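(* Let $f$ be a real analytic map, defined near $0\in\mathbb{R}$, with $f(0)=0$ and $f'(0)=-1$. Then there exists a polynomial vector field of the form $$\dot x=-y+P(x,y),\qquad \dot y=x+Q(x,y),$$ where $P$ and $Q$ are polynomials starting with terms of order at least two, such that $f$ is locally (near the origin) $\mathcal{C}^\infty$-conjugate to the half-return map $\Pi_+$ of this vector field.
   Context: Half-return map: for a planar system $\dot x=-y+P(x,y)$, $\dot y=x+Q(x,y)$ with $P,Q$ analytic and starting with at least second order terms, the origin is monodromic. In polar coordinates $r^2=x^2+y^2$, $\theta=\arctan(y/x)$, let $r(\theta;x)$ denote the solution passing through the point $(x,0)$ at $\theta=0$, i.e. $r(0;x)=x$, for $x>0$ small. The half-return map $\Pi_+:(0,\epsilon)\to\mathbb{R}^-$ sends $x$ to the abscissa of the first intersection, in positive time, with the negative $x$-axis of the orbit that at time $t=0$ passes through $(x,0)$; thus $\Pi_+(x)=-r(\pi;x)$. It has an analytic extension to a neighborhood of $0$ in $\mathbb{R}$, also denoted $\Pi_+$, of the form $\Pi_+(x)=-x+O(x^2)$; the conjugacy refers to this extension. *)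

(* Defs.v *)
(* Stdlib real numbers with Coquelicot. *)
From Stdlib Require Import Reals.
From Coquelicot Require Import Coquelicot.
Open Scope R_scope.

Definition analytic_at (f : R -> R) (x0 : R) : Prop :=
  exists a : nat -> R, locally x0 (fun x => is_pseries a (x - x0) (f x)).

(* One neighbourhood of x0 on which the derivatives of every order exist. *)
Definition smooth_near (f : R -> R) (x0 : R) : Prop :=
  locally x0 (fun x => forall n : nat, ex_derive_n f n x).

(* P is a polynomial function of two variables all of whose monomials have
   total degree at least k; the zero polynomial is allowed. *)
Definition is_poly2_order_ge (k : nat) (P : R -> R -> R) : Prop :=
  exists (N : nat) (c : nat -> nat -> R),
    (forall i j : nat, (i + j < k)%nat -> c i j = 0) /\
    (forall x y : R,
       P x y = sum_n (fun i => sum_n (fun j => c i j * x ^ i * y ^ j) N) N).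

(* t |-> (u t, v t) solves x' = -y + P(x,y), y' = x + Q(x,y) on [0, T]. *)
Definition is_orbit (P Q : R -> R -> R) (T : R) (u v : R -> R) : Prop :=
  forall t : R, 0 <= t <= T ->
    is_derive u t (- v t + P (u t) (v t)) /\
    is_derive v t (u t + Q (u t) (v t)).

(* y is the abscissa of the first intersection, in positive time, of the orbit
   starting at (x, 0) with the negative x-axis. *)
Definition half_return (P Q : R -> R -> R) (x y : R) : Prop :=
  exists (T : R) (u v : R -> R),
    0 < T /\ is_orbit P Q T u v /\
    u 0 = x /\ v 0 = 0 /\
    (forall t : R, 0 < t < T -> ~ (u t < 0 /\ v t = 0)) /\
    y < 0 /\ u T = y /\ v T = 0.

(* Pi represents the germ at 0 of the analytic extension of the half-return
   map, which is itself defined only for small x > 0. *)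
Definition is_half_return_map (P Q : R -> R -> R) (Pi : R -> R) : Prop :=
  analytic_at Pi 0 /\
  exists eps : R, 0 < eps /\
    forall x : R, 0 < x < eps -> half_return P Q x (Pi x).

(* h is a local C^infinity diffeomorphism of (R, 0), with local inverse g. *)
Definition smooth_conjugate_at0 (f1 f2 : R -> R) : Prop :=
  exists h g : R -> R,
    h 0 = 0 /\ g 0 = 0 /\
    smooth_near h 0 /\ smooth_near g 0 /\
    locally 0 (fun x => g (h x) = x) /\
    locally 0 (fun y => h (g y) = y) /\
    locally 0 (fun x => h (f1 x) = f2 (h x)).

(* Main.v *)
(* If f∘f is the identity near 0, then (x - f(x)) / 2 conjugates f to -x, the half-return map
   of the linear centre.  Otherwise g = f∘f = x + a x^(p+1) + ... with p = 2m even, and there is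
   a Fatou coordinate Psi(x) = K(x) / x^p + b ln|x| with Psi∘f = Psi + 1/2 and K smooth across 0.
   When g is attracting, Psi is a truncated formal solution plus a series over the orbit of g:
   the equation Psi∘g = Psi + 1 has formal solutions because x^(i-p)∘g - x^(i-p) has order i;
   the correction is C^j when the truncation order is large, because g^n = O(n^(-1/p)) while
   its derivatives grow polynomially; and telescoping shows that Psi does not depend on the
   truncation order.  Since Psi∘f - Psi is g-invariant and has a Laurent expansion common to both
   sides of 0, it is constant, hence equal to 1/2.  The repelling case is the one of f^(-1).
   On the other side, the system theta' = 1 + b' r^p, r' = c r^(p+1) has explicit orbits, and its
   half-return map is the translation by 1/2 in the coordinate K(0) / y^p + b ln|y| for suitable
   b', c.  It is -x exp(tau(x^p)), where tau is analytic as the solution of a quadratic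
   differential equation.  The conjugacy is x exp(sigma(x)), where the implicit equation
   K(0) e^(-p sigma) + b x^p sigma = K(x) expresses that it transforms Psi into that
   coordinate. *)
Require Import Defs.
From Stdlib Require Import Reals Lra Lia Arith ClassicalEpsilon.
From Coquelicot Require Import Coquelicot.
Open Scope R_scope.

(** Only three data of [f] survive up to smooth conjugacy: the exponent p = 2m, the value K(0) and
    the residue b. The vector field is built from these three alone, and K(0) is kept as a parameter
    instead of being normalised by scaling. The obstacle is the origin. Since [f] exchanges the two
    sides of 0, a Fatou coordinate built on one side separately would give no conjugacy that is
    smooth at 0. Hence Psi is encoded by K, which is smooth on a full neighbourhood, and by ln|x|;
    since p is even, x^p and |x| treat both sides alike. The price is that the correction series has
    to be controlled with all its derivatives up to 0, where the convergence of the iterates is only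
    polynomial. Raising the truncation order buys as many powers of the iterate as the derivatives
    cost. Two tools solve implicit equations. The conjugacy only has to be smooth, so a C^1 implicit
    function theorem followed by a bootstrap is enough. The half-return map has to be analytic, so
    its exponent is produced as a convergent power series. *)

(** * Derivation rules on R and neighbourhoods of 0 *)

Lemma is_derive_cast (f : R -> R) (x l l' : R) :
  is_derive f x l -> l = l' -> is_derive f x l'.
Proof. intros H E; rewrite <- E; exact H. Qed.

Lemma is_derive_multR (u v : R -> R) (x a b : R) :
  is_derive u x a -> is_derive v x b ->
  is_derive (fun t => u t * v t) x (a * v x + u x * b).
Proof.
  intros Hu Hv. apply (is_derive_mult u v x a b Hu Hv).
  intros; apply Rmult_comm.
Qed.

Lemma is_derive_plusR (u v : R -> R) (x a b : R) :
  is_derive u x a -> is_derive v x b ->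
  is_derive (fun t => u t + v t) x (a + b).
Proof. intros Hu Hv. exact (is_derive_plus u v x a b Hu Hv). Qed.

Lemma is_derive_compR (u v : R -> R) (x a b : R) :
  is_derive u (v x) a -> is_derive v x b ->
  is_derive (fun t => u (v t)) x (a * b).
Proof.
  intros Hu Hv. eapply is_derive_cast.
  apply (is_derive_comp u v x a b Hu Hv). unfold scal; simpl; unfold mult; simpl; ring.
Qed.

Lemma is_derive_invR (u : R -> R) (x a : R) :
  is_derive u x a -> u x <> 0 ->
  is_derive (fun t => / u t) x (- a * (/ u x * / u x)).
Proof.
  intros Hu H0. eapply is_derive_cast.
  apply (is_derive_inv u x a Hu H0). field; exact H0.
Qed.

Lemma is_derive_continuity_pt (u : R -> R) (x a : R) :
  is_derive u x a -> continuity_pt u x.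
Proof.
  intros H. apply derivable_continuous_pt. exists a. now apply is_derive_Reals.
Qed.

Lemma is_derive_eps (u : R -> R) (x l : R) :
  is_derive u x l <->
  forall eps, 0 < eps -> exists del, 0 < del /\
    forall y, Rabs (y - x) < del -> Rabs (u y - u x - l * (y - x)) <= eps * Rabs (y - x).
Proof.
  split.
  - intros [_ H] eps He. specialize (H x (fun P h => h) (mkposreal eps He)).
    destruct H as [del Hdel]. exists del. split. apply cond_pos.
    intros y Hy. specialize (Hdel y Hy).
    replace (u y - u x - l * (y - x)) with (u y - u x - (y - x) * l) by ring. exact Hdel.
  - intros H. split. apply is_linear_scal_l.
    intros x0 Hx0. rewrite <- (@is_filter_lim_locally_unique R_AbsRing R_NormedModule x x0 Hx0).
    intros eps. destruct (H eps (cond_pos eps)) as [del [Hd Hdel]].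
    exists (mkposreal del Hd). intros y Hy. specialize (Hdel y Hy).
    replace (u y - u x - l * (y - x)) with (u y - u x - (y - x) * l) in Hdel by ring. exact Hdel.
Qed.

Lemma sum_SnR (a : nat -> R) (n : nat) : sum_n a (S n) = sum_n a n + a (S n).
Proof. apply (sum_Sn a n). Qed.

Lemma locally_abs_lt (d x : R) : Rabs x < d -> locally x (fun y => Rabs y < d).
Proof.
  intros H. assert (H0 : 0 < d - Rabs x) by lra.
  exists (mkposreal _ H0). intros y Hy.
  change (Rabs (y - x) < d - Rabs x) in Hy.
  replace y with ((y - x) + x) by ring.
  pose proof (Rabs_triang (y - x) x). lra.
Qed.

Lemma locally_0_abs (P : R -> Prop) :
  locally 0 P <-> exists d, 0 < d /\ forall x, Rabs x < d -> P x.
Proof.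
  split.
  - intros [e He]. exists e. split. apply cond_pos.
    intros x Hx. apply He. change (Rabs (x - 0) < e). now rewrite Rminus_0_r.
  - intros [d [Hd H]]. exists (mkposreal d Hd). intros y Hy. apply H.
    change (Rabs (y - 0) < d) in Hy. now rewrite Rminus_0_r in Hy.
Qed.

(** * Smooth functions near 0 *)

(** The derivatives are existentially quantified rather than taken from [Derive_n], so that closure
    under products, inverses and compositions goes by induction on the order, without formulas for
    higher derivatives. Order [n] asks that [n] successive derivatives exist; in [smooth_on] the
    continuity of each comes from the next order. *)
Fixpoint Ck (d : R) (n : nat) (u : R -> R) : Prop :=
  match n with
  | 0%nat => True
  | S k => exists u', (forall x, Rabs x < d -> is_derive u x (u' x)) /\ Ck d k u'
  end.

Definition smooth_on (d : R) (u : R -> R) : Prop := forall n, Ck d n u.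

Lemma Ck_ext (d : R) (n : nat) (u v : R -> R) :
  (forall x, Rabs x < d -> u x = v x) -> Ck d n u -> Ck d n v.
Proof.
  revert u v; induction n as [|n IH]; intros u v E; simpl; auto.
  intros [u' [H1 H2]]. exists u'. split; auto.
  intros x Hx. apply (is_derive_ext_loc u); auto.
  generalize (locally_abs_lt d x Hx). apply filter_imp. auto.
Qed.

Lemma Ck_pred (d : R) (n : nat) (u : R -> R) : Ck d (S n) u -> Ck d n u.
Proof.
  revert u; induction n as [|n IH]; intros u. simpl; auto.
  intros [u' [H1 H2]]. exists u'. split; auto.
Qed.

Lemma Ck_shrink (d e : R) (n : nat) (u : R -> R) : e <= d -> Ck d n u -> Ck e n u.
Proof.
  intros He; revert u; induction n as [|n IH]; intros u; simpl; auto.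
  intros [u' [H1 H2]]. exists u'. split; auto. intros x Hx; apply H1; lra.
Qed.

Lemma Ck_const (d c : R) (n : nat) : Ck d n (fun _ => c).
Proof.
  revert c; induction n as [|n IH]; intros c; simpl; auto.
  exists (fun _ => 0). split; auto. intros x _. apply @is_derive_const.
Qed.

Lemma Ck_id (d : R) (n : nat) : Ck d n (fun x => x).
Proof.
  destruct n as [|n]; simpl; auto.
  exists (fun _ => 1). split. intros; apply @is_derive_id. apply Ck_const.
Qed.

Lemma Ck_plus (d : R) (n : nat) (u v : R -> R) :
  Ck d n u -> Ck d n v -> Ck d n (fun x => u x + v x).
Proof.
  revert u v; induction n as [|n IH]; intros u v; simpl; auto.
  intros [u' [H1 H2]] [v' [H3 H4]]. exists (fun x => u' x + v' x). split; auto.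
  intros x Hx. apply is_derive_plusR; auto.
Qed.

Lemma Ck_mult (d : R) (n : nat) (u v : R -> R) :
  Ck d n u -> Ck d n v -> Ck d n (fun x => u x * v x).
Proof.
  revert u v; induction n as [|n IH]; intros u v Hu Hv; simpl; auto.
  pose proof (Ck_pred _ _ _ Hu). pose proof (Ck_pred _ _ _ Hv).
  destruct Hu as [u' [H1 H2]], Hv as [v' [H3 H4]].
  exists (fun x => u' x * v x + u x * v' x). split.
  intros x Hx. apply is_derive_multR; auto.
  apply Ck_plus; apply IH; auto.
Qed.

Lemma Ck_scal (d c : R) (n : nat) (u : R -> R) : Ck d n u -> Ck d n (fun x => c * u x).
Proof. intros; apply Ck_mult; auto; apply Ck_const. Qed.

Lemma Ck_opp (d : R) (n : nat) (u : R -> R) : Ck d n u -> Ck d n (fun x => - u x).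
Proof.
  intros H. apply (Ck_ext d n (fun x => (-1) * u x)). intros; ring. now apply Ck_scal.
Qed.

Lemma Ck_minus (d : R) (n : nat) (u v : R -> R) :
  Ck d n u -> Ck d n v -> Ck d n (fun x => u x - v x).
Proof. intros. apply Ck_plus; auto. now apply Ck_opp. Qed.

Lemma Ck_pow (d : R) (n k : nat) (u : R -> R) : Ck d n u -> Ck d n (fun x => u x ^ k).
Proof.
  intros H; induction k as [|k IH]; simpl. apply Ck_const. now apply Ck_mult.
Qed.

Lemma Ck_inv (d : R) (n : nat) (u : R -> R) :
  (forall x, Rabs x < d -> u x <> 0) -> Ck d n u -> Ck d n (fun x => / u x).
Proof.
  intros H0; revert u H0; induction n as [|n IH]; intros u H0 Hu; simpl; auto.
  pose proof (Ck_pred _ _ _ Hu) as Hu0. destruct Hu as [u' [H1 H2]].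
  exists (fun x => - u' x * (/ u x * / u x)). split.
  intros x Hx. apply is_derive_invR; auto.
  apply Ck_mult. now apply Ck_opp. apply Ck_mult; auto.
Qed.

Lemma Ck_exp (d : R) (n : nat) (u : R -> R) : Ck d n u -> Ck d n (fun x => exp (u x)).
Proof.
  induction n as [|n IH]; intros Hu; simpl; auto.
  pose proof (Ck_pred _ _ _ Hu). destruct Hu as [u' [H1 H2]].
  exists (fun x => exp (u x) * u' x). split.
  intros x Hx. apply is_derive_compR; auto. apply is_derive_exp.
  apply Ck_mult; auto.
Qed.

Lemma Ck_ln (d : R) (n : nat) (u : R -> R) :
  (forall x, Rabs x < d -> 0 < u x) -> Ck d n u -> Ck d n (fun x => ln (u x)).
Proof.
  destruct n as [|n]; intros H0 Hu; simpl; auto.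
  pose proof (Ck_pred _ _ _ Hu). destruct Hu as [u' [H1 H2]].
  exists (fun x => / u x * u' x). split.
  intros x Hx. apply is_derive_compR; auto. apply is_derive_ln; auto.
  apply Ck_mult; auto. apply Ck_inv; auto. intros x Hx. specialize (H0 x Hx). lra.
Qed.

Lemma Ck_comp (d e : R) (n : nat) (u v : R -> R) :
  (forall x, Rabs x < d -> Rabs (v x) < e) -> Ck e n u -> Ck d n v ->
  Ck d n (fun x => u (v x)).
Proof.
  intros Hm; revert u; induction n as [|n IH]; intros u Hu Hv; simpl; auto.
  pose proof (Ck_pred _ _ _ Hv) as Hv0.
  destruct Hu as [u' [H1 H2]], Hv as [v' [H3 H4]].
  exists (fun x => u' (v x) * v' x). split.
  intros x Hx. apply is_derive_compR; auto.
  apply Ck_mult; auto.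
Qed.

Lemma smooth_on_Derive (d : R) (u : R -> R) : smooth_on d u ->
  (forall x, Rabs x < d -> is_derive u x (Derive u x)) /\ smooth_on d (Derive u).
Proof.
  intros H. split.
  - intros x Hx. destruct (H 1%nat) as [u' [H1 _]].
    apply Derive_correct. exists (u' x). auto.
  - intros n. destruct (H (S n)) as [u' [H1 H2]].
    apply (Ck_ext d n u'); auto. intros x Hx. symmetry. apply is_derive_unique; auto.
Qed.

Lemma smooth_on_continuity (d : R) (u : R -> R) (x : R) :
  smooth_on d u -> Rabs x < d -> continuity_pt u x.
Proof.
  intros H Hx. eapply is_derive_continuity_pt. now apply (smooth_on_Derive d u H).
Qed.

Lemma smooth_on_shrink (d e : R) (u : R -> R) : e <= d -> smooth_on d u -> smooth_on e u.
Proof. intros He H n. apply (Ck_shrink d); auto. Qed.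

Lemma smooth_on_Derive_n (d : R) (u : R -> R) (k : nat) :
  smooth_on d u -> smooth_on d (Derive_n u k).
Proof.
  intros H; induction k as [|k IH]; simpl; auto.
  now apply (proj2 (smooth_on_Derive _ _ IH)).
Qed.

Lemma smooth_on_near (d : R) (u : R -> R) : 0 < d -> smooth_on d u -> smooth_near u 0.
Proof.
  intros Hd H. apply locally_0_abs. exists d. split; auto.
  intros x Hx [|n]; simpl; auto.
  exists (Derive (Derive_n u n) x).
  apply (smooth_on_Derive d); auto. now apply smooth_on_Derive_n.
Qed.

Lemma continuity_pt_near (u : R -> R) (x e : R) : continuity_pt u x -> 0 < e ->
  exists d, 0 < d /\ forall y, Rabs (y - x) < d -> Rabs (u y - u x) < e.
Proof.
  intros H He. destruct (H e He) as [a [Ha H1]]. exists a. split; auto.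
  intros y Hy. destruct (Req_dec y x) as [->|Hn].
  rewrite Rminus_diag, Rabs_R0; auto.
  apply H1. split; auto. split; auto. exact I.
Qed.

Lemma continuity_pt_near0 (u : R -> R) (e : R) : continuity_pt u 0 -> 0 < e ->
  exists d, 0 < d /\ forall y, Rabs y < d -> Rabs (u y - u 0) < e.
Proof.
  intros H He. destruct (continuity_pt_near u 0 e H He) as [d [Hd H1]].
  exists d. split; auto. intros y Hy. apply H1. now rewrite Rminus_0_r.
Qed.

Lemma MVT_abs (u u' : R -> R) (d x y : R) : Rabs x < d -> Rabs y < d ->
  (forall z, Rabs z < d -> is_derive u z (u' z)) ->
  exists z, Rabs z < d /\ Rmin x y <= z <= Rmax x y /\ u y - u x = u' z * (y - x).
Proof.
  intros Hx Hy H.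
  assert (Hb : forall z, Rmin x y <= z <= Rmax x y -> Rabs z < d).
  { intros z Hz. apply Rabs_def2 in Hx, Hy. apply Rabs_def1.
    unfold Rmax, Rmin in Hz; destruct (Rle_dec x y); lra.
    unfold Rmax, Rmin in Hz; destruct (Rle_dec x y); lra. }
  destruct (MVT_gen u x y u') as [c [Hc E]].
  intros z Hz; apply H, Hb; lra.
  intros z Hz; eapply is_derive_continuity_pt; apply H, Hb; lra.
  exists c. auto.
Qed.

(** * Smooth division by x (Hadamard's lemma) *)

Definition quot0 (u : R -> R) (x : R) : R :=
  if Req_EM_T x 0 then Derive u 0 else (u x - u 0) / x.

Lemma quot0_spec (u : R -> R) (x : R) : u x = u 0 + x * quot0 u x.
Proof. unfold quot0. destruct (Req_EM_T x 0) as [->|H]. ring. field; auto. Qed.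

Lemma quot0_0 (u : R -> R) : quot0 u 0 = Derive u 0.
Proof. unfold quot0. destruct (Req_EM_T 0 0) as [_|H]; auto. now elim H. Qed.

Lemma abs_seg_lt (d x t : R) : Rabs x < d -> 0 <= t <= 1 -> Rabs (t * x) < d.
Proof.
  intros Hx Ht. rewrite Rabs_mult, (Rabs_pos_eq t) by lra.
  pose proof (Rabs_pos x). nra.
Qed.

(** Integrate u' along the segment from 0 to x. The factor [t ^ 0] and the form [Derive_n u 1]
    present the integral as the member k = 0 of the family of [moment_derive]. *)
Lemma quot0_RInt (d : R) (u : R -> R) (x : R) : smooth_on d u -> Rabs x < d ->
  quot0 u x = RInt (fun t => t ^ 0 * Derive_n u 1 (t * x)) 0 1.
Proof.
  intros Hu Hx. symmetry.
  destruct (smooth_on_Derive _ _ Hu) as [H1 H2].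
  unfold quot0; destruct (Req_EM_T x 0) as [->|Hn].
  - rewrite (RInt_ext _ (fun _ => Derive u 0)).
    rewrite RInt_const. unfold scal; simpl; unfold mult; simpl; ring.
    intros t _. simpl. rewrite Rmult_0_r. apply Rmult_1_l.
  - apply is_RInt_unique.
    apply (is_RInt_ext (fun t => / x * (Derive u (t * x) * x))).
    intros t _; change (Derive_n u 1) with (Derive u); simpl; field; auto.
    replace ((u x - u 0) / x) with (/ x * (u (1 * x) - u (0 * x)))
      by (rewrite Rmult_1_l, Rmult_0_l; field; auto).
    apply (is_RInt_scal (fun t => Derive u (t * x) * x) 0 1 (/ x)).
    apply (is_RInt_derive (fun t => u (t * x)) (fun t => Derive u (t * x) * x)).
    + intros t Ht. rewrite Rmin_left, Rmax_right in Ht by lra.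
      apply is_derive_compR. apply H1. now apply abs_seg_lt.
      eapply is_derive_cast. apply is_derive_multR. apply @is_derive_id.
      apply @is_derive_const. unfold zero, one; simpl. ring.
    + intros t Ht. rewrite Rmin_left, Rmax_right in Ht by lra.
      apply continuity_pt_filterlim.
      assert (continuity_pt (fun t => t * x) t).
      { eapply is_derive_continuity_pt. apply is_derive_multR. apply @is_derive_id.
        apply @is_derive_const. }
      apply continuity_pt_mult.
      apply (continuity_pt_comp (fun t => t * x)). auto.
      apply (smooth_on_continuity d); auto. now apply abs_seg_lt.
      apply continuity_pt_const. now intros a b.
Qed.

(** Differentiation under the integral sign raises [k] by one, so these moments form a family closed
    under differentiation. Smoothness of the quotient follows by induction on the order, for all [k]
    at once. *)
Lemma moment_derive (d : R) (u : R -> R) (k : nat) (x : R) :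
  smooth_on d u -> Rabs x < d ->
  is_derive (fun x => RInt (fun t => t ^ k * Derive_n u (S k) (t * x)) 0 1) x
    (RInt (fun t => t ^ S k * Derive_n u (S (S k)) (t * x)) 0 1).
Proof.
  intros Hu Hx.
  set (w := Derive_n u (S k)).
  assert (Hw : smooth_on d w) by now apply smooth_on_Derive_n.
  destruct (smooth_on_Derive _ _ Hw) as [H1 H2].
  assert (HD : forall y t, Rabs y < d -> 0 <= t <= 1 ->
     is_derive (fun z => t ^ k * w (t * z)) y (t ^ S k * Derive w (t * y))).
  { intros y t Hy Ht.
    eapply is_derive_cast. apply is_derive_multR. apply @is_derive_const.
    apply is_derive_compR. apply H1. now apply abs_seg_lt.
    eapply is_derive_multR. apply @is_derive_const. apply @is_derive_id.
    unfold zero, one; simpl; ring. }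
  assert (HC : forall v j, smooth_on d v -> forall y t, Rabs y < d -> 0 <= t <= 1 ->
     continuity_2d_pt (fun y t => t ^ j * v (t * y)) y t).
  { intros v j Hv y t Hy Ht. apply continuity_2d_pt_mult.
    - apply (continuity_1d_2d_pt_comp (fun t => t ^ j) (fun _ t => t)).
      apply derivable_continuous_pt, derivable_pt_pow. apply continuity_2d_pt_id2.
    - apply (continuity_1d_2d_pt_comp v (fun y t => t * y)).
      apply (smooth_on_continuity d); auto. now apply abs_seg_lt.
      apply continuity_2d_pt_mult. apply continuity_2d_pt_id2. apply continuity_2d_pt_id1. }
  eapply is_derive_cast.
  apply (is_derive_RInt_param (fun y t => t ^ k * w (t * y)) 0 1 x).
  - generalize (locally_abs_lt d x Hx). apply filter_imp. intros y Hy t Ht.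
    rewrite Rmin_left, Rmax_right in Ht by lra. eexists; now apply HD.
  - intros t Ht. rewrite Rmin_left, Rmax_right in Ht by lra.
    assert (Hd : 0 < d - Rabs x) by lra.
    assert (Ht' : Rabs (t * x) < d) by now apply abs_seg_lt.
    apply (continuity_2d_pt_ext_loc (fun y t => t ^ S k * Derive w (t * y))).
    + destruct (continuity_2d_pt_mult (fun y t => t) (fun y t => y) x t
         (continuity_2d_pt_id2 _ _) (continuity_2d_pt_id1 _ _)
         (mkposreal (d - Rabs (t * x)) ltac:(lra))) as [e He].
      exists e. intros y s Hy Hs. specialize (He y s Hy Hs). simpl in He.
      symmetry. apply is_derive_unique.
      eapply is_derive_cast. apply is_derive_multR. apply @is_derive_const.
      apply (is_derive_compR w). apply H1.
      { replace (s * y) with ((s * y - t * x) + t * x) by ring.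
        pose proof (Rabs_triang (s * y - t * x) (t * x)). lra. }
      eapply is_derive_multR. apply @is_derive_const. apply @is_derive_id.
      unfold zero, one; simpl; ring.
    + now apply HC.
  - generalize (locally_abs_lt d x Hx). apply filter_imp. intros y Hy.
    apply (@ex_RInt_continuous R_CompleteNormedModule). intros t Ht.
    rewrite Rmin_left, Rmax_right in Ht by lra.
    apply continuity_pt_filterlim.
    intros e He. destruct (HC w k Hw y t Hy Ht (mkposreal e He)) as [del Hdel].
    exists del. split. apply cond_pos. intros s [_ Hs]. apply Hdel; auto.
    rewrite Rminus_diag, Rabs_R0. apply cond_pos.
  - apply RInt_ext. intros t Ht. rewrite Rmin_left, Rmax_right in Ht by lra.
    apply is_derive_unique. apply HD; auto. lra.
Qed.

Lemma quot0_smooth (d : R) (u : R -> R) : smooth_on d u -> smooth_on d (quot0 u).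
Proof.
  intros Hu n.
  apply (Ck_ext d n (fun x => RInt (fun t => t ^ 0 * Derive_n u 1 (t * x)) 0 1)).
  intros x Hx. symmetry. now apply quot0_RInt with d.
  assert (H : forall k, Ck d n (fun x => RInt (fun t => t ^ k * Derive_n u (S k) (t * x)) 0 1)).
  { induction n as [|n IH]; intros k; simpl; auto.
    exists (fun x => RInt (fun t => t ^ S k * Derive_n u (S (S k)) (t * x)) 0 1).
    split; auto. intros x Hx. now apply (moment_derive d). }
  apply (H 0%nat).
Qed.

(** * Sequences of functions with controlled derivatives, and their series *)

(* All derivatives up to order [j] of [u n] are O(w n), uniformly on |x| < d. *)
Fixpoint seqO (d : R) (w : nat -> R) (j : nat) (u : nat -> R -> R) : Prop :=
  (exists C, forall n x, Rabs x < d -> Rabs (u n x) <= C * w n) /\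
  match j with
  | 0%nat => True
  | S k => exists u', (forall n x, Rabs x < d -> is_derive (u n) x (u' n x)) /\ seqO d w k u'
  end.

(** The shift to [S n] keeps every weight at least 1, so that weights grow with the exponent and
    [/ weight 2] is a summable reference sequence. *)
Definition weight (p : nat) (n : nat) : R := INR (S n) ^ p.

Lemma weight_ge1 (p n : nat) : 1 <= weight p n.
Proof. apply pow_R1_Rle. rewrite S_INR. pose proof (pos_INR n). lra. Qed.

Lemma seqO_bound (d : R) (w : nat -> R) (j : nat) (u : nat -> R -> R) :
  seqO d w j u -> exists C, forall n x, Rabs x < d -> Rabs (u n x) <= C * w n.
Proof. destruct j; now intros [H _]. Qed.

Lemma seqO_pred (d : R) (w : nat -> R) (j : nat) (u : nat -> R -> R) :
  seqO d w (S j) u -> seqO d w j u.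
Proof.
  revert u; induction j as [|j IH]; intros u [H1 [u' [H2 H3]]].
  split; auto. split; auto. exists u'; auto.
Qed.

Lemma seqO_ext (d : R) (w : nat -> R) (j : nat) (u v : nat -> R -> R) :
  (forall n x, Rabs x < d -> u n x = v n x) -> seqO d w j u -> seqO d w j v.
Proof.
  intros E; destruct j as [|j]; intros [[C H1] H2]; (split; [exists C; intros n x Hx; rewrite <- E; auto|]).
  exact I.
  destruct H2 as [u' [H2 H3]]. exists u'. split; auto.
  intros n x Hx. apply (is_derive_ext_loc (u n)); auto.
  generalize (locally_abs_lt d x Hx). apply filter_imp. auto.
Qed.

Lemma seqO_weight (d : R) (w w' : nat -> R) (j : nat) (u : nat -> R -> R) (A : R) :
  (forall n, 0 <= w n <= A * w' n) -> seqO d w j u -> seqO d w' j u.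
Proof.
  intros Hw; revert u; induction j as [|j IH]; intros u [[C H1] H2].
  all: assert (HC : forall n x, Rabs x < d -> Rabs (u n x) <= (Rabs C * A) * w' n).
  1, 3: intros n x Hx; specialize (H1 n x Hx); specialize (Hw n);
    pose proof (Rle_abs C); pose proof (Rabs_pos C);
    apply Rle_trans with (1 := H1); rewrite Rmult_assoc;
    apply Rle_trans with (Rabs C * w n); [apply Rmult_le_compat_r | apply Rmult_le_compat_l]; lra.
  split; eauto. split; eauto. destruct H2 as [u' [H2 H3]]. exists u'; auto.
Qed.

Lemma seqO_mult (d : R) (w w' : nat -> R) (j : nat) (u v : nat -> R -> R) :
  seqO d w j u -> seqO d w' j v ->
  seqO d (fun n => w n * w' n) j (fun n x => u n x * v n x).
Proof.
  assert (HB : forall j u v, seqO d w j u -> seqO d w' j v ->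
    exists C, forall n x, Rabs x < d -> Rabs (u n x * v n x) <= C * (w n * w' n)).
  { clear; intros j u v Hu Hv. destruct (seqO_bound _ _ _ _ Hu) as [C H1].
    destruct (seqO_bound _ _ _ _ Hv) as [C' H2]. exists (C * C'). intros n x Hx.
    rewrite Rabs_mult. replace (C * C' * (w n * w' n)) with ((C * w n) * (C' * w' n)) by ring.
    apply Rmult_le_compat; auto; apply Rabs_pos. }
  assert (HP : forall j u v, seqO d (fun n => w n * w' n) j u -> seqO d (fun n => w n * w' n) j v ->
    seqO d (fun n => w n * w' n) j (fun n x => u n x + v n x)).
  { clear. induction j as [|j IH]; intros u v [[C H1] H2] [[C' H3] H4].
    all: assert (exists C, forall n x, Rabs x < d -> Rabs (u n x + v n x) <= C * (w n * w' n))
     by (exists (C + C'); intros n x Hx; specialize (H1 n x Hx); specialize (H3 n x Hx);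
         pose proof (Rabs_triang (u n x) (v n x)); lra).
    split; auto. split; auto.
    destruct H2 as [u' [H5 H6]], H4 as [v' [H7 H8]].
    exists (fun n x => u' n x + v' n x). split; auto.
    intros n x Hx; apply is_derive_plusR; auto. }
  revert u v; induction j as [|j IH]; intros u v Hu Hv.
  split; auto. apply (HB 0%nat); auto.
  split. now apply (HB (S j)).
  pose proof (seqO_pred _ _ _ _ Hu). pose proof (seqO_pred _ _ _ _ Hv).
  destruct Hu as [_ [u' [H5 H6]]], Hv as [_ [v' [H7 H8]]].
  exists (fun n x => u' n x * v n x + u n x * v' n x). split.
  intros n x Hx; apply is_derive_multR; auto.
  apply HP; apply IH; auto.
Qed.

Lemma bounded_on_inner (d0 d : R) (u : R -> R) : d < d0 -> smooth_on d0 u ->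
  exists C, forall x, Rabs x < d -> Rabs (u x) <= C.
Proof.
  intros Hd Hu. destruct (Rle_dec d 0) as [Hd0|Hd0].
  exists 0; intros x Hx; pose proof (Rabs_pos x); lra.
  assert (Hc : forall c, - d <= c <= d -> continuity_pt (fun x => Rabs (u x)) c).
  { intros c Hc. apply (continuity_pt_comp u Rabs).
    apply (smooth_on_continuity d0); auto. apply Rabs_def1; lra. apply Rcontinuity_abs. }
  destruct (continuity_ab_maj (fun x => Rabs (u x)) (- d) d) as [M [HM _]]; auto. lra.
  exists (Rabs (u M)). intros x Hx. apply HM. apply Rabs_def2 in Hx. lra.
Qed.

(** The chain rule gains one order: polynomial control of the derivatives [v n] up to order [j]
    controls [phi (u n)] up to order [S j]. This gain drives the induction on the order for the
    iterates. The condition [d < d0] makes [phi] and its derivatives bounded on the range of the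
    [u n]. *)
Lemma seqO_comp (d0 d : R) (j : nat) (phi : R -> R) (u v : nat -> R -> R) (p : nat) :
  d < d0 -> smooth_on d0 phi ->
  (forall n x, Rabs x < d -> Rabs (u n x) < d) ->
  (forall n x, Rabs x < d -> is_derive (u n) x (v n x)) ->
  seqO d (weight p) j v ->
  exists q, seqO d (weight q) (S j) (fun n x => phi (u n x)).
Proof.
  intros Hd Hphi Hm Hder.
  assert (HB : forall phi, smooth_on d0 phi -> forall q,
    exists C, forall n x, Rabs x < d -> Rabs (phi (u n x)) <= C * weight q n).
  { intros ph Hph q. destruct (bounded_on_inner d0 d ph Hd Hph) as [C HC].
    exists (Rabs C). intros n x Hx. pose proof (weight_ge1 q n).
    pose proof (Rle_abs C). pose proof (Rabs_pos C). specialize (HC (u n x) (Hm n x Hx)). nra. }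
  assert (HW : forall q j w, seqO d (weight q) j w -> seqO d (weight p) j v ->
    seqO d (weight (q + p)) j (fun n x => w n x * v n x)).
  { clear. intros q j w Hw Hv.
    apply (seqO_weight d (fun n => weight q n * weight p n) _ _ _ 1).
    intros n. unfold weight. rewrite pow_add.
    pose proof (weight_ge1 q n). pose proof (weight_ge1 p n). unfold weight in *. nra.
    now apply seqO_mult. }
  assert (HS : forall j q phi, smooth_on d0 phi ->
     seqO d (weight q) j (fun n x => Derive phi (u n x)) -> seqO d (weight p) j v ->
     exists q, seqO d (weight q) (S j) (fun n x => phi (u n x))).
  { clear j phi Hphi. intros j q phi Hphi H Hv. exists (q + p)%nat. split. now apply HB.
    exists (fun n x => Derive phi (u n x) * v n x). split; auto.
    intros n x Hx. apply is_derive_compR; auto. apply (smooth_on_Derive d0 phi Hphi).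
    specialize (Hm n x Hx). lra. }
  revert phi Hphi; induction j as [|j IH]; intros phi Hphi Hv;
    pose proof (proj2 (smooth_on_Derive _ _ Hphi)) as Hphi'.
  - apply (HS 0%nat 0%nat); auto. split; auto.
  - destruct (IH (Derive phi) Hphi' (seqO_pred _ _ _ _ Hv)) as [q Hq].
    now apply (HS (S j) q).
Qed.

Fixpoint rsum (u : nat -> R) (n : nat) : R :=
  match n with 0%nat => 0 | S k => rsum u k + u k end.

Lemma seqO_rsum (d : R) (p j : nat) (u : nat -> R -> R) :
  seqO d (weight p) j u -> seqO d (weight (S p)) j (fun n x => rsum (fun i => u i x) n).
Proof.
  assert (HB : forall u, (exists C, forall n x, Rabs x < d -> Rabs (u n x) <= C * weight p n) ->
    exists C, forall n x, Rabs x < d -> Rabs (rsum (fun i => u i x) n) <= C * weight (S p) n).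
  { clear. intros u [C HC]. exists (Rabs C). intros n x Hx.
    assert (Hk : forall k, (k <= n)%nat -> Rabs (rsum (fun i => u i x) k) <= INR k * (Rabs C * weight p n)).
    { induction k as [|k IH]; intros Hk. simpl. rewrite Rabs_R0. lra.
      rewrite S_INR. simpl rsum.
      apply Rle_trans with (1 := Rabs_triang _ _).
      assert (Rabs (u k x) <= Rabs C * weight p n).
      { apply Rle_trans with (1 := HC k x Hx).
        assert (0 <= weight p k <= weight p n).
        { split. pose proof (weight_ge1 p k); lra.
          apply pow_incr. split. apply pos_INR. apply le_INR. lia. }
        pose proof (Rle_abs C). pose proof (Rabs_pos C). nra. }
      specialize (IH ltac:(lia)). lra. }
    specialize (Hk n (le_n n)). apply Rle_trans with (1 := Hk).
    unfold weight. rewrite <- tech_pow_Rmult, S_INR.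
    pose proof (weight_ge1 p n). unfold weight in *. rewrite S_INR in *.
    pose proof (Rabs_pos C). pose proof (pos_INR n).
    replace (Rabs C * ((INR n + 1) * (INR n + 1) ^ p)) with
     (INR n * (Rabs C * (INR n + 1) ^ p) + Rabs C * (INR n + 1) ^ p) by ring.
    assert (0 <= Rabs C * (INR n + 1) ^ p) by (apply Rmult_le_pos; lra). lra. }
  revert u; induction j as [|j IH]; intros u [H1 H2]; split; auto.
  destruct H2 as [u' [H2 H3]]. exists (fun n x => rsum (fun i => u' i x) n). split; auto.
  intros n x Hx. induction n as [|n IHn]; simpl. apply @is_derive_const.
  apply is_derive_plusR; auto.
Qed.

Lemma ex_series_inv_sq : ex_series (fun n => / weight 2 n).
Proof.
  (* Telescoping bound, from 1 / (y + 1)^2 <= 1 / y - 1 / (y + 1). *)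
  assert (H : forall N, sum_n (fun n => / weight 2 n) N <= 2 - / INR (S N)).
  { induction N as [|N IH].
    - rewrite sum_O. unfold weight. simpl. lra.
    - rewrite sum_Sn. unfold plus; simpl plus.
      apply Rle_trans with (1 := Rplus_le_compat_r _ _ _ IH).
      unfold weight. rewrite (S_INR (S N)). set (y := INR (S N)).
      assert (1 <= y) by (unfold y; rewrite S_INR; pose proof (pos_INR N); lra).
      apply Rminus_le.
      replace (2 - / y + / (y + 1) ^ 2 - (2 - / (y + 1))) with (- (/ (y * (y + 1) ^ 2))) by (field; lra).
      assert (0 < / (y * (y + 1) ^ 2)); [|lra].
      apply Rinv_0_lt_compat. apply Rmult_lt_0_compat. lra. apply pow_lt; lra. }
  assert (Hex : ex_finite_lim_seq (sum_n (fun n => / weight 2 n))).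
  { apply (ex_finite_lim_seq_incr _ 2).
    - intros n. rewrite sum_Sn. unfold plus; simpl.
      pose proof (weight_ge1 2 (S n)). assert (0 < / weight 2 (S n)) by (apply Rinv_0_lt_compat; lra).
      unfold weight in H1; simpl in H1. unfold weight; simpl. lra.
    - intros n. specialize (H n). pose proof (lt_0_INR (S n) ltac:(lia)).
      assert (0 < / INR (S n)) by now apply Rinv_0_lt_compat. lra. }
  destruct Hex as [l Hl]. exists l. exact Hl.
Qed.

Lemma Series_dom (a b : nat -> R) (C : R) : ex_series b ->
  (forall n, Rabs (a n) <= C * b n) -> ex_series a /\ Rabs (Series a) <= C * Series b.
Proof.
  intros Hb H.
  assert (Hcb : ex_series (fun n => C * b n)) by now apply @ex_series_scal.
  assert (Ha : ex_series (fun n => Rabs (a n))).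
  { apply (@ex_series_le R_AbsRing R_CompleteNormedModule) with (b := fun n => C * b n); auto.
    intros n. unfold norm; simpl; unfold abs; simpl. rewrite Rabs_Rabsolu. auto. }
  split. now apply ex_series_Rabs.
  apply Rle_trans with (1 := Series_Rabs _ Ha).
  rewrite <- Series_scal_l. apply Series_le; auto.
  intros n; split; auto. apply Rabs_pos.
Qed.

(** One order is lost because termwise differentiation is justified by the second derivatives: each
    term differs from its linear part at x by at most a summable constant times (y - x)^2, and these
    errors add up. *)
Lemma Ck_Series (d : R) (j : nat) (t : nat -> R -> R) :
  seqO d (fun n => / weight 2 n) (S j) t -> Ck d j (fun x => Series (fun n => t n x)).
Proof.
  revert t; induction j as [|j IH]; intros t Ht. exact I.
  destruct Ht as [[C0 H0] [t' [H1 Ht']]]. exists (fun x => Series (fun n => t' n x)).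
  split; auto.
  assert (Ht2 := Ht'). destruct Ht' as [[C1 H2] [t'' [H3 H4]]].
  destruct (seqO_bound _ _ _ _ H4) as [C2 H5]. clear H4 IH.
  set (W := Series (fun n => / weight 2 n)).
  intros x Hx.
  assert (E0 : forall y, Rabs y < d -> ex_series (fun n => t n y))
    by (intros y Hy; apply (fun h => proj1 (Series_dom _ _ C0 ex_series_inv_sq h)); auto).
  assert (E1 : ex_series (fun n => t' n x))
    by (apply (fun h => proj1 (Series_dom _ _ C1 ex_series_inv_sq h)); auto).
  assert (HT : forall n y, Rabs y < d ->
    Rabs (t n y - t n x - t' n x * (y - x)) <= (Rabs C2 * Rabs (y - x) ^ 2) * / weight 2 n).
  { intros n y Hy.
    destruct (MVT_abs (t n) (t' n) d x y Hx Hy (H1 n)) as [z [Hz [Hzb ->]]].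
    replace (t' n z * (y - x) - t' n x * (y - x)) with ((t' n z - t' n x) * (y - x)) by ring.
    destruct (MVT_abs (t' n) (t'' n) d x z Hx Hz (H3 n)) as [s [Hs [_ ->]]].
    rewrite !Rabs_mult.
    assert (Hzx : Rabs (z - x) <= Rabs (y - x)).
    { unfold Rmin, Rmax in Hzb. destruct (Rle_dec x y).
      rewrite !Rabs_pos_eq; lra. rewrite !Rabs_left1; lra. }
    specialize (H5 n s Hs). pose proof (weight_ge1 2 n).
    assert (0 < / weight 2 n) by (apply Rinv_0_lt_compat; lra).
    pose proof (Rle_abs C2). pose proof (Rabs_pos C2).
    pose proof (Rabs_pos (z - x)). pose proof (Rabs_pos (y - x)). pose proof (Rabs_pos (t'' n s)).
    replace (Rabs C2 * Rabs (y - x) ^ 2 * / weight 2 n)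
      with (Rabs C2 * / weight 2 n * Rabs (y - x) * Rabs (y - x)) by ring.
    apply Rmult_le_compat_r; auto. apply Rmult_le_compat; auto.
    apply Rle_trans with (1 := H5). apply Rmult_le_compat_r; lra. }
  apply is_derive_eps. intros eps Heps.
  assert (HD : 0 < eps / (Rabs C2 * Rabs W + 1)).
  { apply Rdiv_lt_0_compat; auto.
    pose proof (Rabs_pos C2); pose proof (Rabs_pos W); nra. }
  exists (Rmin (d - Rabs x) (eps / (Rabs C2 * Rabs W + 1))). split.
  apply Rmin_pos; lra.
  intros y Hyx0. pose proof (Rlt_le_trans _ _ _ Hyx0 (Rmin_r _ _)) as Hyx.
  pose proof (Rlt_le_trans _ _ _ Hyx0 (Rmin_l _ _)) as Hy0.
  assert (Hy : Rabs y < d).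
  { replace y with ((y - x) + x) by ring. pose proof (Rabs_triang (y - x) x). lra. }
  replace (Series (fun n => t n y) - Series (fun n => t n x) -
    Series (fun n => t' n x) * (y - x))
   with (Series (fun n => t n y - t n x - t' n x * (y - x))).
  2: { rewrite Series_minus, Series_minus, Series_scal_r. ring.
       auto. auto. apply @ex_series_minus; auto. now apply @ex_series_scal_r. }
  destruct (Series_dom (fun n => t n y - t n x - t' n x * (y - x)) (fun n => / weight 2 n)
    (Rabs C2 * Rabs (y - x) ^ 2) ex_series_inv_sq) as [_ HS].
  { intros n. now apply HT. }
  apply Rle_trans with (1 := HS). fold W.
  pose proof (Rabs_pos C2); pose proof (Rabs_pos W). pose proof (Rabs_pos (y - x)).
  pose proof (Rle_abs W).
  apply Rle_trans with ((Rabs C2 * Rabs W + 1) * Rabs (y - x) * Rabs (y - x)).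
  { replace (Rabs C2 * Rabs (y - x) ^ 2 * W) with (Rabs C2 * W * (Rabs (y - x) * Rabs (y - x))) by ring.
    rewrite (Rmult_assoc (_ + 1)). apply Rmult_le_compat_r. nra.
    assert (Rabs C2 * W <= Rabs C2 * Rabs W) by (apply Rmult_le_compat_l; auto). lra. }
  apply Rmult_le_compat_r; auto.
  apply Rmult_lt_compat_l with (r := Rabs C2 * Rabs W + 1) in Hyx; [|nra].
  apply Rlt_le, Rlt_le_trans with (1 := Hyx). right. field. nra.
Qed.

(** * A Fatou coordinate for the square of the germ *)

(** A germ tangent to the identity that attracts on both sides of 0. The pointwise inequalities hold
    for |x| < d0, while uniform bounds on smooth functions are taken on the smaller interval |x| <
    d, whose closure lies inside. *)
Record contraction (d0 d c : R) (p : nat) (A g : R -> R) : Prop := {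
  ctr_dom : 0 < d < d0;
  ctr_c : 0 < c;
  ctr_p : (0 < p)%nat;
  ctr_even : forall x : R, 0 <= x ^ p;
  ctr_A : smooth_on d0 A;
  ctr_A0 : A 0 <> 0;
  ctr_g : smooth_on d0 g;
  ctr_eq : forall x, Rabs x < d0 -> g x = x * (1 + x ^ p * A x);
  ctr_lo : forall x, Rabs x < d0 -> / 2 <= 1 + x ^ p * A x;
  ctr_hi : forall x, Rabs x < d0 -> 1 + x ^ p * A x <= 1 - c * x ^ p;
  ctr_der : forall x, Rabs x < d0 -> 0 < Derive g x <= 1
}.

Lemma contraction_abs (d0 d c : R) (p : nat) (A g : R -> R) (x : R) :
  contraction d0 d c p A g -> Rabs x < d0 -> Rabs (g x) <= Rabs x.
Proof.
  intros H Hx. rewrite (ctr_eq _ _ _ _ _ _ H x Hx), Rabs_mult.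
  pose proof (ctr_lo _ _ _ _ _ _ H x Hx). pose proof (ctr_hi _ _ _ _ _ _ H x Hx).
  pose proof (ctr_even _ _ _ _ _ _ H x). pose proof (ctr_c _ _ _ _ _ _ H).
  rewrite (Rabs_pos_eq (1 + _)) by lra. rewrite <- (Rmult_1_r (Rabs x)) at 2.
  apply Rmult_le_compat_l. apply Rabs_pos. nra.
Qed.

Lemma contraction_iter_abs (d0 d c : R) (p : nat) (A g : R -> R) (x : R) (n : nat) :
  contraction d0 d c p A g -> Rabs x < d0 -> Rabs (Nat.iter n g x) <= Rabs x.
Proof.
  intros H Hx; induction n as [|n IH]; simpl. lra.
  apply Rle_trans with (2 := IH). apply (contraction_abs d0 d c p A); auto. lra.
Qed.

(** Along an orbit w = x^p satisfies w' <= w (1 - c w), so 1 / w grows at least linearly. *)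
Lemma contraction_decay (d0 d c : R) (p : nat) (A g : R -> R) :
  contraction d0 d c p A g ->
  exists C, 0 < C /\ forall n x, Rabs x < d -> (Nat.iter n g x) ^ p <= C / INR (S n).
Proof.
  intros H. pose proof (ctr_c _ _ _ _ _ _ H) as Hc. pose proof (ctr_dom _ _ _ _ _ _ H) as Hd.
  (* The summand [d ^ p] starts the induction; [/ c] gives 1 <= c C, which lets N + 1 be replaced by
     N + c C in the induction step. *)
  set (C := d ^ p + / c).
  assert (Hic : 0 < / c) by now apply Rinv_0_lt_compat.
  assert (Hdp : 0 < d ^ p) by (apply pow_lt; lra).
  assert (HC : 1 <= c * C).
  { unfold C. rewrite Rmult_plus_distr_l, Rinv_r by lra. nra. }
  exists C. split. unfold C; lra.
  intros n x Hx. induction n as [|n IH].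
  - simpl. replace (C / 1) with C by field. apply Rle_trans with (d ^ p).
    rewrite <- (Rabs_pos_eq (x ^ p)) by apply (ctr_even _ _ _ _ _ _ H).
    rewrite <- RPow_abs. apply pow_incr. split. apply Rabs_pos. lra. unfold C; lra.
  - simpl Nat.iter. set (y := Nat.iter n g x) in *.
    assert (Hy : Rabs y < d0).
    { pose proof (contraction_iter_abs d0 d c p A g x n H ltac:(lra)). fold y in H0. lra. }
    rewrite (ctr_eq _ _ _ _ _ _ H y Hy), Rpow_mult_distr.
    pose proof (ctr_lo _ _ _ _ _ _ H y Hy). pose proof (ctr_hi _ _ _ _ _ _ H y Hy).
    pose proof (ctr_even _ _ _ _ _ _ H y). set (w := y ^ p) in *. set (l := 1 + w * A y) in *.
    assert (Hl : l ^ p <= 1 - c * w).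
    { destruct p as [|p]. pose proof (ctr_p _ _ _ _ _ _ H); lia.
      simpl. apply Rle_trans with (l * 1); [|lra]. apply Rmult_le_compat_l. lra.
      rewrite <- (pow1 p). apply pow_incr. nra. }
    apply Rle_trans with (w * (1 - c * w)). apply Rmult_le_compat_l; auto.
    set (N := INR (S n)) in *. rewrite (S_INR (S n)). fold N.
    assert (HN : 1 <= N) by (unfold N; rewrite S_INR; pose proof (pos_INR n); lra).
    assert (IH' : w * N <= C).
    { apply Rmult_le_compat_r with (r := N) in IH; [|lra].
      unfold Rdiv in IH. rewrite Rmult_assoc, Rinv_l in IH by lra. lra. }
    apply Rmult_le_reg_r with (N + 1). lra.
    replace (C / (N + 1) * (N + 1)) with C by (field; lra).
    apply Rle_trans with (w * (1 - c * w) * (N + c * C)).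
    apply Rmult_le_compat_l. apply Rmult_le_pos; lra. lra.
    replace (w * (1 - c * w) * (N + c * C)) with ((w * N + c * w * C) * (1 - c * w)) by ring.
    apply Rle_trans with ((C + c * w * C) * (1 - c * w)).
    apply Rmult_le_compat_r; lra.
    assert (0 < C) by (unfold C; lra).
    assert (0 <= C * ((c * w) * (c * w))) by (apply Rmult_le_pos; nra).
    replace ((C + c * w * C) * (1 - c * w)) with (C - C * ((c * w) * (c * w))) by ring. lra.
Qed.

Fixpoint iter_deriv (g : R -> R) (n : nat) (x : R) : R :=
  match n with
  | 0%nat => 1
  | S k => Derive g (Nat.iter k g x) * iter_deriv g k x
  end.

Lemma is_derive_iter (d0 d c : R) (p : nat) (A g : R -> R) (n : nat) (x : R) :
  contraction d0 d c p A g -> Rabs x < d0 ->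
  is_derive (fun x => Nat.iter n g x) x (iter_deriv g n x).
Proof.
  intros H Hx; induction n as [|n IH]; simpl. apply @is_derive_id.
  apply (is_derive_compR g (fun x => Nat.iter n g x)); auto.
  apply (smooth_on_Derive d0 g (ctr_g _ _ _ _ _ _ H)).
  pose proof (contraction_iter_abs d0 d c p A g x n H Hx). lra.
Qed.

Lemma is_derive_iter_deriv (d0 d c : R) (p : nat) (A g : R -> R) (n : nat) (x : R) :
  contraction d0 d c p A g -> Rabs x < d0 ->
  is_derive (iter_deriv g n) x
   (iter_deriv g n x *
    rsum (fun i => Derive (Derive g) (Nat.iter i g x) * / Derive g (Nat.iter i g x)
                   * iter_deriv g i x) n).
Proof.
  intros H Hx; induction n as [|n IH].
  - simpl. rewrite Rmult_0_r. apply @is_derive_const.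
  - assert (Hy : Rabs (Nat.iter n g x) < d0)
     by (pose proof (contraction_iter_abs d0 d c p A g x n H Hx); lra).
    simpl. eapply is_derive_cast. apply is_derive_multR. 2: exact IH.
    apply (is_derive_compR (Derive g) (fun x => Nat.iter n g x)).
    apply (smooth_on_Derive d0 (Derive g)); auto.
    apply (smooth_on_Derive d0 g (ctr_g _ _ _ _ _ _ H)).
    apply (is_derive_iter d0 d c p A); auto.
    simpl. field. pose proof (ctr_der _ _ _ _ _ _ H _ Hy). lra.
Qed.

Lemma iter_deriv_bound (d0 d c : R) (p : nat) (A g : R -> R) (n : nat) (x : R) :
  contraction d0 d c p A g -> Rabs x < d0 -> 0 <= iter_deriv g n x <= 1.
Proof.
  intros H Hx; induction n as [|n IH]; simpl. lra.
  assert (Hy : Rabs (Nat.iter n g x) < d0)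
     by (pose proof (contraction_iter_abs d0 d c p A g x n H Hx); lra).
  pose proof (ctr_der _ _ _ _ _ _ H _ Hy). nra.
Qed.

Lemma seqO_mult_weight (d : R) (p q j : nat) (u v : nat -> R -> R) :
  seqO d (weight p) j u -> seqO d (weight q) j v ->
  seqO d (weight (p + q)) j (fun n x => u n x * v n x).
Proof.
  intros Hu Hv. apply (seqO_weight d (fun n => weight p n * weight q n) _ _ _ 1).
  intros n. unfold weight. rewrite pow_add.
  pose proof (weight_ge1 p n). pose proof (weight_ge1 q n). unfold weight in *. nra.
  now apply seqO_mult.
Qed.

(* The derivatives of the iterates of [g] grow at most polynomially because
   [v_n' = v_n * sum_(i < n) (g'' / g')(g^i) * v_i] for [v_n = (g^n)'], which lies in [[0, 1]]. *)
Lemma seqO_iter_deriv (d0 d c : R) (p : nat) (A g : R -> R) (j : nat) :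
  contraction d0 d c p A g -> exists q, seqO d (weight q) j (iter_deriv g).
Proof.
  intros H. pose proof (ctr_dom _ _ _ _ _ _ H) as Hd.
  assert (HB : forall q, exists C, forall n x, Rabs x < d ->
    Rabs (iter_deriv g n x) <= C * weight q n).
  { intros q. exists 1. intros n x Hx. pose proof (weight_ge1 q n).
    destruct (iter_deriv_bound d0 d c p A g n x H ltac:(lra)).
    rewrite Rabs_pos_eq; lra. }
  induction j as [|j [q IH]].
  - exists 0%nat. split; auto.
  - destruct (smooth_on_Derive _ _ (ctr_g _ _ _ _ _ _ H)) as [_ H1].
    destruct (smooth_on_Derive _ _ H1) as [_ H2].
    destruct (seqO_comp d0 d j (fun y => Derive (Derive g) y * / Derive g y)
      (fun n x => Nat.iter n g x) (iter_deriv g) q) as [r Hr].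
    + apply Hd.
    + intros n. apply Ck_mult; auto. apply Ck_inv; auto.
      intros y Hy. pose proof (ctr_der _ _ _ _ _ _ H y Hy). lra.
    + intros n x Hx. pose proof (contraction_iter_abs d0 d c p A g x n H ltac:(lra)). lra.
    + intros n x Hx. apply (is_derive_iter d0 d c p A); auto. lra.
    + exact IH.
    + apply seqO_pred in Hr.
      exists (q + S (r + q))%nat. split. apply HB.
      eexists. split.
      intros n x Hx. apply (is_derive_iter_deriv d0 d c p A g n x H). lra.
      apply seqO_mult_weight; auto.
      apply (seqO_rsum d (r + q) j (fun n x => Derive (Derive g) (Nat.iter n g x) *
         / Derive g (Nat.iter n g x) * iter_deriv g n x)).
      now apply seqO_mult_weight.
Qed.

(** Differentiating y^(M + j + 1) s(y) along the iterates gives y^(M + j) times another smooth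
    factor, times the derivative of the iterate: one power of y is spent and a polynomial weight is
    paid. After [j] derivatives the factor rho^M is still available. The exponent [q] is chosen
    before [M] and [s], so that [M] can afterwards be taken large enough to beat the weight. *)
Lemma seqO_iter_pow (d0 d c : R) (p : nat) (A g : R -> R) (rho : nat -> R) (B : R) (j : nat) :
  contraction d0 d c p A g ->
  (forall n, 0 <= rho n <= B) ->
  (forall n x, Rabs x < d -> Rabs (Nat.iter n g x) <= rho n) ->
  exists q, forall M s, smooth_on d0 s ->
    seqO d (fun n => weight q n * rho n ^ M) j
      (fun n x => Nat.iter n g x ^ (M + j) * s (Nat.iter n g x)).
Proof.
  intros H Hr Hu. pose proof (ctr_dom _ _ _ _ _ _ H) as Hd.
  assert (HB : forall q M k s, smooth_on d0 s -> exists C, forall n x, Rabs x < d ->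
    Rabs (Nat.iter n g x ^ (M + k) * s (Nat.iter n g x)) <= C * (weight q n * rho n ^ M)).
  { intros q M k s Hs. destruct (bounded_on_inner d0 d s) as [C HC]; auto. lra.
    exists (Rabs C * B ^ k). intros n x Hx.
    specialize (Hu n x Hx). specialize (Hr n).
    assert (Hy : Rabs (Nat.iter n g x) < d)
     by (pose proof (contraction_iter_abs d0 d c p A g x n H ltac:(lra)); lra).
    specialize (HC _ Hy). set (y := Nat.iter n g x) in *.
    rewrite Rabs_mult, <- RPow_abs, pow_add.
    assert (0 <= Rabs y ^ M <= rho n ^ M).
    { split. apply pow_le, Rabs_pos. apply pow_incr. split; auto. apply Rabs_pos. }
    assert (0 <= Rabs y ^ k <= B ^ k).
    { split. apply pow_le, Rabs_pos. apply pow_incr. split. apply Rabs_pos. lra. }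
    pose proof (weight_ge1 q n). pose proof (Rle_abs C). pose proof (Rabs_pos (s y)).
    apply Rle_trans with ((rho n ^ M * B ^ k) * Rabs C).
    apply Rmult_le_compat; try lra. apply Rmult_le_pos; lra. apply Rmult_le_compat; lra.
    replace (Rabs C * B ^ k * (weight q n * rho n ^ M)) with
      (weight q n * (rho n ^ M * B ^ k * Rabs C)) by ring.
    assert (0 <= rho n ^ M * B ^ k * Rabs C) by (repeat apply Rmult_le_pos; try lra; apply Rabs_pos).
    nra. }
  induction j as [|j [q IH]].
  - exists 0%nat. intros M s Hs. split; auto.
  - destruct (seqO_iter_deriv d0 d c p A g j H) as [r Hv].
    exists (q + r)%nat. intros M s Hs. split. now apply HB.
    destruct (smooth_on_Derive _ _ Hs) as [Hs1 Hs2].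
    exists (fun n x => (Nat.iter n g x ^ (M + j) *
       (INR (M + S j) * s (Nat.iter n g x) + Nat.iter n g x * Derive s (Nat.iter n g x))) *
       iter_deriv g n x).
    split.
    + intros n x Hx.
      assert (Hy : Rabs (Nat.iter n g x) < d)
        by (pose proof (contraction_iter_abs d0 d c p A g x n H ltac:(lra)); lra).
      apply (is_derive_compR (fun y => y ^ (M + S j) * s y) (fun x => Nat.iter n g x)).
      2: apply (is_derive_iter d0 d c p A); auto; lra.
      eapply is_derive_cast. apply is_derive_multR.
      apply (is_derive_pow (fun y => y)). apply @is_derive_id. apply Hs1; lra.
      unfold one; simpl. rewrite Nat.add_succ_r; simpl Nat.pred. simpl pow. ring.
    + apply (seqO_weight d (fun n => (weight q n * rho n ^ M) * weight r n) _ _ _ 1).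
      intros n. unfold weight. rewrite pow_add.
      pose proof (weight_ge1 q n). pose proof (weight_ge1 r n). unfold weight in *.
      assert (0 <= rho n ^ M) by (apply pow_le, Hr).
      split. repeat apply Rmult_le_pos; lra. right; ring.
      apply seqO_mult; auto.
      apply (IH M (fun y => INR (M + S j) * s y + y * Derive s y)).
      intros k. apply Ck_plus. now apply Ck_scal. apply Ck_mult; auto. apply Ck_id.
Qed.

Lemma seqO_iter_summable (d0 d c : R) (p : nat) (A g : R -> R) (j : nat) :
  contraction d0 d c p A g ->
  exists M0, forall M s, (M0 <= M)%nat -> smooth_on d0 s ->
    seqO d (fun n => / weight 2 n) j (fun n x => Nat.iter n g x ^ M * s (Nat.iter n g x)).
Proof.
  intros H. destruct (contraction_decay _ _ _ _ _ _ H) as [C [HC Hdec]].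
  pose proof (ctr_p _ _ _ _ _ _ H) as Hp. pose proof (lt_0_INR p Hp) as Hp'.
  assert (HN : forall n, 0 < C / INR (S n)) by (intros n; apply Rdiv_lt_0_compat; auto; apply lt_0_INR; lia).
  (* The p-th root of the decay bound on the p-th powers of the iterates. *)
  set (rho := fun n => Rpower (C / INR (S n)) (/ INR p)).
  assert (Hrp : forall n, rho n ^ p = C / INR (S n)).
  { intros n. unfold rho. rewrite <- Rpower_pow by apply exp_pos.
    rewrite Rpower_mult, Rinv_l, Rpower_1; auto. lra. }
  assert (Hle : forall a b, 0 <= a -> 0 < b -> a ^ p <= b ^ p -> a <= b).
  { intros a b Ha Hb Hab. destruct (Rle_or_lt a b) as [|Hba]; auto.
    assert (b ^ p < a ^ p); [|lra].
    clear -Hp Hba Hb. induction p as [|[|p] IH]. lia. simpl; lra.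
    specialize (IH ltac:(lia)). rewrite <- (tech_pow_Rmult b), <- (tech_pow_Rmult a).
    apply Rmult_gt_0_lt_compat; auto. apply pow_lt; auto. lra. }
  destruct (seqO_iter_pow d0 d c p A g rho (rho 0%nat) j H) as [q Hq].
  - intros n. split. left; apply exp_pos. apply Hle; try apply exp_pos. left; apply exp_pos.
    rewrite !Hrp. apply Rmult_le_compat_l. lra. apply Rinv_le_contravar.
    simpl; lra. apply le_INR; lia.
  - intros n x Hx. apply Hle. apply Rabs_pos. apply exp_pos.
    rewrite RPow_abs, Rabs_pos_eq by apply (ctr_even _ _ _ _ _ _ H).
    rewrite Hrp. auto.
  (* Since rho^p = C / (n + 1), the power rho^(p (q + 2)) cancels the weight (n + 1)^q and leaves a
     multiple of 1 / (n + 1)^2. The remaining [j] powers are those spent by the derivatives. *)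
  - exists (p * (q + 2) + j)%nat. intros M s HM Hs.
    apply (seqO_weight d (fun n => weight q n * rho n ^ (p * (q + 2))) _ _ _ (C ^ (q + 2))).
    + intros n. rewrite pow_mult, Hrp. unfold weight. unfold Rdiv. rewrite Rpow_mult_distr.
      pose proof (lt_0_INR (S n) ltac:(lia)) as HS. set (y := INR (S n)) in *.
      rewrite pow_inv.
      assert (0 < / y ^ (q + 2)) by (apply Rinv_0_lt_compat, pow_lt, HS).
      assert (0 < y ^ q) by now apply pow_lt. assert (0 < C ^ (q + 2)) by now apply pow_lt.
      split. apply Rmult_le_pos. lra. apply Rmult_le_pos; lra. rewrite (pow_add y).
      right. field. split; [|apply pow_nonzero]; lra.
    + apply (seqO_ext d _ j (fun n x => Nat.iter n g x ^ (p * (q + 2) + j) *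
        (fun y => y ^ (M - (p * (q + 2) + j)) * s y) (Nat.iter n g x))).
      intros n x Hx. rewrite <- Rmult_assoc, <- pow_add. do 2 f_equal. lia.
      apply (Hq _ (fun y => y ^ (M - (p * (q + 2) + j)) * s y)). intros k. apply Ck_mult; auto. apply Ck_pow, Ck_id.
Qed.

Definition ln1p_quot (y : R) : R := quot0 (fun t => ln (1 + t)) y.

Lemma ln1p_quot_spec (y : R) : ln (1 + y) = y * ln1p_quot y.
Proof.
  unfold ln1p_quot. rewrite (quot0_spec (fun t => ln (1 + t)) y) at 1.
  rewrite Rplus_0_r, ln_1. ring.
Qed.

Lemma ln1p_quot_smooth : smooth_on 1 ln1p_quot.
Proof.
  apply quot0_smooth. intros n. apply Ck_ln.
  intros x Hx. apply Rabs_def2 in Hx. lra.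
  apply Ck_plus. apply Ck_const. apply Ck_id.
Qed.

Lemma ln1p_quot_0 : ln1p_quot 0 = 1.
Proof.
  unfold ln1p_quot. rewrite quot0_0. apply is_derive_unique. auto_derive; [lra|field].
Qed.

Definition exp_quot (y : R) : R := quot0 exp y.

Lemma exp_quot_spec (y : R) : exp y = 1 + y * exp_quot y.
Proof. unfold exp_quot. rewrite (quot0_spec exp y) at 1. now rewrite exp_0. Qed.

Lemma exp_quot_smooth (d : R) : smooth_on d exp_quot.
Proof. apply quot0_smooth. intros n. apply (Ck_exp d n (fun x => x)), Ck_id. Qed.

Lemma exp_quot_0 : exp_quot 0 = 1.
Proof.
  unfold exp_quot. rewrite quot0_0. apply is_derive_unique.
  eapply is_derive_cast. apply is_derive_exp. apply exp_0.
Qed.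

(** * Formal solution of the Abel equation and its correction along orbits *)

Section Fatou.

Variables (d0 d c : R) (p : nat) (A g : R -> R).
Hypothesis H : contraction d0 d c p A g.

Let gam (x : R) : R := 1 + x ^ p * A x.
(** With [gam] the multiplier g(x) / x, this is ln(gam) / x^p extended smoothly across 0, where its
    value is A(0). *)
Let l (x : R) : R := A x * ln1p_quot (x ^ p * A x).

Let gam_ln (x : R) : ln (gam x) = x ^ p * l x.
Proof. unfold gam, l. rewrite ln1p_quot_spec. ring. Qed.

Let gam_bound (x : R) : Rabs x < d0 -> / 2 <= gam x <= 1.
Proof.
  intros Hx. pose proof (ctr_lo _ _ _ _ _ _ H x Hx). pose proof (ctr_hi _ _ _ _ _ _ H x Hx).
  pose proof (ctr_even _ _ _ _ _ _ H x). pose proof (ctr_c _ _ _ _ _ _ H).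
  unfold gam. split. lra. nra.
Qed.

Let l_smooth : smooth_on d0 l.
Proof.
  intros n. pose proof (ctr_A _ _ _ _ _ _ H). apply Ck_mult; auto.
  apply (Ck_comp d0 1 n ln1p_quot (fun x => x ^ p * A x)).
  - intros x Hx. pose proof (gam_bound x Hx). unfold gam in *. apply Rabs_def1; lra.
  - apply ln1p_quot_smooth.
  - apply Ck_mult; auto. apply Ck_pow, Ck_id.
Qed.

Let zero_pow : 0 ^ p = 0.
Proof. apply pow_ne_zero. pose proof (ctr_p _ _ _ _ _ _ H). lia. Qed.

Let l_0 : l 0 = A 0.
Proof. unfold l. rewrite zero_pow, Rmult_0_l, ln1p_quot_0. ring. Qed.

(* The exponent [i = p] would give a constant, which a coboundary cannot see: the
   logarithm replaces it, and its coefficient is the residue. *)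
Let cob (i : nat) (x : R) : R := if Nat.eq_dec i p then ln (Rabs x) else x ^ i / x ^ p.

(** The coboundary of [cob i] divided by x^i. For i <> p it comes from gam^(i - p) - 1 = exp((i - p)
    x^p l) - 1, whose factor x^p cancels the denominator of [cob i]. The value at 0 is (i - p) A(0),
    or A(0) when i = p; being nonzero, it makes the formal equation solvable one coefficient at a
    time. *)
Let e (i : nat) (x : R) : R :=
  if Nat.eq_dec i p then l x
  else (INR i - INR p) * l x * exp_quot ((INR i - INR p) * (x ^ p * l x)).

Let e_smooth (i : nat) : smooth_on d0 (e i).
Proof.
  intros n. unfold e. destruct (Nat.eq_dec i p) as [_|Hi]. apply l_smooth.
  set (q := INR i - INR p). apply Ck_mult. apply Ck_scal, l_smooth.
  apply (Ck_comp d0 (Rabs q * ln 2 + 1) n exp_quot (fun x => q * (x ^ p * l x))).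
  - intros x Hx. rewrite <- gam_ln, Rabs_mult. pose proof (gam_bound x Hx).
    assert (ln (gam x) <= 0) by (rewrite <- ln_1; apply ln_le; lra).
    assert (- ln 2 <= ln (gam x)) by (rewrite <- ln_Rinv by lra; apply ln_le; lra).
    rewrite (Rabs_left1 (ln _)) by lra. pose proof (Rabs_pos q). nra.
  - apply exp_quot_smooth.
  - apply Ck_scal, Ck_mult. apply Ck_pow, Ck_id. apply l_smooth.
Qed.

Let e_0 (i : nat) : e i 0 <> 0.
Proof.
  pose proof (ctr_A0 _ _ _ _ _ _ H).
  unfold e. destruct (Nat.eq_dec i p) as [_|Hi]; rewrite l_0; auto.
  rewrite zero_pow, Rmult_0_l, Rmult_0_r, exp_quot_0, Rmult_1_r.
  apply Rmult_integral_contrapositive_currified; auto.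
  intros E. apply Hi, INR_eq. lra.
Qed.

Let g_eq (x : R) : Rabs x < d0 -> g x = x * gam x.
Proof. apply (ctr_eq _ _ _ _ _ _ H). Qed.

Let cob_eq (i : nat) (x : R) : x <> 0 -> Rabs x < d0 ->
  cob i (g x) - cob i x = x ^ i * e i x.
Proof.
  intros Hx0 Hx. pose proof (gam_bound x Hx). rewrite g_eq by auto.
  unfold cob, e. destruct (Nat.eq_dec i p) as [->|Hi].
  - rewrite Rabs_mult, ln_mult, (Rabs_pos_eq (gam x)) by
      (try apply Rabs_pos_lt; try rewrite Rabs_pos_eq; lra).
    rewrite gam_ln. ring.
  - set (q := INR i - INR p).
    assert (E : gam x ^ i / gam x ^ p = exp (q * ln (gam x))).
    { rewrite <- !Rpower_pow by lra. unfold q, Rpower.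
      rewrite Rmult_minus_distr_r. unfold Rminus, Rdiv. rewrite exp_plus, exp_Ropp. auto. }
    rewrite !Rpow_mult_distr.
    assert (x ^ p <> 0) by now apply pow_nonzero. assert (gam x ^ p <> 0) by (apply pow_nonzero; lra).
    replace (x ^ i * gam x ^ i / (x ^ p * gam x ^ p)) with (x ^ i / x ^ p * (gam x ^ i / gam x ^ p))
      by (field; auto).
    rewrite E, exp_quot_spec, gam_ln. field. auto.
Qed.

(* Solving [1 = sum_i kap i * x ^ i * e i x] formally, one coefficient at a time:
   [1 = sum_(i < N) kap i * x ^ i * e i x + x ^ N * fatou_rem e N x]. *)
Fixpoint fatou_rem (e : nat -> R -> R) (N : nat) : R -> R :=
  match N with
  | 0%nat => fun _ => 1
  | S k => quot0 (fun x => fatou_rem e k x - fatou_rem e k 0 / e k 0 * e k x)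
  end.

Let rem : nat -> R -> R := fatou_rem e.
Let kap (i : nat) : R := rem i 0 / e i 0.

Let rem_eq (k : nat) (x : R) : rem k x = kap k * e k x + x * rem (S k) x.
Proof.
  pose proof (quot0_spec (fun x => rem k x - kap k * e k x) x) as E. cbv beta in E.
  change (quot0 (fun x => rem k x - kap k * e k x)) with (rem (S k)) in E.
  replace (rem k 0 - kap k * e k 0) with 0 in E. lra.
  unfold kap. field. apply e_0.
Qed.

Let rem_smooth (k : nat) : smooth_on d0 (rem k).
Proof.
  unfold rem. induction k as [|k IH]; simpl. intros n; apply Ck_const.
  apply quot0_smooth. intros n. apply Ck_minus; auto. apply Ck_scal, e_smooth.
Qed.

Let rem_sum (N : nat) (x : R) : rsum (fun i => kap i * (x ^ i * e i x)) N + x ^ N * rem N x = 1.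
Proof.
  induction N as [|N IH]. unfold rem; simpl; ring.
  rewrite rem_eq in IH. simpl rsum. simpl pow. lra.
Qed.

(** The solution of h(g(x)) - h(x) = x^N rem_N(x) obtained by summing along the forward orbit; the
    minus sign comes from h(x) = h(g(x)) - x^N rem_N(x), iterated. *)
Let tail (N : nat) (x : R) : R :=
  Series (fun n => - (Nat.iter n g x ^ N * rem N (Nat.iter n g x))).

Let iter_in (n : nat) (x : R) : Rabs x < d -> Rabs (Nat.iter n g x) < d.
Proof.
  intros Hx. pose proof (ctr_dom _ _ _ _ _ _ H).
  pose proof (contraction_iter_abs d0 d c p A g x n H ltac:(lra)). lra.
Qed.

Let iter_lim (x : R) : Rabs x < d -> is_lim_seq (fun n => Nat.iter n g x ^ p) 0.
Proof.
  intros Hx. destruct (contraction_decay _ _ _ _ _ _ H) as [C [HC Hdec]].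
  apply (is_lim_seq_le_le (fun _ => 0) _ (fun n => C * / INR (S n))).
  - intros n. split. apply (ctr_even _ _ _ _ _ _ H). auto.
  - apply is_lim_seq_const.
  - replace (Finite 0) with (Rbar_mult (Finite C) (Finite 0)) by (simpl; f_equal; ring).
    apply is_lim_seq_scal_l.
    apply (is_lim_seq_incr_1 (fun n => / INR n)).
    apply (is_lim_seq_inv _ p_infty). apply is_lim_seq_INR. discriminate.
Qed.

Let iter_0 (n : nat) : Nat.iter n g 0 = 0.
Proof.
  induction n as [|n IH]; auto. simpl. rewrite IH, g_eq. ring.
  rewrite Rabs_R0. pose proof (ctr_dom _ _ _ _ _ _ H). lra.
Qed.

Lemma iter_pow_lim (k : nat) (x : R) : (0 < k)%nat -> Rabs x < d ->
  is_lim_seq (fun n => Nat.iter n g x ^ k) 0.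
Proof.
  intros Hk Hx.
  assert (L : is_lim_seq (fun n => Nat.iter n g x) 0).
  { apply is_lim_seq_spec. intros eps.
    pose proof (iter_lim x Hx) as L. apply is_lim_seq_spec in L.
    assert (He : 0 < eps ^ p) by apply pow_lt, cond_pos.
    destruct (L (mkposreal _ He)) as [N HN]. exists N. intros n Hn. specialize (HN n Hn).
    simpl in HN. rewrite Rminus_0_r in *. rewrite <- RPow_abs in HN.
    destruct (Rlt_or_le (Rabs (Nat.iter n g x)) eps) as [|Hc]; auto.
    assert (eps ^ p <= Rabs (Nat.iter n g x) ^ p); [|lra].
    apply pow_incr. split; auto. left; apply cond_pos. }
  replace (Finite 0) with (Finite (0 ^ k)) by (rewrite pow_ne_zero; auto; lia).
  apply (is_lim_seq_continuous (fun y => y ^ k)); auto.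
  apply derivable_continuous_pt, derivable_pt_pow.
Qed.

Let summable (j : nat) : exists N0, (p < N0)%nat /\ forall N, (N0 <= N)%nat ->
  (forall x, Rabs x < d -> ex_series (fun n => - (Nat.iter n g x ^ N * rem N (Nat.iter n g x)))) /\
  (forall x, Rabs x < d -> ex_series (fun n => Nat.iter n g x ^ N * e N (Nat.iter n g x))) /\
  Ck d j (tail N).
Proof.
  destruct (seqO_iter_summable d0 d c p A g (S j) H) as [M0 HM].
  assert (HS : forall N s, (M0 <= N)%nat -> smooth_on d0 s ->
     forall x, Rabs x < d -> ex_series (fun n => Nat.iter n g x ^ N * s (Nat.iter n g x))).
  { intros N s HN Hs x Hx. destruct (seqO_bound _ _ _ _ (HM N s HN Hs)) as [C HC].
    apply (Series_dom _ _ C ex_series_inv_sq). auto. }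
  exists (M0 + S p)%nat. split. lia. intros N HN. split; [|split].
  - intros x Hx. apply (@ex_series_opp R_AbsRing R_NormedModule). apply HS; auto. lia.
  - intros x Hx. apply HS; auto. lia.
  - apply Ck_Series.
    apply (seqO_ext d _ (S j) (fun n x => Nat.iter n g x ^ N * (fun y => (-1) * rem N y) (Nat.iter n g x))).
    intros n x Hx. ring.
    apply (HM N (fun y => (-1) * rem N y)). lia. intros k. apply Ck_scal, rem_smooth.
Qed.

Let tail_shift (N : nat) (x : R) : Rabs x < d ->
  ex_series (fun n => - (Nat.iter n g x ^ N * rem N (Nat.iter n g x))) ->
  tail N (g x) - tail N x = x ^ N * rem N x.
Proof.
  intros Hx Hs. unfold tail at 2. rewrite Series_incr_1 by auto. simpl Nat.iter at 1 2.
  replace (tail N (g x)) with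
    (Series (fun n => - (Nat.iter (S n) g x ^ N * rem N (Nat.iter (S n) g x)))). ring.
  apply Series_ext. intros n. rewrite Nat.iter_succ_r. auto.
Qed.

Let tail_step (N : nat) (x : R) : (p < N)%nat -> Rabs x < d ->
  ex_series (fun n => - (Nat.iter n g x ^ N * rem N (Nat.iter n g x))) ->
  ex_series (fun n => - (Nat.iter n g x ^ S N * rem (S N) (Nat.iter n g x))) ->
  ex_series (fun n => Nat.iter n g x ^ N * e N (Nat.iter n g x)) ->
  tail N x = tail (S N) x + kap N * x ^ (N - p).
Proof.
  intros HN Hx H1 H2 H3.
  assert (E : tail N x - tail (S N) x =
     (- kap N) * Series (fun n => Nat.iter n g x ^ N * e N (Nat.iter n g x))).
  { unfold tail. rewrite <- Series_minus by auto. rewrite <- Series_scal_l.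
    apply Series_ext. intros n. rewrite (rem_eq N). simpl pow. ring. }
  (* For N > p the N-th coboundary is that of y^(N - p), which tends to 0 along the orbit, so the
     telescoping sum keeps only its initial term. *)
  assert (E2 : Series (fun n => Nat.iter n g x ^ N * e N (Nat.iter n g x)) = - x ^ (N - p)).
  { apply is_series_unique.
    assert (T : forall y, Rabs y < d -> y ^ N * e N y = g y ^ (N - p) - y ^ (N - p)).
    { intros y Hy. destruct (Req_dec y 0) as [->|Hy0].
      - pose proof (iter_0 1) as E0. simpl in E0. rewrite E0.
        rewrite (pow_ne_zero N) by lia. ring.
      - rewrite <- cob_eq; auto. unfold cob. destruct (Nat.eq_dec N p). lia.
        assert (Q : forall z, z <> 0 -> z ^ N / z ^ p = z ^ (N - p)).
        { intros z Hz. replace N with (N - p + p)%nat at 1 by lia. rewrite pow_add.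
          field. now apply pow_nonzero. }
        rewrite !Q; auto. rewrite g_eq.
        assert (Hd := ctr_dom _ _ _ _ _ _ H). pose proof (gam_bound y ltac:(lra)).
        apply Rmult_integral_contrapositive_currified; auto; lra.
        assert (Hd := ctr_dom _ _ _ _ _ _ H). lra.
        assert (Hd := ctr_dom _ _ _ _ _ _ H). lra. }
    change (is_lim_seq (sum_n (fun n => Nat.iter n g x ^ N * e N (Nat.iter n g x))) (- x ^ (N - p))).
    apply (is_lim_seq_ext (fun n => Nat.iter (S n) g x ^ (N - p) - x ^ (N - p))).
    - induction n as [|n IH].
      + rewrite sum_O. simpl Nat.iter. rewrite T; auto.
      + rewrite sum_SnR, <- IH. rewrite (T (Nat.iter (S n) g x)) by auto.
        simpl Nat.iter. ring.
    - replace (Finite (- x ^ (N - p))) with (Finite (0 - x ^ (N - p))) by (f_equal; ring).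
      apply is_lim_seq_minus'. apply (is_lim_seq_incr_1 (fun n => Nat.iter n g x ^ (N - p))).
      apply iter_pow_lim; auto. lia. apply is_lim_seq_const. }
  rewrite E2 in E. lra.
Qed.

(** x^p times the corrected truncation, without its logarithmic term: the index [p] is skipped here
    and reappears as the coefficient [kap p] of ln|x|. *)
Let K (N : nat) (x : R) : R :=
  rsum (fun i => if Nat.eq_dec i p then 0 else kap i * x ^ i) N + x ^ p * tail N x.

Lemma fatou_coordinate : exists K b,
  smooth_on d K /\ K 0 <> 0 /\
  forall x, x <> 0 -> Rabs x < d ->
    K (g x) / g x ^ p + b * ln (Rabs (g x)) = K x / x ^ p + b * ln (Rabs x) + 1.
Proof.
  assert (Hd := ctr_dom _ _ _ _ _ _ H). assert (Hp := ctr_p _ _ _ _ _ _ H).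
  destruct (summable 0) as [N0 [HpN HN]].
  assert (KN : forall k x, Rabs x < d -> K (N0 + k) x = K N0 x).
  { induction k as [|k IH]; intros x Hx. now rewrite Nat.add_0_r.
    rewrite <- IH by auto. rewrite Nat.add_succ_r. set (N := (N0 + k)%nat).
    destruct (HN N ltac:(lia)) as [S1 [S2 _]]. destruct (HN (S N) ltac:(lia)) as [S3 _].
    unfold K. rewrite (tail_step N x) by (auto; lia). simpl rsum.
    destruct (Nat.eq_dec N p). lia.
    replace (x ^ N) with (x ^ p * x ^ (N - p)) by (rewrite <- pow_add; f_equal; lia). ring. }
  exists (K N0), (kap p). split; [|split].
  (* For each order [j] the same function is rewritten with a longer truncation, for which the tail
     is known to be of class C^j. *)
  - intros j. destruct (summable j) as [N1 [_ HN1]].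
    apply (Ck_ext d j (K (N0 + N1))). auto.
    destruct (HN1 (N0 + N1)%nat ltac:(lia)) as [_ [_ HC]].
    unfold K. apply Ck_plus.
    + generalize (N0 + N1)%nat as N. induction N as [|N IH]; simpl. apply Ck_const.
      apply Ck_plus; auto. destruct (Nat.eq_dec N p). apply Ck_const.
      apply Ck_scal, Ck_pow, Ck_id.
    + apply Ck_mult; auto. apply Ck_pow, Ck_id.
  - unfold K. rewrite zero_pow, Rmult_0_l, Rplus_0_r.
    (* At 0 only the leading coefficient remains; it is 1 / e_0(0) because the remainder starts from
       the constant 1. *)
    assert (R0 : forall k, rsum (fun i => if Nat.eq_dec i p then 0 else kap i * 0 ^ i) (S k) = kap 0%nat).
    { induction k as [|k IH].
      - cbn [rsum pow]. destruct (Nat.eq_dec 0 p). lia. ring.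
      - change (rsum (fun i => if Nat.eq_dec i p then 0 else kap i * 0 ^ i) (S k) +
          (if Nat.eq_dec (S k) p then 0 else kap (S k) * 0 ^ S k) = kap 0%nat).
        rewrite IH. destruct (Nat.eq_dec (S k) p). ring. simpl pow. ring. }
    destruct N0 as [|N0]. lia. rewrite R0. unfold kap, rem. simpl.
    apply Rmult_integral_contrapositive_currified. lra. apply Rinv_neq_0_compat, e_0.
  - assert (PE : forall x, x <> 0 -> K N0 x / x ^ p + kap p * ln (Rabs x) =
       rsum (fun i => kap i * cob i x) N0 + tail N0 x).
    { intros x Hx. assert (Hxp : x ^ p <> 0) by now apply pow_nonzero.
      (* The logarithm enters once the partial sum has passed the index [p]. *)
      assert (Q : forall k, rsum (fun i => kap i * cob i x) k =
        rsum (fun i => if Nat.eq_dec i p then 0 else kap i * x ^ i) k / x ^ p +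
        (if le_lt_dec k p then 0 else kap p * ln (Rabs x))).
      { induction k as [|k IH]. simpl. field; auto.
        simpl rsum. rewrite IH. unfold cob.
        destruct (Nat.eq_dec k p) as [Hk|Hk], (le_lt_dec k p), (le_lt_dec (S k) p);
          try lia; try rewrite Hk; field; auto. }
      rewrite Q. unfold K. destruct (le_lt_dec N0 p). lia. field; auto. }
    intros x Hx0 Hx.
    assert (Hg0 : g x <> 0).
    { rewrite g_eq by lra. pose proof (gam_bound x ltac:(lra)).
      apply Rmult_integral_contrapositive_currified; auto; lra. }
    rewrite !PE by auto.
    destruct (HN N0 ltac:(lia)) as [S1 _].
    pose proof (tail_shift N0 x Hx (S1 x Hx)) as T.
    pose proof (rem_sum N0 x) as RS.
    assert (D : rsum (fun i => kap i * cob i (g x)) N0 - rsum (fun i => kap i * cob i x) N0 =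
       rsum (fun i => kap i * (x ^ i * e i x)) N0).
    { generalize N0 as k. induction k as [|k IH]; simpl. ring.
      rewrite <- cob_eq by (auto; lra). lra. }
    lra.
Qed.

End Fatou.

(** * Implicit functions and local inverses *)

(** Existence comes from the intermediate value theorem between the sides s = -e and s = e,
    uniqueness from the lower bound [k] on the derivative in s. Only a first derivative is obtained,
    but its explicit formula lets each application bootstrap to all orders. *)
Lemma implicit_function (F Fx Fs : R -> R -> R) (d e k : R) : 0 < e -> 0 < k ->
  (forall x s, Rabs x < d -> Rabs s <= e -> is_derive (F x) s (Fs x s) /\ k <= Fs x s) ->
  (forall x, Rabs x < d -> F x (- e) < 0 < F x e) ->
  (forall x s, Rabs x < d -> Rabs s < e -> is_derive (fun y => F y s) x (Fx x s)) ->
  (forall x s, Rabs x < d -> Rabs s < e -> continuity_2d_pt Fs x s) ->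
  exists sg : R -> R, forall x, Rabs x < d ->
    Rabs (sg x) < e /\ F x (sg x) = 0 /\
    (forall s, Rabs s < e -> F x s = 0 -> s = sg x) /\
    is_derive sg x (- Fx x (sg x) / Fs x (sg x)).
Proof.
  intros He Hk HFs Hpm HFx Hc.
  assert (Hex : forall x, Rabs x < d -> exists s, Rabs s < e /\ F x s = 0).
  { intros x Hx. destruct (Hpm x Hx) as [Hm Hp].
    destruct (Ranalysis5.IVT_interv (F x) (- e) e) as [z [Hz E]]; auto.
    - intros a Ha. eapply is_derive_continuity_pt. apply HFs; auto. apply Rabs_le; lra.
    - lra.
    - exists z. split; auto. apply Rabs_def1.
      destruct (Req_dec z e) as [->|]; lra. destruct (Req_dec z (- e)) as [->|]; lra. }
  assert (Hmvt : forall x s s', Rabs x < d -> Rabs s < e -> Rabs s' < e ->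
     exists z, Rabs z < e /\ Rabs (z - s) <= Rabs (s' - s) /\ F x s' - F x s = Fs x z * (s' - s)).
  { intros x s s' Hx Hs Hs'. destruct (MVT_abs (F x) (Fs x) e s s' Hs Hs') as [z [Hz [Hb E]]].
    intros z Hz. apply HFs; auto. lra.
    exists z. split; auto. split; auto.
    unfold Rmin, Rmax in Hb. destruct (Rle_dec s s').
    rewrite !Rabs_pos_eq; lra. rewrite !Rabs_left1; lra. }
  set (sg := fun x => epsilon (inhabits 0) (fun s => Rabs s < e /\ F x s = 0)).
  assert (Hsg : forall x, Rabs x < d -> Rabs (sg x) < e /\ F x (sg x) = 0).
  { intros x Hx. apply (epsilon_spec (inhabits 0) (fun s => Rabs s < e /\ F x s = 0)). auto. }
  exists sg. intros x Hx. destruct (Hsg x Hx) as [Hs0 E0].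
  split; auto. split; auto. split.
  { intros s Hs E. destruct (Hmvt x (sg x) s Hx Hs0 Hs) as [z [Hz [_ Ez]]].
    rewrite E, E0 in Ez. destruct (HFs x z Hx ltac:(lra)) as [_ Hkz].
    assert (s - sg x = 0); [|lra].
    destruct (Rmult_integral (Fs x z) (s - sg x)); lra. }
  set (s0 := sg x) in *. set (a := Fx x s0). set (b := Fs x s0).
  destruct (HFs x s0 Hx ltac:(lra)) as [_ Hb]. fold b in Hb.
  (* A local Lipschitz constant of [sg] at x: |F(y, s0)| <= (|a| + 1) |y - x|, and moving s changes
     F at rate at least k. *)
  set (M := (Rabs a + 1) / k).
  assert (HM : 0 < M) by (apply Rdiv_lt_0_compat; pose proof (Rabs_pos a); lra).
  pose proof (proj1 (is_derive_eps _ _ _) (HFx x s0 Hx Hs0)) as HD. fold a in HD.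
  apply is_derive_eps. intros eps Heps.
  (* The two error terms at the end add up to e1 (M + 1) |y - x| = k eps |y - x|, and b >= k. *)
  set (e1 := eps * k / (M + 1)).
  assert (He1 : 0 < e1) by (apply Rdiv_lt_0_compat; nra).
  destruct (HD 1 Rlt_0_1) as [d1 [Hd1 H1]]. destruct (HD e1 He1) as [d2 [Hd2 H2]].
  destruct (Hc x s0 Hx Hs0 (mkposreal e1 He1)) as [d3 H3]. simpl in H3.
  set (del := Rmin (Rmin (d - Rabs x) d1) (Rmin d2 (Rmin d3 (d3 / M)))).
  assert (Hd3 := cond_pos d3).
  exists del. split.
  { repeat apply Rmin_pos; try lra. apply Rdiv_lt_0_compat; lra. }
  intros y Hy.
  assert (Hy1 : Rabs (y - x) < d - Rabs x /\ Rabs (y - x) < d1 /\ Rabs (y - x) < d2 /\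
     Rabs (y - x) < d3 /\ Rabs (y - x) < d3 / M).
  { unfold del in Hy. 
    pose proof (Rmin_l (Rmin (d - Rabs x) d1) (Rmin d2 (Rmin d3 (d3 / M)))).
    pose proof (Rmin_r (Rmin (d - Rabs x) d1) (Rmin d2 (Rmin d3 (d3 / M)))).
    pose proof (Rmin_l (d - Rabs x) d1). pose proof (Rmin_r (d - Rabs x) d1).
    pose proof (Rmin_l d2 (Rmin d3 (d3 / M))). pose proof (Rmin_r d2 (Rmin d3 (d3 / M))).
    pose proof (Rmin_l d3 (d3 / M)). pose proof (Rmin_r d3 (d3 / M)).
    repeat split; lra. }
  destruct Hy1 as [Y0 [Y1 [Y2 [Y3 Y4]]]].
  assert (Hyd : Rabs y < d).
  { replace y with ((y - x) + x) by ring. pose proof (Rabs_triang (y - x) x). lra. }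
  destruct (Hsg y Hyd) as [Hs E]. set (s := sg y) in *.
  destruct (Hmvt y s0 s Hyd Hs0 Hs) as [z [Hz [Hzs Ez]]].
  destruct (HFs y z Hyd ltac:(lra)) as [_ Hkz].
  specialize (H1 y Y1). specialize (H2 y Y2). rewrite E0 in H1, H2. rewrite E in Ez.
  set (r := F y s0 - 0 - a * (y - x)) in *.
  assert (Er : F y s0 = r + a * (y - x)) by (unfold r; ring).
  pose proof (Rabs_pos (y - x)) as Hyx.
  assert (Hss : Rabs (s - s0) <= M * Rabs (y - x)).
  { unfold M. apply Rmult_le_reg_l with k; auto.
    replace (k * ((Rabs a + 1) / k * Rabs (y - x))) with ((Rabs a + 1) * Rabs (y - x)) by (field; lra).
    apply Rle_trans with (Rabs (Fs y z * (s - s0))).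
    rewrite Rabs_mult. apply Rmult_le_compat_r. apply Rabs_pos. pose proof (Rle_abs (Fs y z)); lra.
    rewrite <- Ez. replace (0 - F y s0) with (- (r + a * (y - x))) by lra. rewrite Rabs_Ropp.
    pose proof (Rabs_triang r (a * (y - x))). rewrite (Rabs_mult a) in H. lra. }
  assert (Hcl : Rabs (Fs y z - b) < e1).
  { apply H3; auto. apply Rle_lt_trans with (1 := Hzs). apply Rle_lt_trans with (1 := Hss).
    apply Rmult_lt_compat_l with (r := M) in Y4; auto.
    replace (M * (d3 / M)) with (pos d3) in Y4 by (field; lra). auto. }
  change (sg x) with s0. apply Rmult_le_reg_l with b. lra.
  replace (b * Rabs (s - s0 - - a / b * (y - x))) with
    (Rabs (b * (s - s0 - - a / b * (y - x)))) by (rewrite Rabs_mult, (Rabs_pos_eq b); lra).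
  (* The mean value relation 0 - F(y, s0) = Fs(y, z) (s - s0) eliminates a (y - x). What is left is
     the variation of Fs, controlled by continuity, and the first-order remainder [r] in x. *)
  replace (b * (s - s0 - - a / b * (y - x))) with (- ((Fs y z - b) * (s - s0)) + - r).
  2: { transitivity (b * (s - s0) - Fs y z * (s - s0) - r). ring. rewrite <- Ez, Er. field. lra. }
  apply Rle_trans with (1 := Rabs_triang _ _). rewrite !Rabs_Ropp, Rabs_mult.
  apply Rle_trans with (e1 * (M * Rabs (y - x)) + e1 * Rabs (y - x)).
  apply Rplus_le_compat; auto. apply Rmult_le_compat; auto; try apply Rabs_pos. lra.
  replace (e1 * (M * Rabs (y - x)) + e1 * Rabs (y - x)) with (k * (eps * Rabs (y - x)))
    by (unfold e1; field; lra).
  apply Rmult_le_compat_r; auto. apply Rmult_le_pos; lra.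
Qed.

Lemma smooth_local_inverse (d : R) (h : R -> R) :
  0 < d -> smooth_on d h -> h 0 = 0 -> Derive h 0 <> 0 ->
  exists e r g, 0 < e < d /\ 0 < r /\ smooth_on r g /\ g 0 = 0 /\
    (forall y, Rabs y < r -> Rabs (g y) < e /\ h (g y) = y) /\
    (forall s, Rabs s < e -> Rabs (h s) < r -> g (h s) = s).
Proof.
  intros Hd Hh H0 Ha. set (a := Derive h 0) in *.
  destruct (smooth_on_Derive _ _ Hh) as [Hh1 Hh2].
  assert (Hc0 : continuity_pt (fun s => Derive h s / a) 0).
  { apply continuity_pt_mult. apply (smooth_on_continuity d); auto. now rewrite Rabs_R0.
    apply continuity_pt_const. now intros x y. }
  destruct (continuity_pt_near0 _ (/ 2) Hc0 ltac:(lra)) as [d1 [Hd1 Hc1]].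
  replace (Derive h 0 / a) with 1 in Hc1 by (unfold a; field; auto).
  set (e := Rmin d d1 / 2).
  pose proof (Rmin_l d d1). pose proof (Rmin_r d d1). assert (0 < Rmin d d1) by now apply Rmin_pos.
  assert (He : 0 < e < d) by (unfold e; lra).
  assert (Hlow : forall s, Rabs s <= e -> / 2 <= Derive h s / a).
  { intros s Hs. specialize (Hc1 s ltac:(unfold e in Hs; lra)). apply Rabs_def2 in Hc1. lra. }
  assert (Hend : forall s, Rabs s <= e -> 0 <= s -> s / 2 <= h s / a /\ h (- s) / a <= - s / 2).
  { intros s Hs Hs0.
    destruct (MVT_abs h (Derive h) d 0 s) as [z [Hz [Hzb Ez]]]; auto. now rewrite Rabs_R0. lra.
    destruct (MVT_abs h (Derive h) d 0 (- s)) as [z' [Hz' [Hzb' Ez']]]; auto. now rewrite Rabs_R0.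
    rewrite Rabs_Ropp; lra.
    rewrite Rabs_pos_eq in Hs by auto.
    rewrite Rmin_left, Rmax_right in Hzb by lra. rewrite Rmin_right, Rmax_left in Hzb' by lra.
    pose proof (Hlow z ltac:(apply Rabs_le; lra)). pose proof (Hlow z' ltac:(apply Rabs_le; lra)).
    replace (h s / a) with (Derive h z / a * s) by
      (apply Rmult_eq_reg_r with a; auto; field_simplify; auto; lra).
    replace (h (- s) / a) with (- (Derive h z' / a * s)) by
      (apply Rmult_eq_reg_r with a; auto; field_simplify; auto; lra).
    split; nra. }
  set (r := Rabs a * e / 2).
  assert (Hapos : 0 < Rabs a) by now apply Rabs_pos_lt.
  assert (Hr : 0 < r) by (unfold r; nra).
  assert (Hya : forall y, Rabs y < r -> - (e / 2) < y / a < e / 2).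
  { intros y Hy. apply and_comm, Rabs_def2. unfold Rdiv. rewrite Rabs_mult, Rabs_inv.
    apply Rmult_lt_reg_r with (Rabs a); auto. rewrite Rmult_assoc, Rinv_l by lra. unfold r in Hy. lra. }
  (* Dividing h(s) = y by a = h'(0) makes the derivative in s close to 1 whatever the sign of a. *)
  destruct (implicit_function (fun y s => h s / a - y / a) (fun _ _ => - / a)
    (fun _ s => Derive h s / a) r e (/ 2)) as [g Hg].
  - lra.
  - lra.
  - intros y s Hy Hs. split; auto.
    eapply is_derive_cast. apply is_derive_plusR. apply is_derive_multR. apply Hh1. lra.
    apply @is_derive_const. apply @is_derive_const. unfold zero; simpl. field; auto.
  - intros y Hy. specialize (Hya y Hy).
    destruct (Hend e) as [E1 E2]. rewrite Rabs_pos_eq; lra. lra.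
    replace (- e / 2) with (- (e / 2)) in E2 by field. lra.
  - intros y s Hy Hs. auto_derive; auto. field; auto.
  - intros y s Hy Hs. apply (continuity_1d_2d_pt_comp (fun s => Derive h s / a) (fun _ s => s)).
    2: apply continuity_2d_pt_id2. apply continuity_pt_mult.
    apply (smooth_on_continuity d); auto. lra. apply continuity_pt_const. now intros u v.
  - assert (Hg' : forall y, Rabs y < r -> h (g y) = y).
    { intros y Hy. destruct (Hg y Hy) as [_ [E _]].
      apply (Rmult_eq_reg_r (/ a)). unfold Rdiv in E; lra.
      now apply Rinv_neq_0_compat. }
    assert (Hnz : forall y, Rabs y < r -> Derive h (g y) <> 0).
    { intros y Hy E. pose proof (Hlow (g y) ltac:(destruct (Hg y Hy); lra)) as HL.
      rewrite E in HL. unfold Rdiv in HL. rewrite Rmult_0_l in HL. lra. }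
    exists e, r, g. split; auto. split; auto. split; [|split; [|split]].
    (* Bootstrap: g' = 1 / h'(g) has the order of differentiability already known for g. *)
    + intros n; induction n as [|n IH]; simpl; auto.
      exists (fun y => / Derive h (g y)). split.
      * intros y Hy. destruct (Hg y Hy) as [_ [_ [_ D]]]. eapply is_derive_cast. apply D.
        field. split; auto.
      * apply Ck_inv; auto. apply (Ck_comp r d n (Derive h) g); auto.
        intros y Hy. destruct (Hg y Hy); lra.
    + destruct (Hg 0) as [_ [_ [U _]]]. now rewrite Rabs_R0.
      symmetry; apply U. rewrite Rabs_R0; lra. rewrite H0. unfold Rdiv; ring.
    + intros y Hy. split; auto. now destruct (Hg y Hy).
    + intros s Hs Hsr. destruct (Hg (h s) Hsr) as [_ [_ [U _]]]. symmetry; apply U; auto. lra.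
Qed.

Lemma contraction_exists (r : R) (p : nat) (A g : R -> R) :
  0 < r -> (0 < p)%nat -> (forall x : R, 0 <= x ^ p) -> smooth_on r A -> A 0 < 0 ->
  (forall x, Rabs x < r -> g x = x * (1 + x ^ p * A x)) ->
  exists d0 d c, contraction d0 d c p A g /\ d0 <= r.
Proof.
  intros Hr Hp Hev HA HA0 Hg.
  destruct (smooth_on_Derive _ _ HA) as [HA1 HA2].
  assert (Hgs : smooth_on r g).
  { intros n. apply (Ck_ext r n (fun x => x * (1 + x ^ p * A x))). intros; symmetry; auto.
    apply Ck_mult. apply Ck_id. apply Ck_plus. apply Ck_const. apply Ck_mult; auto.
    apply Ck_pow, Ck_id. }
  (* Chosen so that g' = 1 + x^p B; B(0) = (p + 1) A(0) < 0 gives g' <= 1 near 0. *)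
  set (B := fun x => INR (S p) * A x + x * Derive A x).
  assert (Hder : forall x, Rabs x < r -> Derive g x = 1 + x ^ p * B x).
  { intros x Hx. apply is_derive_unique.
    apply (is_derive_ext_loc (fun x => x * (1 + x ^ p * A x))).
    generalize (locally_abs_lt r x Hx). apply filter_imp. intros; symmetry; auto.
    eapply is_derive_cast. apply is_derive_multR. apply @is_derive_id.
    apply is_derive_plusR. apply @is_derive_const. apply is_derive_multR.
    apply (is_derive_pow (fun y => y)). apply @is_derive_id. apply HA1; auto.
    unfold one, zero, B; simpl. change (match p with 0%nat => 1 | S _ => INR p + 1 end) with (INR (S p)).
    rewrite S_INR. destruct p as [|p]. lia. simpl Nat.pred. simpl pow. ring. }
  assert (C0 : Rabs 0 < r) by now rewrite Rabs_R0.
  assert (CA : continuity_pt A 0) by now apply (smooth_on_continuity r).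
  assert (Cp : continuity_pt (fun x => x ^ p) 0) by apply derivable_continuous_pt, derivable_pt_pow.
  assert (CB : continuity_pt B 0).
  { apply continuity_pt_plus; apply continuity_pt_mult; auto.
    apply continuity_pt_const; now intros u v. apply derivable_continuous_pt, derivable_pt_id.
    now apply (smooth_on_continuity r). }
  assert (Z : 0 ^ p = 0) by (apply pow_ne_zero; lia).
  assert (HB0 : B 0 < 0).
  { unfold B. rewrite S_INR. pose proof (pos_INR p). nra. }
  destruct (continuity_pt_near0 A (- A 0 / 2) CA ltac:(lra)) as [d1 [Hd1 N1]].
  destruct (continuity_pt_near0 B (- B 0) CB ltac:(lra)) as [d2 [Hd2 N2]].
  destruct (continuity_pt_near0 (fun x => x ^ p * A x) (/ 2)) as [d3 [Hd3 N3]].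
  apply continuity_pt_mult; auto. lra.
  destruct (continuity_pt_near0 (fun x => x ^ p * B x) (/ 2)) as [d4 [Hd4 N4]].
  apply continuity_pt_mult; auto. lra.
  rewrite Z, Rmult_0_l in N3, N4.
  set (d0 := Rmin (Rmin r d1) (Rmin d2 (Rmin d3 d4))).
  assert (Hd0 : 0 < d0) by (repeat apply Rmin_pos; auto).
  assert (HL : d0 <= r /\ d0 <= d1 /\ d0 <= d2 /\ d0 <= d3 /\ d0 <= d4).
  { unfold d0. pose proof (Rmin_l (Rmin r d1) (Rmin d2 (Rmin d3 d4))).
    pose proof (Rmin_r (Rmin r d1) (Rmin d2 (Rmin d3 d4))).
    pose proof (Rmin_l r d1). pose proof (Rmin_r r d1).
    pose proof (Rmin_l d2 (Rmin d3 d4)). pose proof (Rmin_r d2 (Rmin d3 d4)).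
    pose proof (Rmin_l d3 d4). pose proof (Rmin_r d3 d4). repeat split; lra. }
  destruct HL as [L0 [L1 [L2 [L3 L4]]]].
  exists d0, (d0 / 2), (- A 0 / 2). split; auto. constructor; auto; try lra.
  - now apply (smooth_on_shrink r).
  - now apply (smooth_on_shrink r).
  - intros x Hx. apply Hg; lra.
  - intros x Hx. specialize (N3 x ltac:(lra)). apply Rabs_def2 in N3. lra.
  - intros x Hx. specialize (N1 x ltac:(lra)). apply Rabs_def2 in N1.
    specialize (Hev x). nra.
  - intros x Hx. rewrite Hder by lra. specialize (N2 x ltac:(lra)). apply Rabs_def2 in N2.
    specialize (N4 x ltac:(lra)). apply Rabs_def2 in N4. specialize (Hev x). split. lra. nra.
Qed.

(** * From the square to the germ *)

Lemma smooth_small (r eps : R) (u : R -> R) : 0 < r -> 0 < eps -> smooth_on r u ->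
  exists rho, 0 < rho <= r /\ forall x, Rabs x < rho -> Rabs (u x - u 0) < eps.
Proof.
  intros Hr He Hu.
  destruct (continuity_pt_near0 u eps) as [d [Hd H]]; auto.
  apply (smooth_on_continuity r); auto. now rewrite Rabs_R0.
  exists (Rmin r d). split. split. now apply Rmin_pos. apply Rmin_l.
  intros x Hx. apply H. pose proof (Rmin_r r d). lra.
Qed.

(* If [T = x ^ i * Ti] with [i < p], invariance forces [Ti 0 = 0], since [x ^ (i - p)] is moved by
   [g] at first order; at [i = p] iteration shows that [T / x ^ p] is constant. *)
Lemma invariant_monomial (d0 d c : R) (p : nat) (A g T : R -> R) (r : R) :
  contraction d0 d c p A g -> 0 < r <= d -> smooth_on r T ->
  (forall x, x <> 0 -> Rabs x < r -> T (g x) / g x ^ p = T x / x ^ p) ->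
  exists th, forall x, Rabs x < r -> T x = th * x ^ p.
Proof.
  intros H Hr HT Hinv. pose proof (ctr_dom _ _ _ _ _ _ H) as Hd.
  assert (Hg : forall x, Rabs x < r -> g x = x * (1 + x ^ p * A x) /\
     / 2 <= 1 + x ^ p * A x <= 1 /\ Rabs (g x) < r).
  { intros x Hx. pose proof (ctr_lo _ _ _ _ _ _ H x ltac:(lra)).
    pose proof (ctr_hi _ _ _ _ _ _ H x ltac:(lra)).
    pose proof (ctr_even _ _ _ _ _ _ H x). pose proof (ctr_c _ _ _ _ _ _ H).
    split. apply (ctr_eq _ _ _ _ _ _ H); lra. split. split; nra.
    pose proof (contraction_abs d0 d c p A g x H ltac:(lra)). lra. }
  (* Invariance of T / x^p rewritten for the cofactor: composing Ti with g multiplies it by the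
     power p - i of the multiplier g(x) / x. *)
  assert (Hlift : forall i (Ti : R -> R), (i <= p)%nat -> (forall x, Rabs x < r -> T x = x ^ i * Ti x) ->
    forall x, x <> 0 -> Rabs x < r -> Ti x * (1 + x ^ p * A x) ^ (p - i) = Ti (g x)).
  { intros i Ti Hi E x Hx0 Hx. destruct (Hg x Hx) as [Eg [Hb Hgr]].
    specialize (Hinv x Hx0 Hx). rewrite (E x Hx), (E (g x) Hgr), Eg in Hinv.
    rewrite <- Eg in Hinv at 1. rewrite <- Eg in Hinv at 1. rewrite Eg in Hinv at 1.
    set (y := 1 + x ^ p * A x) in *. rewrite !Rpow_mult_distr in Hinv.
    assert (x ^ i <> 0) by now apply pow_nonzero. assert (x ^ p <> 0) by now apply pow_nonzero.
    assert (y ^ p <> 0) by (apply pow_nonzero; lra). assert (y ^ i <> 0) by (apply pow_nonzero; lra).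
    assert (EY : y ^ p = y ^ i * y ^ (p - i)) by (rewrite <- pow_add; f_equal; lia).
    apply Rmult_eq_reg_l with (x ^ i / x ^ p * y ^ i). 2: {
      apply Rmult_integral_contrapositive_currified; auto.
      apply Rmult_integral_contrapositive_currified; auto. now apply Rinv_neq_0_compat. }
    transitivity (x ^ i * Ti x / x ^ p * y ^ p). rewrite EY; field; auto.
    rewrite <- Hinv. field; auto. }
  assert (Hi : forall i, (i <= p)%nat -> exists Ti, smooth_on r Ti /\
     forall x, Rabs x < r -> T x = x ^ i * Ti x).
  { induction i as [|i IH]; intros Hi. exists T. split; auto. intros x Hx. simpl; ring.
    destruct (IH ltac:(lia)) as [Ti [HTi E]].
    assert (Hl := Hlift i Ti ltac:(lia) E).
    destruct (smooth_on_Derive _ _ HTi) as [HD1 HD2].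
    assert (Z : Ti 0 = 0).
    { destruct (bounded_on_inner r (r / 2) (Derive Ti)) as [C HC]; auto. lra.
      destruct (smooth_small d0 (Rabs (A 0)) A) as [r2 [Hr2 HA]].
      lra. apply Rabs_pos_lt, (ctr_A0 _ _ _ _ _ _ H). apply (ctr_A _ _ _ _ _ _ H).
      (* With y the multiplier, |Ti(g x) - Ti(x)| = |Ti(x)| (1 - y^(p - i)) >= |Ti(x)| (1 - y)
         because i < p, while the mean value theorem bounds it by C |x| (1 - y). The factor 1 - y is
         positive, since A(x) <> 0 here, and cancels. *)
      assert (Hbd : forall x, x <> 0 -> Rabs x < r / 2 -> Rabs x < r2 -> Rabs (Ti x) <= Rabs C * Rabs x).
      { intros x Hx0 Hx Hx2. destruct (Hg x ltac:(lra)) as [Eg [Hb Hgr]].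
        specialize (Hl x Hx0 ltac:(lra)).
        assert (HAx : A x <> 0).
        { specialize (HA x Hx2). intros E0. rewrite E0 in HA.
          replace (0 - A 0) with (- A 0) in HA by ring. rewrite Rabs_Ropp in HA. lra. }
        pose proof (contraction_abs d0 d c p A g x H ltac:(lra)) as Hga.
        destruct (MVT_abs Ti (Derive Ti) (r / 2) x (g x)) as [z [Hz [_ Ez]]]; try lra.
        intros z Hz; apply HD1; lra.
        rewrite <- Hl in Ez. specialize (HC z Hz).
        set (y := 1 + x ^ p * A x) in *.
        assert (Hyp : y ^ (p - i) <= y).
        { replace (p - i)%nat with (S (p - S i)) by lia. simpl.
          rewrite <- (Rmult_1_r y) at 3. apply Rmult_le_compat_l. lra.
          rewrite <- (pow1 (p - S i)). apply pow_incr. lra. }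
        assert (Hw : 0 < 1 - y).
        { assert (y <> 1); [|lra]. unfold y. intros E1.
          assert (x ^ p * A x = 0) by lra. apply Rmult_integral in H0. destruct H0; auto.
          now apply (pow_nonzero x p). }
        assert (E2 : Ti x * (1 - y ^ (p - i)) = Derive Ti z * (x * (1 - y))).
        { rewrite Eg in Ez. replace (x * (1 - y)) with (- (x * y - x)) by ring. lra. }
        apply (f_equal Rabs) in E2. rewrite !Rabs_mult in E2.
        rewrite (Rabs_pos_eq (1 - y ^ _)), (Rabs_pos_eq (1 - y)) in E2 by lra.
        apply Rmult_le_reg_r with (1 - y); auto.
        apply Rle_trans with (Rabs (Ti x) * (1 - y ^ (p - i))).
        apply Rmult_le_compat_l. apply Rabs_pos. lra.
        rewrite E2, <- Rmult_assoc. apply Rmult_le_compat_r. lra.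
        apply Rmult_le_compat_r. apply Rabs_pos. pose proof (Rle_abs C). lra. }
      apply Rabs_eq_0. apply Rle_antisym. 2: apply Rabs_pos.
      apply le_epsilon. intros eps Heps.
      destruct (smooth_small r (eps / 2) Ti) as [r3 [Hr3 H3]]; auto; try lra.
      set (x := Rmin (Rmin (r / 4) (r2 / 2)) (Rmin (r3 / 2) (eps / 2 / (Rabs C + 1)))).
      pose proof (Rabs_pos C).
      assert (0 < eps / 2 / (Rabs C + 1)) by (apply Rdiv_lt_0_compat; lra).
      assert (Hx : 0 < x) by (unfold x; repeat apply Rmin_pos; lra).
      pose proof (Rmin_l (Rmin (r / 4) (r2 / 2)) (Rmin (r3 / 2) (eps / 2 / (Rabs C + 1)))).
      pose proof (Rmin_r (Rmin (r / 4) (r2 / 2)) (Rmin (r3 / 2) (eps / 2 / (Rabs C + 1)))).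
      fold x in H2, H4.
      pose proof (Rmin_l (r / 4) (r2 / 2)). pose proof (Rmin_r (r / 4) (r2 / 2)).
      pose proof (Rmin_l (r3 / 2) (eps / 2 / (Rabs C + 1))).
      pose proof (Rmin_r (r3 / 2) (eps / 2 / (Rabs C + 1))).
      assert (Ex : Rabs x = x) by (apply Rabs_pos_eq; lra).
      specialize (Hbd x ltac:(lra) ltac:(lra) ltac:(lra)). specialize (H3 x ltac:(lra)).
      rewrite Ex in Hbd.
      assert (Rabs C * x <= eps / 2).
      { apply Rle_trans with ((Rabs C + 1) * (eps / 2 / (Rabs C + 1))).
        apply Rmult_le_compat; lra. right; field; lra. }
      replace (Ti 0) with (Ti x - (Ti x - Ti 0)) by ring.
      pose proof (Rabs_triang (Ti x) (- (Ti x - Ti 0))). rewrite Rabs_Ropp in H10.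
      unfold Rminus at 1. lra. }
    exists (quot0 Ti). split. now apply quot0_smooth.
    intros x Hx. rewrite (E x Hx). rewrite (quot0_spec Ti x) at 1. rewrite Z. simpl; ring. }
  destruct (Hi p (le_n p)) as [Tp [HTp E]].
  exists (Tp 0). intros x Hx. rewrite (E x Hx), Rmult_comm. f_equal.
  assert (Hinv2 : forall x, Rabs x < r -> Tp x = Tp (g x)).
  { intros y Hy. destruct (Req_dec y 0) as [->|Hy0].
    destruct (Hg 0 Hy) as [-> _]. now rewrite Rmult_0_l.
    rewrite <- (Hlift p Tp (le_n p) E y Hy0 Hy), Nat.sub_diag. simpl; ring. }
  assert (Hit : forall n, Rabs (Nat.iter n g x) < r /\ Tp (Nat.iter n g x) = Tp x).
  { induction n as [|n [I1 I2]]; auto. simpl. split. now apply Hg.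
    rewrite <- Hinv2; auto. }
  assert (L1 : is_lim_seq (fun n => Tp (Nat.iter n g x)) (Tp 0)).
  { apply is_lim_seq_continuous. apply (smooth_on_continuity r); auto. rewrite Rabs_R0; lra.
    apply (is_lim_seq_ext (fun n => Nat.iter n g x ^ 1)). intros; simpl; ring.
    apply (iter_pow_lim d0 d c p A g H); auto. lra. }
  apply (is_lim_seq_ext _ (fun _ => Tp x)) in L1. 2: intros n; apply Hit.
  apply is_lim_seq_unique in L1. rewrite Lim_seq_const in L1. congruence.
Qed.

Lemma reversing_factor (r : R) (f : R -> R) :
  0 < r -> smooth_on r f -> f 0 = 0 -> Derive f 0 = -1 ->
  exists rho, 0 < rho <= r /\ forall x, Rabs x < rho -> f x = x * quot0 f x /\ -2 < quot0 f x < - / 2.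
Proof.
  intros Hr Hf H0 H1.
  destruct (smooth_small r (/ 2) (quot0 f)) as [rho [Hrho H]]; auto. lra. now apply quot0_smooth.
  exists rho. split; auto. intros x Hx. split.
  rewrite (quot0_spec f x) at 1. rewrite H0. ring.
  specialize (H x Hx). rewrite quot0_0, H1 in H. apply Rabs_def2 in H. lra.
Qed.

Definition fatou (f : R -> R) (p : nat) (r : R) (K : R -> R) (b : R) : Prop :=
  forall x, x <> 0 -> Rabs x < r ->
    K (f x) / f x ^ p + b * ln (Rabs (f x)) = K x / x ^ p + b * ln (Rabs x) + / 2.

Lemma fatou_contracting (r : R) (p : nat) (A f : R -> R) :
  0 < r -> (0 < p)%nat -> (forall x : R, 0 <= x ^ p) -> smooth_on r f -> f 0 = 0 -> Derive f 0 = -1 ->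
  smooth_on r A -> A 0 < 0 -> (forall x, Rabs x < r -> f (f x) = x * (1 + x ^ p * A x)) ->
  exists r' K b, 0 < r' /\ smooth_on r' K /\ K 0 <> 0 /\ fatou f p r' K b.
Proof.
  intros Hr Hp Hev Hf Hf0 Hf1 HA HA0 Hff.
  destruct (contraction_exists r p A (fun x => f (f x)) Hr Hp Hev HA HA0 Hff) as [d0 [d [c [H Hd0]]]].
  set (g := fun x => f (f x)) in *.
  pose proof (ctr_dom _ _ _ _ _ _ H) as Hd.
  destruct (fatou_coordinate d0 d c p A g H) as [K [b [HK [HK0 HF]]]].
  destruct (reversing_factor r f Hr Hf Hf0 Hf1) as [rho [Hrho Hphi]].
  set (phi := quot0 f) in *.
  set (s := Rmin d rho / 2).
  pose proof (Rmin_l d rho). pose proof (Rmin_r d rho). assert (0 < Rmin d rho) by (apply Rmin_pos; lra).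
  assert (Hs : 0 < s /\ 2 * s <= d /\ 2 * s <= rho) by (unfold s; lra).
  assert (Hfx : forall x, Rabs x < s -> f x = x * phi x /\ -2 < phi x < - / 2 /\ Rabs (f x) < d /\
     Rabs (f x) <= 2 * Rabs x).
  { intros x Hx. destruct (Hphi x ltac:(lra)) as [E1 E2]. split; auto. split; auto.
    assert (Rabs (f x) <= 2 * Rabs x).
    { rewrite E1, Rabs_mult, Rmult_comm. apply Rmult_le_compat_r. apply Rabs_pos. apply Rabs_le; lra. }
    lra. }
  (* This is x^p (Psi(f(x)) - Psi(x)). It is smooth across 0 because f(x) = x phi(x) with phi
     negative, so the difference of the logarithms is ln(-phi). *)
  set (T := fun x => K (f x) * / phi x ^ p - K x + b * (x ^ p * ln (- phi x))).
  assert (Hphis : smooth_on s phi) by (apply (smooth_on_shrink r); [lra | now apply quot0_smooth]).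
  assert (HT : smooth_on s T).
  { intros n. apply Ck_plus. apply Ck_minus. apply Ck_mult.
    apply (Ck_comp s d n K f). intros x Hx; now apply Hfx. apply HK.
    apply (Ck_shrink r); auto. lra.
    apply Ck_inv. intros x Hx. apply pow_nonzero. destruct (Hfx x Hx). lra.
    apply Ck_pow, Hphis. apply (Ck_shrink d); auto. lra.
    apply Ck_scal, Ck_mult. apply Ck_pow, Ck_id. apply Ck_ln. intros x Hx. destruct (Hfx x Hx). lra.
    apply Ck_opp, Hphis. }
  set (Psi := fun x => K x / x ^ p + b * ln (Rabs x)).
  assert (HTE : forall x, x <> 0 -> Rabs x < s -> T x / x ^ p = Psi (f x) - Psi x /\ f x <> 0).
  { intros x Hx0 Hx. destruct (Hfx x Hx) as [E1 [E2 E3]].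
    unfold T, Psi. split. 2: rewrite E1; apply Rmult_integral_contrapositive_currified; lra.
    replace (ln (Rabs (f x))) with (ln (Rabs x) + ln (- phi x)).
    2: { rewrite E1, Rabs_mult, ln_mult. f_equal. f_equal. rewrite Rabs_left; lra.
         now apply Rabs_pos_lt. apply Rabs_pos_lt; lra. }
    replace (f x ^ p) with (x ^ p * phi x ^ p) by (rewrite E1, Rpow_mult_distr; auto).
    field. split; apply pow_nonzero; auto; lra. }
  destruct (invariant_monomial d0 d c p A g T s H ltac:(lra) HT) as [th Hth].
  { intros x Hx0 Hx. destruct (HTE x Hx0 Hx) as [-> Hfx0].
    assert (Hgx0 : g x <> 0).
    { rewrite (ctr_eq _ _ _ _ _ _ H x ltac:(lra)).
      pose proof (ctr_lo _ _ _ _ _ _ H x ltac:(lra)).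
      apply Rmult_integral_contrapositive_currified; lra. }
    assert (Hgx : Rabs (g x) < s).
    { pose proof (contraction_abs d0 d c p A g x H ltac:(lra)). lra. }
    destruct (HTE (g x) Hgx0 Hgx) as [-> _].
    pose proof (HF x Hx0 ltac:(lra)). destruct (Hfx x Hx) as [_ [_ [Hfd _]]].
    pose proof (HF (f x) Hfx0 Hfd). unfold Psi. change (f (g x)) with (g (f x)). lra. }
  assert (Hth' : forall x, x <> 0 -> Rabs x < s -> Psi (f x) - Psi x = th).
  { intros x Hx0 Hx. rewrite <- (proj1 (HTE x Hx0 Hx)), Hth by auto. field. now apply pow_nonzero. }
  (* Adding the relations at x and at f(x) gives 2 th = 1. The sample point s / 4 keeps f(x) inside
     the interval. *)
  assert (Hhalf : th = / 2).
  { set (x := s / 4). assert (Ex : Rabs x = x) by (apply Rabs_pos_eq; unfold x; lra).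
    assert (Hx0 : x <> 0) by (unfold x; lra). assert (Hx : Rabs x < s) by (rewrite Ex; unfold x; lra).
    destruct (HTE x Hx0 Hx) as [_ Hfx0]. destruct (Hfx x Hx) as [_ [_ [_ Hb]]]. rewrite Ex in Hb.
    pose proof (Hth' x Hx0 Hx). pose proof (Hth' (f x) Hfx0 ltac:(unfold x in *; lra)).
    pose proof (HF x Hx0 ltac:(lra)). unfold Psi, g in *. lra. }
  exists s, K, b. split. lra. split. apply (smooth_on_shrink d); auto; lra. split; auto.
  intros x Hx0 Hx. pose proof (Hth' x Hx0 Hx). unfold Psi in H3. lra.
Qed.

Lemma fatou_reversing (r : R) (p : nat) (A f : R -> R) :
  0 < r -> (0 < p)%nat -> (forall x : R, 0 <= x ^ p) -> smooth_on r f -> f 0 = 0 -> Derive f 0 = -1 ->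
  smooth_on r A -> A 0 <> 0 -> (forall x, Rabs x < r -> f (f x) = x * (1 + x ^ p * A x)) ->
  exists r' K b, 0 < r' /\ smooth_on r' K /\ K 0 <> 0 /\ fatou f p r' K b.
Proof.
  intros Hr Hp Hev Hf Hf0 Hf1 HA HA0 Hff.
  destruct (Rlt_or_le (A 0) 0) as [HA1|HA1].
  { now apply (fatou_contracting r p A f). }
  destruct (smooth_local_inverse r f Hr Hf Hf0 ltac:(rewrite Hf1; lra)) as [e [r1 [ft [He [Hr1 [Hft [Hft0 [Hi1 Hi2]]]]]]]].
  destruct (smooth_on_Derive _ _ Hf) as [HD _]. destruct (smooth_on_Derive _ _ Hft) as [HDt _].
  assert (R00 : Rabs 0 < r1) by now rewrite Rabs_R0.
  assert (Hft1 : Derive ft 0 = -1).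
  { assert (D1 : is_derive (fun y => f (ft y)) 0 (-1 * Derive ft 0)).
    { apply is_derive_compR; auto. rewrite Hft0, <- Hf1. apply HD. now rewrite Rabs_R0. }
    assert (D2 : is_derive (fun y => f (ft y)) 0 1).
    { apply (is_derive_ext_loc (fun y => y)). 2: apply @is_derive_id.
      generalize (locally_abs_lt r1 0 R00). apply filter_imp. intros y Hy. symmetry. now apply Hi1. }
    apply is_derive_unique in D1. apply is_derive_unique in D2. lra. }
  destruct (smooth_small r1 r1 ft) as [r2 [Hr2 Hr2']]; auto.
  rewrite Hft0 in Hr2'.
  assert (Hr2'' : forall x, Rabs x < r2 -> Rabs (ft x) < r1).
  { intros x Hx. specialize (Hr2' x Hx). now rewrite Rminus_0_r in Hr2'. }
  set (G := fun y => ft (ft y)).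
  assert (HG : smooth_on r2 G).
  { intros n. apply (Ck_comp r2 r1 n ft ft); auto. apply (Ck_shrink r1); auto. lra. }
  assert (HG0 : G 0 = 0) by (unfold G; now rewrite !Hft0).
  assert (HG1 : Derive G 0 = 1).
  { apply is_derive_unique. eapply is_derive_cast. apply (is_derive_compR ft ft).
    apply HDt; now rewrite Hft0. now apply HDt. rewrite Hft0, Hft1. ring. }
  (* G inverts the square of f, so y = G + G^(p + 1) A(G), that is G = y - G^(p + 1) A(G);
     substituting G = y quot0 G(y) gives the cofactor. Its value at 0 is -A(0), hence negative. *)
  set (At := fun y => - (quot0 G y ^ S p * A (G y))).
  destruct (fatou_contracting r2 p At ft) as [r' [K [b [Hr' [HK [HK0 HF]]]]]]; auto.
  - lra.
  - apply (smooth_on_shrink r1); auto. lra.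
  - intros n. apply Ck_opp, Ck_mult. apply Ck_pow, quot0_smooth, HG.
    apply (Ck_comp r2 r n A G); auto. intros y Hy. unfold G.
    pose proof (proj1 (Hi1 (ft y) (Hr2'' y Hy))). lra.
  - unfold At. rewrite quot0_0, HG1, HG0, pow1. lra.
  - intros y Hy. fold (G y).
    assert (E : y = G y * (1 + G y ^ p * A (G y))).
    { rewrite <- Hff. unfold G. rewrite (proj2 (Hi1 (ft y) (Hr2'' y Hy))). symmetry; apply Hi1; lra.
      unfold G. pose proof (proj1 (Hi1 (ft y) (Hr2'' y Hy))). lra. }
    assert (EG : G y = y * quot0 G y) by (rewrite (quot0_spec G y) at 1; rewrite HG0; ring).
    unfold At. apply Rplus_eq_reg_r with (G y ^ S p * A (G y)).
    transitivity y. transitivity (G y * (1 + G y ^ p * A (G y))). simpl; ring. symmetry; apply E.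
    assert (EP : G y ^ S p = y ^ S p * quot0 G y ^ S p) by (rewrite EG at 1; apply Rpow_mult_distr).
    rewrite EP. rewrite <- (tech_pow_Rmult y). ring.
  - destruct (smooth_small r (Rmin r1 r') f) as [s [Hs Hs']]; auto. now apply Rmin_pos.
    rewrite Hf0 in Hs'.
    set (t := Rmin (Rmin s e) r').
    pose proof (Rmin_l (Rmin s e) r'). pose proof (Rmin_r (Rmin s e) r').
    pose proof (Rmin_l s e). pose proof (Rmin_r s e). fold t in H, H0.
    (* A coordinate in which the inverse of f advances by 1/2 is moved back by 1/2 by f, so its
       opposite is a coordinate for f. *)
    exists t, (fun x => (-1) * K x), (- b). split. repeat apply Rmin_pos; lra. split; [|split].
    + intros n. apply Ck_scal. apply (Ck_shrink r'); auto.
    + lra.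
    + intros x Hx0 Hx. specialize (Hs' x ltac:(lra)). rewrite Rminus_0_r in Hs'.
      pose proof (Rmin_l r1 r'). pose proof (Rmin_r r1 r').
      assert (E : ft (f x) = x) by (apply Hi2; lra).
      assert (Hfx0 : f x <> 0) by (intros E0; rewrite E0, Hft0 in E; auto).
      pose proof (HF (f x) Hfx0 ltac:(lra)) as Q. rewrite E in Q.
      unfold Rdiv in *. lra.
Qed.

(* [f] commutes with its square and reverses orientation: comparing the leading terms of
   [f (f (f x))] computed in the two ways excludes even [n]. *)
Lemma square_order_odd (r : R) (n : nat) (B f : R -> R) :
  0 < r -> smooth_on r f -> f 0 = 0 -> Derive f 0 = -1 -> smooth_on r B -> B 0 <> 0 ->
  (2 <= n)%nat -> (forall x, Rabs x < r -> f (f x) = x + x ^ n * B x) ->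
  exists m, (1 <= m)%nat /\ n = S (2 * m).
Proof.
  intros Hr Hf Hf0 Hf1 HB HB0 Hn Hff.
  destruct (Nat.Even_or_Odd n) as [[m Em]|[m Em]].
  2: { exists m. split; lia. }
  exfalso.
  destruct (smooth_on_Derive _ _ Hf) as [HD1 HD2].
  destruct (reversing_factor r f Hr Hf Hf0 Hf1) as [rho [Hrho Hphi]].
  destruct (smooth_small r (/ 2) (Derive f)) as [r1 [Hr1 H1]]; auto. lra. rewrite Hf1 in H1.
  destruct (smooth_small r (Rabs (B 0)) B) as [r2 [Hr2 H2]]; auto. now apply Rabs_pos_lt.
  assert (HBs : forall x, Rabs x < r2 -> 0 < B x * B 0).
  { intros x Hx. specialize (H2 x Hx). apply Rabs_def2 in H2. unfold Rabs in H2.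
    destruct (Rcase_abs (B 0)). nra. assert (0 < B 0) by lra. nra. }
  set (s := Rmin (Rmin rho r1) r2).
  pose proof (Rmin_l (Rmin rho r1) r2). pose proof (Rmin_r (Rmin rho r1) r2).
  pose proof (Rmin_l rho r1). pose proof (Rmin_r rho r1). fold s in H, H0.
  assert (Hs : 0 < s) by (repeat apply Rmin_pos; lra).
  set (x := s / 8).
  assert (Ex : Rabs x = x) by (apply Rabs_pos_eq; unfold x; lra).
  assert (Hx0 : x <> 0) by (unfold x; lra).
  assert (Hgrow : forall t, Rabs t < s -> Rabs (f t) <= 2 * Rabs t).
  { intros t Ht. destruct (Hphi t ltac:(lra)) as [E1 E2].
    rewrite E1, Rabs_mult, Rmult_comm. apply Rmult_le_compat_r. apply Rabs_pos. apply Rabs_le; lra. }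
  pose proof (Hgrow x ltac:(rewrite Ex; unfold x; lra)) as Hy. set (y := f x) in *.
  assert (Hys : Rabs y <= s / 4) by (rewrite Ex in Hy; unfold x in Hy; lra).
  pose proof (Hgrow y ltac:(lra)) as Hz.
  assert (Hy0 : y <> 0).
  { unfold y. destruct (Hphi x ltac:(rewrite Ex; unfold x; lra)) as [-> E2].
    apply Rmult_integral_contrapositive_currified; lra. }
  pose proof (Hff y ltac:(lra)) as E3.
  pose proof (Hff x ltac:(rewrite Ex; unfold x; lra)) as E2. fold y in E2.
  (* Here y = f(x): f(f(y)) - y = f'(xi) (f(f(x)) - x), that is y^n B(y) = f'(xi) x^n B(x). For even
     n the quantities y^n B(y) and x^n B(x) both have the sign of B(0), while f'(xi) < 0. *)
  destruct (MVT_abs f (Derive f) s x (f y)) as [xi [Hxi [_ EM]]].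
  rewrite Ex; unfold x; lra. lra. intros t Ht; apply HD1; lra.
  rewrite E3 in EM. fold y in EM. rewrite E2 in EM.
  specialize (H1 xi ltac:(lra)). apply Rabs_def2 in H1.
  pose proof (HBs x ltac:(rewrite Ex; unfold x; lra)). pose proof (HBs y ltac:(lra)).
  assert (Hpos : forall t, t <> 0 -> 0 < t ^ n).
  { intros t Ht. rewrite Em, pow_mult. apply pow_lt. now apply pow2_gt_0. }
  pose proof (Hpos x Hx0). pose proof (Hpos y Hy0).
  assert (E4 : y ^ n * (B y * B 0) = Derive f xi * (x ^ n * (B x * B 0))).
  { transitivity ((y + y ^ n * B y - y) * B 0). ring. rewrite EM. ring. }
  assert (0 < y ^ n * (B y * B 0)) by now apply Rmult_lt_0_compat.
  assert (0 < x ^ n * (B x * B 0)) by now apply Rmult_lt_0_compat.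
  nra.
Qed.

(** * The smooth conjugacy *)

Lemma is_derive_powR (p : nat) (x : R) : is_derive (fun y => y ^ p) x (INR p * x ^ pred p).
Proof.
  eapply is_derive_cast. apply (is_derive_pow (fun y => y)). apply @is_derive_id.
  unfold one; simpl. ring.
Qed.

Lemma exp_ge_2 (p : nat) : (0 < p)%nat -> 2 <= exp (INR p).
Proof.
  intros Hp. apply (le_INR 1) in Hp. simpl in Hp. pose proof (exp_ineq1_le (INR p)). lra.
Qed.

Lemma smooth_on_pow (r : R) (p : nat) : smooth_on r (fun x => x ^ p).
Proof. intros n. apply Ck_pow, Ck_id. Qed.

(** Divided by K(0), the equation is a small perturbation of exp(-p s) = 1. It is solved in the box
    |s| <= 1, and smoothness follows because the derivative of the solution is a smooth expression
    in x and the solution itself. *)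
Lemma normal_form_exponent (r : R) (p : nat) (K : R -> R) (b : R) :
  0 < r -> (0 < p)%nat -> smooth_on r K -> K 0 <> 0 ->
  exists e sg, 0 < e <= r /\ smooth_on e sg /\ sg 0 = 0 /\ forall x, Rabs x < e ->
    Rabs (sg x) < 1 /\ K 0 * exp (- (INR p * sg x)) + b * x ^ p * sg x = K x.
Proof.
  intros Hr Hp HK HK0. set (k := K 0) in *. set (be := b / k).
  assert (Hp1 : 1 <= INR p) by (apply (le_INR 1); lia).
  pose proof (exp_ge_2 p Hp) as Hep. pose proof (exp_pos (INR p)) as Hep0.
  assert (Hem : 0 < exp (- INR p) <= / 2).
  { split. apply exp_pos. rewrite exp_Ropp. apply Rinv_le_contravar; lra. }
  (* Half the minimum of p exp(-p s) over |s| <= 1: keeping |be x^p| below it leaves [q] as lower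
     bound of the derivative in s. The tolerances 1/8 serve for the signs at s = -1 and s = 1, where
     exp(-p s) is at least 2 and at most 1/2. *)
  set (q := INR p * exp (- INR p) / 2).
  assert (Hq : 0 < q) by (unfold q; nra).
  destruct (smooth_small r (/ 8) (fun x => K x * / k)) as [r1 [Hr1 H1]]; auto. lra.
  { intros n; apply Ck_mult; auto. apply Ck_const. }
  replace (K 0 * / k) with 1 in H1 by (unfold k; field; auto).
  destruct (smooth_small r (Rmin (/ 8) q) (fun x => be * x ^ p)) as [r2 [Hr2 H2]]; auto.
  apply Rmin_pos; lra.
  { intros n; apply Ck_scal, smooth_on_pow. }
  set (d := Rmin r1 r2). pose proof (Rmin_l r1 r2). pose proof (Rmin_r r1 r2). fold d in H, H0.
  assert (Hd : 0 < d) by (apply Rmin_pos; lra).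
  assert (H2' : forall x, Rabs x < d -> Rabs (be * x ^ p) < / 8 /\ Rabs (be * x ^ p) < q).
  { intros x Hx. specialize (H2 x ltac:(lra)). rewrite pow_ne_zero, Rmult_0_r, Rminus_0_r in H2 by lia.
    pose proof (Rmin_l (/ 8) q). pose proof (Rmin_r (/ 8) q). lra. }
  destruct (smooth_on_Derive _ _ HK) as [HD1 HD2].
  destruct (implicit_function
    (fun x s => K x * / k - exp (- (INR p * s)) - be * x ^ p * s)
    (fun x s => Derive K x * / k - be * (INR p * x ^ pred p) * s)
    (fun x s => INR p * exp (- (INR p * s)) - be * x ^ p) d 1 q) as [sg Hsg].
  - lra.
  - auto.
  - intros x s Hx Hs. split.
    + auto_derive; auto. ring.
    + destruct (H2' x Hx) as [_ Hq2]. apply Rabs_def2 in Hq2.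
      assert (exp (- INR p) <= exp (- (INR p * s))).
      { destruct (Req_dec s 1) as [->|Hs1]. rewrite Rmult_1_r; lra.
        left. apply exp_increasing. apply Ropp_lt_contravar.
        assert (s <= 1) by (pose proof (Rle_abs s); lra). nra. }
      unfold q in *. nra.
  - intros x Hx. destruct (H2' x Hx) as [Hq2 _]. apply Rabs_def2 in Hq2.
    specialize (H1 x ltac:(lra)). apply Rabs_def2 in H1.
    replace (- (INR p * - (1))) with (INR p) by ring. rewrite Rmult_1_r. lra.
  - intros x s Hx Hs. eapply is_derive_cast.
    apply is_derive_plusR. apply is_derive_plusR. apply is_derive_multR. apply HD1. lra.
    apply @is_derive_const. apply @is_derive_const.
    apply (is_derive_ext (fun y => (- be * s) * y ^ p)). intros t. simpl; ring.
    apply is_derive_multR. apply @is_derive_const. apply is_derive_powR.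
    unfold zero; simpl. ring.
  - intros x s Hx Hs. apply continuity_2d_pt_minus.
    + apply (continuity_1d_2d_pt_comp (fun s => INR p * exp (- (INR p * s))) (fun _ s => s)).
      2: apply continuity_2d_pt_id2.
      apply (is_derive_continuity_pt _ _ (INR p * (exp (- (INR p * s)) * - INR p))).
      auto_derive; auto. ring.
    + apply (continuity_1d_2d_pt_comp (fun x => be * x ^ p) (fun x _ => x)).
      2: apply continuity_2d_pt_id1. apply (smooth_on_continuity r). 2: lra.
      intros n; apply Ck_scal, smooth_on_pow.
  - exists d, sg. split. lra. split; [|split].
    + intros n; induction n as [|n IH]; simpl; auto.
      eexists. split. intros x Hx. apply (Hsg x Hx). cbv beta.
      apply Ck_mult. apply Ck_opp, Ck_minus. apply Ck_mult. apply (Ck_shrink r); auto; lra.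
      apply Ck_const. apply Ck_mult; auto. apply Ck_scal, Ck_scal, smooth_on_pow.
      apply Ck_inv.
      * intros x Hx. destruct (Hsg x Hx) as [Hs _]. destruct (H2' x Hx) as [_ Hq2]. apply Rabs_def2 in Hq2.
        assert (exp (- INR p) <= exp (- (INR p * sg x))).
        { left. apply exp_increasing. apply Ropp_lt_contravar. apply Rabs_def2 in Hs. nra. }
        unfold q in *. nra.
      * apply Ck_minus. apply Ck_scal, Ck_exp, Ck_opp, Ck_scal; auto.
        apply Ck_scal, smooth_on_pow.
    + destruct (Hsg 0) as [_ [_ [U _]]]. now rewrite Rabs_R0. symmetry; apply U.
      rewrite Rabs_R0; lra. rewrite Rmult_0_r, Ropp_0, exp_0, Rmult_0_r. fold k. field; auto.
    + intros x Hx. destruct (Hsg x Hx) as [Hs [E _]]. split; auto.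
      apply Rmult_eq_reg_r with (/ k). 2: now apply Rinv_neq_0_compat.
      transitivity (exp (- (INR p * sg x)) + be * x ^ p * sg x). unfold be; field; auto. lra.
Qed.

(** The derivative is (-p k + b y^p) / y^(p + 1), which cannot vanish while |b y^p| < p |k|. *)
Lemma translation_coordinate_inj (p : nat) (k b : R) : (0 < p)%nat -> k <> 0 ->
  exists del, 0 < del /\ forall u v, 0 < u < del -> 0 < v < del ->
    k / u ^ p + b * ln u = k / v ^ p + b * ln v -> u = v.
Proof.
  intros Hp Hk. assert (Hp0 : 0 < INR p) by now apply lt_0_INR.
  destruct (smooth_small 1 (INR p * Rabs k) (fun x => b * x ^ p)) as [del [Hdel H]].
  lra. apply Rmult_lt_0_compat; auto. now apply Rabs_pos_lt.
  intros n; apply Ck_scal, smooth_on_pow.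
  exists del. split. lra. intros u v Hu Hv E.
  set (Phi := fun y => k / y ^ p + b * ln y) in *.
  assert (HD : forall y, 0 < y -> is_derive Phi y ((- (INR p * k) + b * y ^ p) / y ^ S p)).
  { intros y Hy. assert (y ^ p <> 0) by (apply pow_nonzero; lra).
    eapply is_derive_cast. apply is_derive_plusR. apply is_derive_multR. apply @is_derive_const.
    apply (is_derive_invR (fun y => y ^ p)). apply is_derive_powR. auto.
    apply is_derive_multR. apply @is_derive_const. apply is_derive_ln; auto.
    unfold zero; simpl. replace (y ^ p) with (y * y ^ pred p).
    assert (y ^ pred p <> 0) by (apply pow_nonzero; lra). field; split; auto; lra.
    destruct p. lia. reflexivity. }
  assert (Hb : forall y, Rmin u v <= y <= Rmax u v -> 0 < y < del).
  { intros y Hy. unfold Rmin, Rmax in Hy; destruct (Rle_dec u v); lra. }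
  destruct (MVT_gen Phi u v (fun y => (- (INR p * k) + b * y ^ p) / y ^ S p)) as [z [Hz Ez]].
  intros y Hy; apply HD, Hb; lra.
  intros y Hy; eapply is_derive_continuity_pt, HD, Hb; lra.
  replace (Phi v - Phi u) with 0 in Ez by (unfold Phi; lra).
  destruct (Hb z Hz) as [Hz0 Hzd].
  symmetry in Ez. apply Rmult_integral in Ez. destruct Ez as [Ez|Ez]; [|lra]. exfalso.
  apply Rmult_integral in Ez. destruct Ez as [Ez|Ez].
  - specialize (H z ltac:(rewrite Rabs_pos_eq; lra)).
    rewrite pow_ne_zero, Rmult_0_r, Rminus_0_r in H by lia.
    replace (b * z ^ p) with (INR p * k) in H by lra. rewrite Rabs_mult, (Rabs_pos_eq (INR p)) in H; lra.
  - revert Ez. apply Rinv_neq_0_compat, pow_nonzero. lra.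
Qed.

Lemma conjugate_of_fatou (r rt : R) (m : nat) (K f tau Pi : R -> R) (b : R) :
  0 < r -> (0 < m)%nat -> smooth_on r f -> f 0 = 0 -> Derive f 0 = -1 ->
  smooth_on r K -> K 0 <> 0 -> fatou f (2 * m) r K b -> 0 < rt ->
  (forall x, Rabs x < rt -> Rabs (tau x) <= 1 /\
     K 0 * (exp (- (INR (2 * m) * tau x)) - 1) + b * x ^ (2 * m) * tau x = x ^ (2 * m) / 2) ->
  (forall x, Pi x = - (x * exp (tau x))) ->
  smooth_conjugate_at0 f Pi.
Proof.
  intros Hr Hm Hf Hf0 Hf1 HK HK0 HF Hrt Htau HPi.
  set (p := (2 * m)%nat) in *. assert (Hp : (0 < p)%nat) by lia.
  assert (Habs : forall x, Rabs x ^ p = x ^ p) by (intros x; unfold p; rewrite !pow_mult, pow2_abs; auto).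
  destruct (normal_form_exponent r p K b Hr Hp HK HK0) as [e [sg [He [Hsg [Hsg0 Hsgx]]]]].
  set (k := K 0) in *.
  destruct (translation_coordinate_inj p k b Hp HK0) as [del [Hdel Hinj]].
  set (h := fun x => x * exp (sg x)).
  assert (Hh : smooth_on e h) by (intros n; apply Ck_mult; [apply Ck_id | apply Ck_exp, Hsg]).
  assert (Hh0 : h 0 = 0) by (unfold h; ring).
  assert (R00 : Rabs 0 < e) by (rewrite Rabs_R0; lra).
  assert (Hh1 : Derive h 0 = 1).
  { apply is_derive_unique. eapply is_derive_cast. apply is_derive_multR. apply @is_derive_id.
    apply (is_derive_compR exp sg). apply is_derive_exp. now apply (smooth_on_Derive e sg Hsg).
    unfold one; simpl. rewrite Hsg0, exp_0. ring. }
  destruct (smooth_local_inverse e h) as [e1 [r1 [g [He1 [Hr1 [Hg [Hg0 [Hi1 Hi2]]]]]]]]; auto.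
  lra. rewrite Hh1; lra.
  exists h, g. split; auto. split; auto.
  split. apply (smooth_on_near e); auto; lra. split. now apply (smooth_on_near r1).
  split. { destruct (smooth_small e r1 h) as [s [Hs Hs']]; auto. lra.
    apply locally_0_abs. exists (Rmin s e1). pose proof (Rmin_l s e1). pose proof (Rmin_r s e1).
    split. apply Rmin_pos; lra. intros x Hx. apply Hi2. lra.
    specialize (Hs' x ltac:(lra)). now rewrite Hh0, Rminus_0_r in Hs'. }
  split. { apply locally_0_abs. exists r1. split; auto. intros y Hy. now apply Hi1. }
  destruct (reversing_factor r f Hr Hf Hf0 Hf1) as [rho [Hrho Hphi]].
  assert (E3 : 0 < exp 1) by apply exp_pos.
  set (s := Rmin (Rmin e rho) (Rmin rt (del / exp 1))).
  assert (0 < del / exp 1) by now apply Rdiv_lt_0_compat.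
  assert (Hs : 0 < s) by (unfold s; repeat apply Rmin_pos; lra).
  assert (HL : s <= e /\ s <= rho /\ s <= rt /\ s <= del / exp 1).
  { unfold s. pose proof (Rmin_l (Rmin e rho) (Rmin rt (del / exp 1))).
    pose proof (Rmin_r (Rmin e rho) (Rmin rt (del / exp 1))).
    pose proof (Rmin_l e rho). pose proof (Rmin_r e rho).
    pose proof (Rmin_l rt (del / exp 1)). pose proof (Rmin_r rt (del / exp 1)). lra. }
  assert (Hexp : forall t, Rabs t <= 1 -> exp t <= exp 1).
  { intros t Ht. destruct (Req_dec t 1) as [->|Hn]. lra. left. apply exp_increasing.
    pose proof (Rle_abs t). lra. }
  (* In the coordinate [Phi], injective on each side of 0, both [Pi] and the map induced by
     [f] through [h] are the translation by 1/2. *)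
  set (Phi := fun y => k / y ^ p + b * ln (Rabs y)).
  (* At x exp(t) the coordinate contains exactly the left-hand side of the equation solved by [sg],
     and, up to the constant k, that of the equation for [tau]. *)
  assert (HPhi_exp : forall x t, x <> 0 ->
     Phi (x * exp t) = (k * exp (- (INR p * t)) + b * x ^ p * t) / x ^ p + b * ln (Rabs x)).
  { intros x t Hx. unfold Phi. pose proof (exp_pos t).
    rewrite Rpow_mult_distr, Rabs_mult, (Rabs_pos_eq (exp t)) by lra.
    rewrite ln_mult, ln_exp by auto using Rabs_pos_lt.
    rewrite <- (Rpower_pow p (exp t)) by auto. unfold Rpower. rewrite ln_exp, exp_Ropp.
    pose proof (exp_pos (INR p * t)). field. split. lra. now apply pow_nonzero. }
  assert (HPhi_neg : forall y, Phi (- y) = Phi y).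
  { intros y. unfold Phi. rewrite Rabs_Ropp, <- (Habs (- y)), Rabs_Ropp, Habs. auto. }
  set (w := Rmin (s / 2) (s / exp 1)).
  assert (0 < s / exp 1) by now apply Rdiv_lt_0_compat.
  pose proof (Rmin_l (s / 2) (s / exp 1)). pose proof (Rmin_r (s / 2) (s / exp 1)). fold w in H1, H2.
  assert (Hw0 : 0 < w) by (apply Rmin_pos; lra).
  apply locally_0_abs. exists (w / exp 1). split. now apply Rdiv_lt_0_compat.
  intros x Hx.
  assert (Hex1 : 2 <= exp 1) by (apply (exp_ge_2 1); lia).
  assert (Hmul : forall a t c, Rabs t <= 1 -> Rabs a < c / exp 1 -> Rabs (a * exp t) < c).
  { intros a t c Ht Ha. rewrite Rabs_mult, (Rabs_pos_eq (exp t)) by (left; apply exp_pos).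
    specialize (Hexp t Ht). pose proof (exp_pos t). pose proof (Rabs_pos a).
    apply Rle_lt_trans with (Rabs a * exp 1). apply Rmult_le_compat_l; lra.
    apply Rmult_lt_compat_r with (r := exp 1) in Ha; auto.
    replace (c / exp 1 * exp 1) with c in Ha by (field; lra). auto. }
  assert (Hdiv : forall c, 0 < c -> c / exp 1 <= c).
  { intros c Hc. apply Rmult_le_reg_r with (exp 1); auto.
    replace (c / exp 1 * exp 1) with c by (field; lra). nra. }
  pose proof (Hdiv w Hw0) as Hdw.
  assert (Hxs : Rabs x < s / 2) by lra.
  destruct (Req_dec x 0) as [->|Hx0].
  { rewrite Hf0, Hh0, HPi. ring. }
  destruct (Hphi x ltac:(lra)) as [Ef Hphix]. set (ph := quot0 f x) in *.
  assert (Hfx0 : f x <> 0) by (rewrite Ef; apply Rmult_integral_contrapositive_currified; lra).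
  assert (Hfxs : Rabs (f x) <= 2 * Rabs x).
  { rewrite Ef, Rabs_mult, Rmult_comm. apply Rmult_le_compat_r. apply Rabs_pos. apply Rabs_le; lra. }
  destruct (Hsgx x ltac:(lra)) as [Hsx Esx]. destruct (Hsgx (f x) ltac:(lra)) as [Hsfx Esfx].
  assert (Hhx : Rabs (h x) < w) by (apply Hmul; lra).
  assert (Hhx0 : h x <> 0) by (pose proof (exp_pos (sg x));
    apply Rmult_integral_contrapositive_currified; lra).
  destruct (Htau (h x) ltac:(lra)) as [Ht1 Et].
  assert (P1 : Phi (h (f x)) = Phi (h x) + / 2).
  { unfold h. rewrite !HPhi_exp, Esx, Esfx by auto. apply HF; auto. lra. }
  assert (P2 : Phi (Pi (h x)) = Phi (h x) + / 2).
  { rewrite HPi, HPhi_neg, HPhi_exp by auto. unfold Phi.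
    assert (h x ^ p <> 0) by now apply pow_nonzero.
    replace (k * exp (- (INR p * tau (h x))) + b * h x ^ p * tau (h x)) with (k + h x ^ p / 2) by lra.
    field. auto. }
  assert (Habs2 : Rabs (h (f x)) = Rabs (Pi (h x))).
  { assert (U1 : Rabs (h (f x)) < del).
    { apply Hmul. lra. lra. }
    assert (U2 : Rabs (Pi (h x)) < del).
    { rewrite HPi, Rabs_Ropp. apply Hmul; lra. }
    apply Hinj.
    - split; auto. apply Rabs_pos_lt. pose proof (exp_pos (sg (f x))).
      apply Rmult_integral_contrapositive_currified; lra.
    - split; auto. apply Rabs_pos_lt. rewrite HPi. pose proof (exp_pos (tau (h x))).
      apply Ropp_neq_0_compat, Rmult_integral_contrapositive_currified; lra.
    - rewrite !Habs. change (Phi (h (f x)) = Phi (Pi (h x))). lra. }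
  (* The coordinate is even, hence determines only absolute values. The signs agree because f and Pi
     both exchange the sides of 0 while h preserves them. *)
  assert (Sgn : 0 < h (f x) * Pi (h x)).
  { rewrite HPi. unfold h at 1. rewrite Ef. unfold h at 1.
    pose proof (exp_pos (sg (x * ph))). pose proof (exp_pos (sg x)). pose proof (exp_pos (tau (h x))).
    replace (x * ph * exp (sg (x * ph)) * - (x * exp (sg x) * exp (tau (h x)))) with
      (x ^ 2 * (- ph) * (exp (sg (x * ph)) * exp (sg x) * exp (tau (h x)))) by ring.
    apply Rmult_lt_0_compat. apply Rmult_lt_0_compat. now apply pow2_gt_0. lra.
    repeat apply Rmult_lt_0_compat; auto. }
  revert Habs2 Sgn. generalize (h (f x)) (Pi (h x)). clear. intros u v Huv Sgn.
  unfold Rabs in Huv. destruct (Rcase_abs u), (Rcase_abs v); nra.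
Qed.

(** * Analytic germs *)

Lemma CV_radius_ge (a : nat -> R) (r M : R) :
  (forall n, Rabs (a n * r ^ n) <= M) -> Rbar_le r (CV_radius a).
Proof. intros H. apply (CV_radius_bounded a). now exists M. Qed.

Lemma ex_pseries_bounded (a : nat -> R) (x : R) : ex_pseries a x ->
  exists M, forall n, Rabs (a n * x ^ n) <= M.
Proof.
  intros H. apply ex_pseries_R in H. apply ex_series_lim_0 in H.
  destruct (filterlim_bounded (fun n => a n * x ^ n)) as [M HM].
  exists 0. exact H.
  exists M. exact HM.
Qed.

(** The radius of convergence strictly exceeds [r], so the series converges absolutely up to the
    boundary |x| = r, which the majorants of the composition use. *)
Lemma analytic_at_0 (f : R -> R) : analytic_at f 0 <->
  exists a r, 0 < r /\ Rbar_lt r (CV_radius a) /\ forall x, Rabs x <= r -> f x = PSeries a x.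
Proof.
  split.
  - intros [a Ha]. apply locally_0_abs in Ha. destruct Ha as [d [Hd Ha]].
    exists a, (d / 4). split. lra.
    assert (Hp : forall x, Rabs x < d -> is_pseries a x (f x)).
    { intros x Hx. specialize (Ha x Hx). now rewrite Rminus_0_r in Ha. }
    split.
    + destruct (ex_pseries_bounded a (d / 2)) as [M HM].
      eexists; apply Hp; rewrite Rabs_pos_eq; lra.
      apply CV_radius_ge in HM. apply Rbar_lt_le_trans with (2 := HM). simpl; lra.
    + intros x Hx. symmetry. apply is_pseries_unique, Hp. lra.
  - intros [a [r [Hr [Ha Hf]]]]. exists a. apply locally_0_abs. exists r. split; auto.
    intros x Hx. rewrite Rminus_0_r, Hf by lra. apply PSeries_correct, CV_radius_inside.
    apply Rbar_lt_trans with (2 := Ha). exact Hx.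
Qed.

Lemma Rbar_lt_abs (a : nat -> R) (r x : R) : Rbar_lt r (CV_radius a) -> Rabs x <= r ->
  Rbar_lt (Rabs x) (CV_radius a).
Proof. intros H Hx. apply Rbar_le_lt_trans with (2 := H). exact Hx. Qed.

Lemma PSeries_smooth (a : nat -> R) (r : R) : Rbar_lt r (CV_radius a) -> smooth_on r (PSeries a).
Proof.
  intros H n. revert a H; induction n as [|n IH]; intros a H; simpl; auto.
  exists (PSeries (PS_derive a)). split.
  intros x Hx. apply is_derive_PSeries. apply (Rbar_lt_abs a r); auto. lra.
  apply IH. now rewrite CV_radius_derive.
Qed.

Lemma analytic_smooth (f : R -> R) : analytic_at f 0 -> exists r, 0 < r /\ smooth_on r f.
Proof.
  intros H. apply analytic_at_0 in H. destruct H as [a [r [Hr [Ha Hf]]]].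
  exists r. split; auto. intros n. apply (Ck_ext r n (PSeries a)).
  intros x Hx. symmetry. apply Hf. lra. now apply PSeries_smooth.
Qed.

Lemma analytic_mult (f g : R -> R) : analytic_at f 0 -> analytic_at g 0 ->
  analytic_at (fun x => f x * g x) 0.
Proof.
  intros Hf Hg. apply analytic_at_0 in Hf, Hg.
  destruct Hf as [a [r [Hr [Ha Hf]]]], Hg as [b [s [Hs [Hb Hg]]]].
  exists (PS_mult a b). apply locally_0_abs. exists (Rmin r s). split. now apply Rmin_pos.
  intros x Hx. rewrite Rminus_0_r. pose proof (Rmin_l r s). pose proof (Rmin_r r s).
  pose proof (Rbar_lt_abs a r x Ha ltac:(lra)). pose proof (Rbar_lt_abs b s x Hb ltac:(lra)).
  apply is_pseries_mult; auto.
  rewrite Hf by lra. now apply PSeries_correct, CV_radius_inside.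
  rewrite Hg by lra. now apply PSeries_correct, CV_radius_inside.
Qed.

Lemma ex_series_extR (a b : nat -> R) : (forall n, a n = b n) -> ex_series a -> ex_series b.
Proof. apply ex_series_ext. Qed.

Lemma is_series_zero : is_series (fun _ : nat => 0) 0.
Proof.
  change (is_lim_seq (sum_n (fun _ : nat => 0)) 0).
  apply (is_lim_seq_ext (fun _ => 0)). intros n. rewrite sum_n_const. ring.
  apply is_lim_seq_const.
Qed.

Lemma analytic_const (c : R) : analytic_at (fun _ => c) 0.
Proof.
  exists (fun n => match n with 0%nat => c | _ => 0 end). apply filter_forall. intros x.
  apply is_pseries_R. apply is_series_decr_1.
  apply (is_series_ext (fun _ => 0)). intros n. symmetry. apply Rmult_0_l.
  match goal with |- is_series _ ?l => replace l with 0 end. apply is_series_zero.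
  unfold plus, opp; simpl. ring.
Qed.

Lemma analytic_id : analytic_at (fun x => x) 0.
Proof.
  exists (fun n => match n with 1%nat => 1 | _ => 0 end). apply filter_forall. intros x.
  rewrite Rminus_0_r. apply is_pseries_R. apply is_series_decr_1, is_series_decr_1.
  apply (is_series_ext (fun _ => 0)). intros n. symmetry. apply Rmult_0_l.
  match goal with |- is_series _ ?l => replace l with 0 end. apply is_series_zero.
  unfold plus, opp; simpl. ring.
Qed.

Lemma analytic_pow (p : nat) : analytic_at (fun x => x ^ p) 0.
Proof.
  induction p as [|p IH]; simpl. apply analytic_const. apply analytic_mult; auto. apply analytic_id.
Qed.

Lemma analytic_exp : analytic_at exp 0.
Proof.
  exists (fun n => / INR (fact n)). apply filter_forall. intros x.
  rewrite Rminus_0_r. apply is_exp_Reals.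
Qed.

(** * Composition of power series *)

(** Dominated convergence for series: the tail is small uniformly in N by domination, and the head
    is a finite sum of null sequences. *)
Lemma Series_tannery (q : nat -> nat -> R) (D : nat -> R) : ex_series D ->
  (forall N n, Rabs (q N n) <= D n) -> (forall n, is_lim_seq (fun N => q N n) 0) ->
  is_lim_seq (fun N => Series (q N)) 0.
Proof.
  intros HD Hq Hl. apply is_lim_seq_spec. intros eps.
  assert (Hex : forall N, ex_series (q N)).
  { intros N. apply (Series_dom (q N) D 1); auto. intros n. rewrite Rmult_1_l. apply Hq. }
  assert (Htail : exists M, (0 < M)%nat /\ Series (fun k => D (M + k)%nat) < eps / 2).
  { assert (L : is_lim_seq (sum_n D) (Series D)) by exact (Series_correct D HD).
    apply is_lim_seq_spec in L. assert (He : 0 < eps / 2) by (pose proof (cond_pos eps); lra).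
    destruct (L (mkposreal _ He)) as [M HM]. exists (S M). split. lia.
    specialize (HM M (le_n M)). simpl in HM. rewrite sum_n_Reals in HM.
    pose proof (Series_incr_n D (S M) ltac:(lia) HD) as E. simpl Nat.pred in E.
    apply Rabs_def2 in HM. lra. }
  destruct Htail as [M [HM0 HM]].
  assert (L : is_lim_seq (fun N => sum_f_R0 (q N) (Nat.pred M)) 0).
  { generalize (Nat.pred M) as m. induction m as [|m IH]; simpl; auto.
    replace (Finite 0) with (Finite (0 + 0)) by (f_equal; ring).
    now apply is_lim_seq_plus'. }
  apply is_lim_seq_spec in L. assert (He : 0 < eps / 2) by (pose proof (cond_pos eps); lra).
  destruct (L (mkposreal _ He)) as [N0 HN0]. exists N0. intros N HN. specialize (HN0 N HN).
  simpl in HN0. rewrite Rminus_0_r in *.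
  rewrite (Series_incr_n (q N) M HM0 (Hex N)).
  apply Rle_lt_trans with (1 := Rabs_triang _ _).
  destruct (Series_dom (fun k => q N (M + k)%nat) (fun k => D (M + k)%nat) 1) as [_ HS].
  now apply ex_series_incr_n. intros n. rewrite Rmult_1_l. apply Hq. lra.
Qed.

Fixpoint PS_pow (a : nat -> R) (n : nat) : nat -> R :=
  match n with
  | 0%nat => fun k => match k with 0%nat => 1 | _ => 0 end
  | S m => PS_mult a (PS_pow a m)
  end.

Lemma PS_mult_term (a b : nat -> R) (x : R) (n : nat) :
  PS_mult a b n * x ^ n = sum_f_R0 (fun k => (a k * x ^ k) * (b (n - k)%nat * x ^ (n - k))) n.
Proof.
  unfold PS_mult. rewrite Rmult_comm, scal_sum. apply sum_eq. intros i Hi.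
  replace (x ^ n) with (x ^ i * x ^ (n - i)) by (rewrite <- pow_add; f_equal; lia). ring.
Qed.

Lemma is_series_one_pow (x : R) :
  is_series (fun k => match k with 0%nat => 1 | _ => 0 end * x ^ k) 1.
Proof.
  apply is_series_decr_1.
  apply (is_series_ext (fun _ => 0)). intros n. symmetry. apply Rmult_0_l.
  match goal with |- is_series _ ?l => replace l with 0 end. apply is_series_zero.
  unfold plus, opp; simpl. ring.
Qed.

Lemma PS_pow_nonneg (a : nat -> R) (n k : nat) : (forall i, 0 <= a i) -> 0 <= PS_pow a n k.
Proof.
  intros Ha; revert k; induction n as [|n IH]; intros k; simpl. destruct k; lra.
  apply cond_pos_sum. intros i. now apply Rmult_le_pos.
Qed.

Lemma PS_pow_abs (a : nat -> R) (n k : nat) :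
  Rabs (PS_pow a n k) <= PS_pow (fun i => Rabs (a i)) n k.
Proof.
  revert k; induction n as [|n IH]; intros k; simpl.
  destruct k. rewrite Rabs_R1; lra. rewrite Rabs_R0; lra.
  apply Rle_trans with (1 := Rsum_abs _ _). apply sum_Rle. intros i Hi.
  rewrite Rabs_mult. apply Rmult_le_compat_l. apply Rabs_pos. apply IH.
Qed.

Lemma is_series_PS_pow_abs (a : nat -> R) (t S0 : R) (n : nat) : 0 <= t ->
  is_series (fun k => Rabs (a k) * t ^ k) S0 ->
  is_series (fun k => PS_pow (fun i => Rabs (a i)) n k * t ^ k) (S0 ^ n).
Proof.
  intros Ht Ha; induction n as [|n IH]; simpl. apply is_series_one_pow.
  eapply is_series_ext. intros k. symmetry. apply PS_mult_term.
  apply (is_series_mult_pos (fun k => Rabs (a k) * t ^ k)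
    (fun k => PS_pow (fun i => Rabs (a i)) n k * t ^ k)); auto.
  intros k. apply Rmult_le_pos. apply Rabs_pos. now apply pow_le.
  intros k. apply Rmult_le_pos. apply PS_pow_nonneg. intros; apply Rabs_pos. now apply pow_le.
Qed.

Lemma PS_term_abs_le (c x t y : R) (k : nat) : Rabs c <= y -> Rabs x <= t ->
  Rabs (c * x ^ k) <= y * t ^ k.
Proof.
  intros Hc Hx. rewrite Rabs_mult, <- RPow_abs.
  apply Rmult_le_compat; auto. apply Rabs_pos. apply pow_le, Rabs_pos.
  apply pow_incr. split; auto. apply Rabs_pos.
Qed.

Lemma is_series_PS_pow (a : nat -> R) (x t S0 l : R) (n : nat) : Rabs x <= t ->
  is_series (fun k => Rabs (a k) * t ^ k) S0 -> is_series (fun k => a k * x ^ k) l ->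
  is_series (fun k => PS_pow a n k * x ^ k) (l ^ n).
Proof.
  intros Hx HA Ha. assert (Ht : 0 <= t) by (pose proof (Rabs_pos x); lra).
  induction n as [|n IH]; simpl. apply is_series_one_pow.
  eapply is_series_ext. intros k. symmetry. apply PS_mult_term.
  apply (is_series_mult (fun k => a k * x ^ k) (fun k => PS_pow a n k * x ^ k)); auto.
  - apply (@ex_series_le R_AbsRing R_CompleteNormedModule) with (b := fun k => Rabs (a k) * t ^ k).
    intros k. unfold norm; simpl; unfold abs; simpl. rewrite Rabs_Rabsolu.
    apply PS_term_abs_le; auto. lra. now exists S0.
  - apply (@ex_series_le R_AbsRing R_CompleteNormedModule)
      with (b := fun k => PS_pow (fun i => Rabs (a i)) n k * t ^ k).
    intros k. unfold norm; simpl; unfold abs; simpl. rewrite Rabs_Rabsolu.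
    apply PS_term_abs_le; auto. apply PS_pow_abs. exists (S0 ^ n). now apply is_series_PS_pow_abs.
Qed.

(** The k-th coefficient is the sum over n of b_n times the k-th coefficient of u^n. The order of
    summation is exchanged by dominated convergence, with majorants |b_n| S0^n where S0 is the sum
    of |a_k| t^k. *)
Lemma analytic_comp (v u : R -> R) : analytic_at v 0 -> analytic_at u 0 -> u 0 = 0 ->
  analytic_at (fun x => v (u x)) 0.
Proof.
  intros Hv Hu Hu0. apply analytic_at_0 in Hv, Hu.
  destruct Hv as [b [s [Hs [Hb Hv]]]], Hu as [a [r [Hr [Ha Hu]]]].
  assert (Ha0 : a 0%nat = 0).
  { rewrite <- Hu0, Hu, PSeries_0; auto. rewrite Rabs_R0; lra. }
  assert (HA : forall t, 0 <= t <= r -> ex_series (fun k => Rabs (a k) * t ^ k)).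
  { intros t Ht. apply (ex_series_extR (fun k => Rabs (a k * t ^ k))).
    intros k. rewrite Rabs_mult, (Rabs_pos_eq (t ^ k)); auto. apply pow_le; lra.
    apply CV_disk_inside. apply (Rbar_lt_abs a r); auto. rewrite Rabs_pos_eq; lra. }
  set (M := Series (fun k => Rabs (a (S k)) * r ^ k)).
  assert (Hex1 : ex_series (fun k => Rabs (a (S k)) * r ^ k)).
  { apply (ex_series_extR (fun k => (Rabs (a (S k)) * r ^ S k) * / r)).
    intros k. simpl. field. lra. apply @ex_series_scal_r.
    apply (ex_series_incr_1 (fun k => Rabs (a k) * r ^ k)). apply HA; lra. }
  assert (HM0 : 0 <= M).
  { apply Rle_trans with (Series (fun _ : nat => 0)).
    right. symmetry. apply is_series_unique, is_series_zero.
    apply Series_le; auto. intros n. split. lra.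
    apply Rmult_le_pos. apply Rabs_pos. apply pow_le; lra. }
  (* As a_0 = 0, the sum S0 of |a_k| t^k is at most t M <= s, so it lies inside the disc of
     convergence of the outer series. *)
  set (t := Rmin r (s / (M + 1))).
  assert (Ht : 0 < t). { apply Rmin_pos; auto. apply Rdiv_lt_0_compat; lra. }
  pose proof (Rmin_l r (s / (M + 1))) as Htr. pose proof (Rmin_r r (s / (M + 1))) as Hts. fold t in Htr, Hts.
  set (S0 := Series (fun k => Rabs (a k) * t ^ k)).
  assert (HS0 : is_series (fun k => Rabs (a k) * t ^ k) S0) by (apply Series_correct, HA; lra).
  assert (HS0s : 0 <= S0 <= s).
  { unfold S0. rewrite Series_incr_1 by (apply HA; lra). rewrite Ha0, Rabs_R0, Rmult_0_l, Rplus_0_l.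
    rewrite (Series_ext _ (fun k => t * (Rabs (a (S k)) * t ^ k))) by (intros; simpl; ring).
    rewrite Series_scal_l.
    assert (HH : 0 <= Series (fun k => Rabs (a (S k)) * t ^ k) <= M).
    { assert (HL : forall n, 0 <= Rabs (a (S n)) * t ^ n <= Rabs (a (S n)) * r ^ n).
      { intros n. split. apply Rmult_le_pos. apply Rabs_pos. apply pow_le; lra.
        apply Rmult_le_compat_l. apply Rabs_pos. apply pow_incr; lra. }
      split.
      - assert (E := Series_dom (fun n => Rabs (a (S n)) * t ^ n) (fun k => Rabs (a (S k)) * r ^ k) 1 Hex1).
        destruct E as [E _]. intros n. rewrite Rmult_1_l, Rabs_pos_eq; apply HL.
        apply Rle_trans with (Series (fun n => 0 * (Rabs (a (S n)) * t ^ n))).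
        rewrite Series_scal_l; lra. apply Series_le; auto. intros n. specialize (HL n). lra.
      - apply Series_le; auto. }
    split. apply Rmult_le_pos; lra.
    apply Rle_trans with (s / (M + 1) * (M + 1)). apply Rmult_le_compat; lra. right; field; lra. }
  assert (Hbs : ex_series (fun n => Rabs (b n) * S0 ^ n)).
  { apply (ex_series_extR (fun k => Rabs (b k * S0 ^ k))).
    intros k. rewrite Rabs_mult, (Rabs_pos_eq (S0 ^ k)); auto. apply pow_le; lra.
    apply CV_disk_inside. apply (Rbar_lt_abs b s); auto. rewrite Rabs_pos_eq; lra. }
  assert (Hnk : forall n x, Rabs x <= t -> forall N,
     Rabs (sum_f_R0 (fun k => PS_pow a n k * x ^ k) N) <= S0 ^ n).
  { intros n x Hx N. apply Rle_trans with (1 := Rsum_abs _ _).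
    apply Rle_trans with (sum_f_R0 (fun k => PS_pow (fun i => Rabs (a i)) n k * t ^ k) N).
    apply sum_Rle. intros k Hk. apply PS_term_abs_le; auto. apply PS_pow_abs.
    rewrite <- sum_n_Reals.
    apply (is_lim_seq_incr_compare (sum_n (fun k => PS_pow (fun i => Rabs (a i)) n k * t ^ k))).
    exact (is_series_PS_pow_abs a t S0 n ltac:(lra) HS0).
    intros m. rewrite sum_SnR.
    assert (0 <= PS_pow (fun i => Rabs (a i)) n (S m) * t ^ S m); [|lra].
    apply Rmult_le_pos. apply PS_pow_nonneg. intros; apply Rabs_pos. apply pow_le; lra. }
  set (cc := fun k => Series (fun n => b n * PS_pow a n k)).
  assert (Hcc : forall k, ex_series (fun n => b n * PS_pow a n k)).
  { intros k. apply (Series_dom (fun n => b n * PS_pow a n k) (fun n => Rabs (b n) * S0 ^ n) (/ t ^ k)).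
    auto. intros n. assert (Htk : 0 < t ^ k) by now apply pow_lt.
    apply Rmult_le_reg_r with (t ^ k); auto.
    replace (/ t ^ k * (Rabs (b n) * S0 ^ n) * t ^ k) with (Rabs (b n) * S0 ^ n) by (field; lra).
    rewrite Rabs_mult, Rmult_assoc. apply Rmult_le_compat_l. apply Rabs_pos.
    apply Rle_trans with (PS_pow (fun i => Rabs (a i)) n k * t ^ k).
    apply Rmult_le_compat_r. lra. apply PS_pow_abs.
    assert (Hnn : forall i, 0 <= PS_pow (fun i => Rabs (a i)) n i * t ^ i).
    { intros i. apply Rmult_le_pos. apply PS_pow_nonneg. intros; apply Rabs_pos. apply pow_le; lra. }
    apply Rle_trans with (sum_n (fun i => PS_pow (fun i => Rabs (a i)) n i * t ^ i) k).
    { rewrite sum_n_Reals. destruct k; simpl sum_f_R0. lra.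
      pose proof (cond_pos_sum (fun i => PS_pow (fun i => Rabs (a i)) n i * t ^ i) k Hnn). simpl in *. lra. }
    apply (is_lim_seq_incr_compare (sum_n (fun k => PS_pow (fun i => Rabs (a i)) n k * t ^ k))).
    exact (is_series_PS_pow_abs a t S0 n ltac:(lra) HS0).
    intros m. rewrite sum_SnR. specialize (Hnn (S m)). lra. }
  exists cc. apply locally_0_abs. exists t. split; auto. intros x Hx. rewrite Rminus_0_r.
  assert (Hux : is_series (fun k => a k * x ^ k) (u x)).
  { rewrite Hu by lra. apply is_pseries_R, PSeries_correct, CV_radius_inside, (Rbar_lt_abs a r); auto. lra. }
  assert (Hpw : forall n, is_series (fun k => PS_pow a n k * x ^ k) (u x ^ n)).
  { intros n. apply (is_series_PS_pow a x t S0); auto. lra. }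
  assert (Huxs : forall n, Rabs (u x ^ n) <= S0 ^ n).
  { intros n. specialize (Hpw n).
    assert (L : is_lim_seq (fun N => Rabs (sum_f_R0 (fun k => PS_pow a n k * x ^ k) N)) (Rabs (u x ^ n))).
    { apply (is_lim_seq_abs _ (u x ^ n)).
      apply (is_lim_seq_ext (sum_n (fun k => PS_pow a n k * x ^ k))). intros; apply sum_n_Reals. exact Hpw. }
    apply (is_lim_seq_le (fun N => Rabs (sum_f_R0 (fun k => PS_pow a n k * x ^ k) N))
      (fun _ => S0 ^ n) (Finite (Rabs (u x ^ n))) (Finite (S0 ^ n))); auto.
    intros N. apply Hnk. lra. apply is_lim_seq_const. }
  assert (Hux1 : Rabs (u x) <= s).
  { specialize (Huxs 1%nat). rewrite !pow_1 in Huxs. lra. }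
  apply is_pseries_R. rewrite Hv by auto.
  (* The error made in the n-th term of the outer series when u^n is cut at degree N. *)
  set (q := fun N n => b n * (sum_f_R0 (fun k => PS_pow a n k * x ^ k) N - u x ^ n)).
  assert (Hlim : is_lim_seq (fun N => Series (q N)) 0).
  { apply (Series_tannery q (fun n => 2 * (Rabs (b n) * S0 ^ n))).
    now apply @ex_series_scal.
    intros N n. unfold q. rewrite Rabs_mult.
    pose proof (Hnk n x ltac:(lra) N). specialize (Huxs n).
    pose proof (Rabs_triang (sum_f_R0 (fun k => PS_pow a n k * x ^ k) N) (- u x ^ n)).
    rewrite Rabs_Ropp in H0. pose proof (Rabs_pos (b n)).
    replace (2 * (Rabs (b n) * S0 ^ n)) with (Rabs (b n) * (2 * S0 ^ n)) by ring.
    apply Rmult_le_compat_l; auto. unfold Rminus. lra.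
    intros n. unfold q. replace (Finite 0) with (Rbar_mult (b n) (u x ^ n - u x ^ n)) by (simpl; f_equal; ring).
    apply is_lim_seq_scal_l. apply is_lim_seq_minus'. 2: apply is_lim_seq_const.
    apply (is_lim_seq_ext (sum_n (fun k => PS_pow a n k * x ^ k))). intros; apply sum_n_Reals. exact (Hpw n). }
  assert (Hsum : forall N, ex_series (fun n => b n * sum_f_R0 (fun k => PS_pow a n k * x ^ k) N) /\
     Series (fun n => b n * sum_f_R0 (fun k => PS_pow a n k * x ^ k) N) = sum_n (fun k => cc k * x ^ k) N).
  { induction N as [|N [I1 I2]].
    - rewrite sum_O. simpl. split.
      apply (ex_series_extR (fun n => b n * PS_pow a n 0%nat)); auto. intros; symmetry; apply f_equal, Rmult_1_r.
      unfold cc. rewrite Rmult_1_r. apply Series_ext. intros; ring.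
    - rewrite sum_SnR, <- I2. unfold cc. rewrite <- Series_scal_r.
      assert (I3 : ex_series (fun n => b n * PS_pow a n (S N) * x ^ S N)) by now apply @ex_series_scal_r.
      split.
      apply (ex_series_extR (fun n => b n * sum_f_R0 (fun k => PS_pow a n k * x ^ k) N + b n * PS_pow a n (S N) * x ^ S N)).
      intros n. cbv beta. rewrite tech5. ring. now apply @ex_series_plus.
      rewrite <- Series_plus; auto. apply Series_ext. intros n; simpl; ring. }
  assert (Hvx : ex_series (fun n => b n * u x ^ n)).
  { apply ex_pseries_R, CV_radius_inside, (Rbar_lt_abs b s); auto. }
  change (is_lim_seq (sum_n (fun k => cc k * x ^ k)) (PSeries b (u x))).
  apply (is_lim_seq_ext (fun N => Series (q N) + PSeries b (u x))).
  - intros N. destruct (Hsum N) as [I1 I2]. rewrite <- I2.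
    unfold q, PSeries. rewrite <- Series_plus; auto. apply Series_ext. intros n. ring.
    apply (ex_series_extR (fun n => b n * sum_f_R0 (fun k => PS_pow a n k * x ^ k) N - b n * u x ^ n)).
    intros n; ring. now apply @ex_series_minus.
  - replace (Finite (PSeries b (u x))) with (Finite (0 + PSeries b (u x))) by (f_equal; ring).
    apply is_lim_seq_plus'; auto. apply is_lim_seq_const.
Qed.

(** Analyticity excludes flat germs: the least nonzero coefficient gives the order, and the shifted
    series the cofactor. *)
Lemma analytic_order (D : R -> R) : analytic_at D 0 ->
  (exists r, 0 < r /\ forall x, Rabs x < r -> D x = 0) \/
  exists r n B, 0 < r /\ smooth_on r B /\ B 0 <> 0 /\ forall x, Rabs x < r -> D x = x ^ n * B x.
Proof.
  intros H. apply analytic_at_0 in H. destruct H as [c [r [Hr [Hc HD]]]].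
  destruct (Classical_Prop.classic (forall n, c n = 0)) as [Hz|Hn].
  - left. exists r. split; auto. intros x Hx. rewrite HD by lra.
    rewrite (PSeries_ext c (fun _ => 0)) by auto. apply PSeries_const_0.
  - right. apply Classical_Pred_Type.not_all_ex_not in Hn.
    destruct (dec_inh_nat_subset_has_unique_least_element (fun n => c n <> 0)) as [n [[Hn0 Hmin] _]]; auto.
    intros n. destruct (Req_dec (c n) 0); auto.
    exists (r / 2), n, (PSeries (PS_decr_n c n)). split. lra. split; [|split].
    + apply PSeries_smooth.
      destruct (ex_pseries_bounded c r) as [M HM].
      { apply CV_radius_inside. rewrite Rabs_pos_eq by lra. exact Hc. }
      apply Rbar_lt_le_trans with (Finite r). simpl; lra.
      apply (CV_radius_ge _ r (M / r ^ n)). intros k. unfold PS_decr_n.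
      specialize (HM (n + k)%nat). rewrite pow_add in HM.
      assert (Hrn : 0 < r ^ n) by now apply pow_lt.
      apply Rmult_le_reg_r with (r ^ n); auto.
      replace (M / r ^ n * r ^ n) with M by (field; lra).
      rewrite <- (Rabs_pos_eq (r ^ n)) at 1 by lra. rewrite <- Rabs_mult.
      replace (c (n + k)%nat * r ^ k * r ^ n) with (c (n + k)%nat * (r ^ n * r ^ k)) by ring. auto.
    + rewrite PSeries_0. unfold PS_decr_n. now rewrite Nat.add_0_r.
    + intros x Hx. rewrite HD by lra. apply PSeries_decr_n_aux.
      intros k Hk. destruct (Req_dec (c k) 0) as [|Hck]; auto. specialize (Hmin k Hck). lia.
Qed.

(** * The exponent of the half-return map as a power series *)

Lemma rsum_S (x : nat -> R) (N : nat) : rsum x (S N) = x 0%nat + rsum (fun i => x (S i)) N.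
Proof. induction N as [|N IH]. simpl; ring. cbn [rsum] in *. rewrite IH. ring. Qed.

Lemma rsum_le (x y : nat -> R) (N : nat) : (forall i, x i <= y i) -> rsum x N <= rsum y N.
Proof. intros H; induction N as [|N IH]; simpl. lra. specialize (H N). lra. Qed.

Lemma rsum_nonneg (x : nat -> R) (N : nat) : (forall i, 0 <= x i) -> 0 <= rsum x N.
Proof. intros H; induction N as [|N IH]; simpl. lra. specialize (H N). lra. Qed.

(** The left side sums x_i y_j over the triangle i + j < N, the right side over the square
    containing it. *)
Lemma rsum_conv_le (x y : nat -> R) (N : nat) : (forall i, 0 <= x i) -> (forall i, 0 <= y i) ->
  rsum (fun n => sum_f_R0 (fun i => x i * y (n - i)%nat) n) N <= rsum x N * rsum y N.
Proof.
  intros Hx Hy. revert x Hx. induction N as [|N IH]; intros x Hx. simpl; lra.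
  specialize (IH (fun i => x (S i)) (fun i => Hx (S i))). cbv beta in IH.
  assert (E : rsum (fun n => sum_f_R0 (fun i => x i * y (n - i)%nat) n) (S N) =
     x 0%nat * rsum y (S N) + rsum (fun n => sum_f_R0 (fun i => x (S i) * y (n - i)%nat) n) N).
  { rewrite rsum_S, (rsum_S y). cbv beta.
    change (sum_f_R0 (fun i => x i * y (0 - i)%nat) 0) with (x 0%nat * y 0%nat).
    assert (E1 : rsum (fun i => sum_f_R0 (fun i0 => x i0 * y (S i - i0)%nat) (S i)) N =
      rsum (fun i => x 0%nat * y (S i) + sum_f_R0 (fun j => x (S j) * y (i - j)%nat) i) N).
    { clear. induction N as [|N IH]; cbn [rsum]; auto. rewrite IH. f_equal.
      rewrite decomp_sum by lia. reflexivity. }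
    rewrite E1. assert (E2 : forall a b N, rsum (fun i => x 0%nat * a i + b i) N = x 0%nat * rsum a N + rsum b N).
    { clear. intros a b. induction N as [|N IH]; simpl; [ring|rewrite IH; ring]. }
    rewrite E2. ring. }
  rewrite E, (rsum_S x). cbn [rsum]. pose proof (rsum_nonneg y N Hy).
  pose proof (rsum_nonneg (fun i => x (S i)) N (fun i => Hx (S i))). specialize (Hy N). nra.
Qed.

(** Comparison of the coefficients of x^n in -P T' = la - be T + (P la - be) x T' - (P be / 2) x
    (T^2)'. Writing 2 T T' as (T^2)' turns the nonlinear term into n times the n-th coefficient of
    T^2, whose factor n is absorbed by the division by n + 1. *)
Definition quad_step (P la be : R) (n : nat) (s : nat -> R) : R :=
  (- (match n with 0%nat => la | _ => 0 end) + be * s n - (P * la - be) * (INR n * s n)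
   + P * be / 2 * (INR n * PS_mult s s n)) / (P * INR (S n)).

(** The recursion uses all earlier coefficients through the Cauchy product, so a whole table is
    carried: stage [S k] adds the entry [S k] and keeps the others. *)
Fixpoint quad_table (P la be : R) (n : nat) : nat -> R :=
  match n with
  | 0%nat => fun _ => 0
  | S k => fun j => if Nat.eq_dec j (S k) then quad_step P la be k (quad_table P la be k)
                    else quad_table P la be k j
  end.

(* Coefficients of the power series solution [tau] of the equation obtained by
   differentiating [exp (- P * tau) = 1 + la * x - be * x * tau] and eliminating the exponential. *)
Definition quad_coef (P la be : R) (n : nat) : R := quad_table P la be n n.

Lemma quad_coef_S (P la be : R) (n : nat) :
  quad_coef P la be (S n) = quad_step P la be n (quad_coef P la be).
Proof.
  assert (HT : forall n j, (j <= n)%nat -> quad_table P la be n j = quad_coef P la be j).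
  { clear n. induction n as [|n IH]; intros j Hj. replace j with 0%nat by lia. auto.
    destruct (Nat.eq_dec j (S n)) as [->|Hn]. reflexivity.
    simpl. destruct (Nat.eq_dec j (S n)). lia. apply IH. lia. }
  unfold quad_coef at 1. cbn [quad_table]. destruct (Nat.eq_dec (S n) (S n)) as [_|]; [|lia].
  unfold quad_step. rewrite HT by auto.
  replace (PS_mult (quad_table P la be n) (quad_table P la be n) n)
    with (PS_mult (quad_coef P la be) (quad_coef P la be) n); auto.
  apply sum_eq. intros i Hi. rewrite !HT by lia. auto.
Qed.

(* With [M] a bound of the recursion and [rho = 1 / (3 M)], the partial sums [S_N] of
   [|s_n| rho^n] satisfy [S_(N+1) <= rho * M * (1 + S_N + S_N ^ 2)], hence stay below 1. *)
Lemma quad_coef_radius (P la be : R) : 1 <= P -> exists rho, 0 < rho /\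
  Rbar_le rho (CV_radius (quad_coef P la be)).
Proof.
  intros HP. set (s := quad_coef P la be).
  set (M := Rabs la + Rabs be + Rabs (P * la - be) + Rabs (P * be / 2) + 1).
  pose proof (Rabs_pos la). pose proof (Rabs_pos be). pose proof (Rabs_pos (P * la - be)).
  pose proof (Rabs_pos (P * be / 2)).
  assert (HM : 1 <= M) by (unfold M; lra).
  assert (Hst : forall n, Rabs (s (S n)) <=
     M * ((match n with 0%nat => 1 | _ => 0 end) + Rabs (s n) + sum_f_R0 (fun i => Rabs (s i) * Rabs (s (n - i)%nat)) n)).
  { intros n. unfold s at 1. rewrite quad_coef_S. fold s. unfold quad_step.
    set (cv := sum_f_R0 (fun i => Rabs (s i) * Rabs (s (n - i)%nat)) n).
    assert (Hcv : Rabs (PS_mult s s n) <= cv).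
    { apply Rle_trans with (1 := Rsum_abs _ _). apply sum_Rle. intros i Hi. rewrite Rabs_mult. lra. }
    set (dl := match n with 0%nat => 1 | _ => 0 end).
    assert (Hdl : 0 <= dl) by (unfold dl; destruct n; lra).
    assert (Hld : Rabs (match n with 0%nat => la | _ => 0 end) <= Rabs la * dl).
    { unfold dl. destruct n. lra. rewrite Rabs_R0. lra. }
    pose proof (pos_INR n) as Hn. rewrite S_INR.
    assert (HPn : 0 < P * (INR n + 1)) by nra.
    unfold Rdiv. rewrite Rabs_mult, Rabs_inv, (Rabs_pos_eq (P * _)) by lra.
    apply Rmult_le_reg_r with (P * (INR n + 1)); auto.
    rewrite Rmult_assoc, Rinv_l, Rmult_1_r by lra.
    set (sn := s n) in *. set (pn := PS_mult s s n) in *.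
    set (ld := match n with 0%nat => la | _ => 0 end) in *.
    apply Rle_trans with (Rabs la * dl + Rabs be * Rabs sn + Rabs (P * la - be) * (INR n * Rabs sn) +
      Rabs (P * be / 2) * (INR n * cv)).
    { replace (Rabs (P * be / 2) * (INR n * cv)) with (Rabs (P * be / 2) * INR n * cv) by ring.
      apply Rle_trans with (1 := Rabs_triang _ _). apply Rplus_le_compat.
      unfold Rminus. apply Rle_trans with (1 := Rabs_triang _ _). apply Rplus_le_compat.
      apply Rle_trans with (1 := Rabs_triang _ _). apply Rplus_le_compat.
      rewrite Rabs_Ropp; auto. rewrite Rabs_mult; lra.
      rewrite Rabs_Ropp, !Rabs_mult, (Rabs_pos_eq (INR n)); lra.
      fold (P * be / 2). rewrite (Rabs_mult (P * be / 2)), (Rabs_mult (INR n)), (Rabs_pos_eq (INR n)) by lra.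
      rewrite <- Rmult_assoc. apply Rmult_le_compat_l; auto. now apply Rmult_le_pos. }
    pose proof (Rabs_pos sn). assert (0 <= cv) by (pose proof (Rabs_pos pn); lra).
    assert (HN1 : 1 <= P * (INR n + 1)) by nra. assert (HN2 : INR n <= P * (INR n + 1)) by nra.
    set (Q := P * (INR n + 1)) in *.
    replace (M * (dl + Rabs sn + cv) * Q) with ((M * dl) * Q + (M * Rabs sn) * Q + (M * cv) * Q) by ring.
    assert (Rabs la * dl <= (M * dl) * Q).
    { apply Rle_trans with (M * dl). apply Rmult_le_compat_r; auto. unfold M; lra. 
      rewrite <- (Rmult_1_r (M * dl)) at 1. apply Rmult_le_compat_l; auto. apply Rmult_le_pos; lra. }
    assert (Rabs be * Rabs sn + Rabs (P * la - be) * (INR n * Rabs sn) <= (M * Rabs sn) * Q).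
    { apply Rle_trans with ((Rabs be + Rabs (P * la - be)) * Rabs sn * Q).
      replace ((Rabs be + Rabs (P * la - be)) * Rabs sn * Q) with
        (Rabs be * Rabs sn * Q + Rabs (P * la - be) * Rabs sn * Q) by ring.
      apply Rplus_le_compat. rewrite <- (Rmult_1_r (Rabs be * Rabs sn)) at 1.
      apply Rmult_le_compat_l; auto. now apply Rmult_le_pos.
      replace (Rabs (P * la - be) * (INR n * Rabs sn)) with (Rabs (P * la - be) * Rabs sn * INR n) by ring.
      apply Rmult_le_compat_l; auto. now apply Rmult_le_pos.
      apply Rmult_le_compat_r. lra. apply Rmult_le_compat_r; auto. unfold M; lra. }
    assert (Rabs (P * be / 2) * (INR n * cv) <= (M * cv) * Q).
    { replace (Rabs (P * be / 2) * (INR n * cv)) with (Rabs (P * be / 2) * cv * INR n) by ring.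
      apply Rmult_le_compat; auto. now apply Rmult_le_pos. apply Rmult_le_compat_r; auto. unfold M; lra. }
    lra. }
  set (rho := / (3 * M)).
  assert (Hrho : 0 < rho) by (apply Rinv_0_lt_compat; lra).
  assert (HrM : rho * M * 3 = 1) by (unfold rho; field; lra).
  assert (Hrho1 : rho <= 1) by nra.
  exists rho. split; auto. apply (CV_radius_ge s rho 1).
  set (a := fun n => Rabs (s n) * rho ^ n).
  assert (Ha : forall n, 0 <= a n) by (intros n; apply Rmult_le_pos; [apply Rabs_pos | apply pow_le; lra]).
  assert (Hs : forall N, rsum a (S N) <= 1).
  { induction N as [|N IH].
    - simpl. unfold a, s, quad_coef. simpl. rewrite Rabs_R0. lra.
    - rewrite rsum_S. unfold a at 1. unfold s at 1, quad_coef. simpl quad_table. rewrite Rabs_R0, Rmult_0_l, Rplus_0_l.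
      set (dl := fun n : nat => match n with 0%nat => 1 | _ => 0 end).
      set (cv := fun n => sum_f_R0 (fun i => a i * a (n - i)%nat) n).
      apply Rle_trans with (rsum (fun n => rho * M * (dl n + a n + cv n)) (S N)).
      + apply rsum_le. intros n. unfold a at 1.
        specialize (Hst n).
        assert (Hrn : 0 <= rho ^ n) by (apply pow_le; lra).
        apply Rle_trans with (rho * M * ((dl n + Rabs (s n) + sum_f_R0 (fun i => Rabs (s i) * Rabs (s (n - i)%nat)) n) * rho ^ n)).
        { rewrite <- tech_pow_Rmult.
          apply Rmult_le_compat_r with (r := rho * rho ^ n) in Hst. 2: apply Rmult_le_pos; lra.
          apply Rle_trans with (1 := Hst). unfold dl. right; ring. }
        apply Rmult_le_compat_l. apply Rmult_le_pos; lra.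
        rewrite !Rmult_plus_distr_r. apply Rplus_le_compat. apply Rplus_le_compat.
        unfold dl. destruct n; simpl; lra. unfold a; lra.
        unfold cv. rewrite Rmult_comm, scal_sum. right. apply sum_eq. intros i Hi. unfold a.
        replace (rho ^ n) with (rho ^ i * rho ^ (n - i)) by (rewrite <- pow_add; f_equal; lia). ring.
      + assert (E : forall k, rsum (fun n => rho * M * (dl n + a n + cv n)) k =
           rho * M * (rsum dl k + rsum a k + rsum cv k)).
        { induction k as [|k IHk]; simpl; [ring | rewrite IHk; ring]. }
        rewrite E.
        assert (Ed : forall k, rsum dl (S k) = 1).
        { intros k. rewrite rsum_S.
          assert (Z : forall j, rsum (fun i => dl (S i)) j = 0) by
            (induction j as [|j IHj]; cbn [rsum]; rewrite ?IHj; unfold dl; ring).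
          rewrite Z. unfold dl; ring. }
        rewrite Ed. pose proof (rsum_conv_le a a (S N) Ha Ha). fold cv in H3.
        pose proof (rsum_nonneg a (S N) Ha).
        assert (rsum a (S N) * rsum a (S N) <= 1) by nra.
        assert (0 <= rho * M) by (apply Rmult_le_pos; lra). nra. }
  intros n. rewrite Rabs_mult, (Rabs_pos_eq (rho ^ n)) by (apply pow_le; lra).
  apply Rle_trans with (2 := Hs n). cbn [rsum]. pose proof (rsum_nonneg a n Ha).
  change (a n <= rsum a n + a n). lra.
Qed.

Lemma sum_f_R0_rev (f : nat -> R) (n : nat) : sum_f_R0 (fun i => f (n - i)%nat) n = sum_f_R0 f n.
Proof.
  induction n as [|n IH]; auto. rewrite decomp_sum by lia. rewrite tech5, <- IH, Rplus_comm. auto.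
Qed.

Lemma quad_ode (P la be x : R) : 1 <= P -> let s := quad_coef P la be in
  Rbar_lt (Rabs x) (CV_radius s) ->
  - P * PSeries (PS_derive s) x =
  la - be * PSeries s x + (P * la - be) * (x * PSeries (PS_derive s) x)
  - P * be / 2 * (x * (2 * PSeries s x * PSeries (PS_derive s) x)).
Proof.
  intros HP s Hx.
  assert (Hd : Rbar_lt (Rabs x) (CV_radius (PS_derive s))) by now rewrite CV_radius_derive.
  assert (H1 := PSeries_correct _ _ (CV_radius_inside _ _ Hd)).
  assert (H2 := PSeries_correct _ _ (CV_radius_inside _ _ Hx)).
  assert (H3 := is_pseries_incr_1 _ _ _ H1).
  assert (H4 : is_pseries (PS_incr_1 (PS_mult s (PS_derive s))) x
     (x * (PSeries s x * PSeries (PS_derive s) x))).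
  { exact (is_pseries_incr_1 _ _ _ (is_pseries_mult _ _ _ _ _ H2 H1 Hx Hd)). }
  set (T := PSeries s x) in *. set (T' := PSeries (PS_derive s) x) in *.
  assert (H0 : is_pseries (fun n => match n with 0%nat => la | _ => 0 end) x la).
  { apply is_pseries_R, is_series_decr_1.
    apply (is_series_ext (fun _ => 0)). intros n. symmetry. apply Rmult_0_l.
    match goal with |- is_series _ ?l => replace l with 0 end. apply is_series_zero.
    unfold plus, opp; simpl. ring. }
  apply is_pseries_R in H0, H1, H2, H3, H4.
  assert (L : is_series (fun n => (- P) * (PS_derive s n * x ^ n)) (- P * T')).
  { exact (is_series_scal_l (-P) _ _ H1). }
  assert (Rr : is_series (fun n => (match n with 0%nat => la | _ => 0 end) * x ^ n +
     (- be * (s n * x ^ n) + ((P * la - be) * (PS_incr_1 (PS_derive s) n * x ^ n) +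
      - (P * be) * (PS_incr_1 (PS_mult s (PS_derive s)) n * x ^ n))))
     (la + (- be * T + ((P * la - be) * (x * T') + - (P * be) * (x * (T * T')))))).
  { apply (is_series_plus (fun n => (match n with 0%nat => la | _ => 0 end) * x ^ n)). exact H0.
    apply (is_series_plus (fun n => - be * (s n * x ^ n))). exact (is_series_scal_l (- be) _ _ H2).
    apply (is_series_plus (fun n => (P * la - be) * (PS_incr_1 (PS_derive s) n * x ^ n))).
    exact (is_series_scal_l (P * la - be) _ _ H3).
    exact (is_series_scal_l (- (P * be)) _ _ H4). }
  apply is_series_unique in L. apply is_series_unique in Rr.
  assert (E : - P * T' = la + (- be * T + ((P * la - be) * (x * T') + - (P * be) * (x * (T * T'))))).
  { rewrite <- L, <- Rr. apply Series_ext. intros n.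
    assert (En : PS_derive s n = INR (S n) * quad_step P la be n s).
    { unfold PS_derive. f_equal. apply quad_coef_S. }
    rewrite En. unfold quad_step.
    assert (E1 : PS_incr_1 (PS_derive s) n = INR n * s n).
    { destruct n; simpl PS_incr_1. unfold zero; simpl; ring. reflexivity. }
    assert (E2 : PS_incr_1 (PS_mult s (PS_derive s)) n = INR n * PS_mult s s n / 2).
    { destruct n as [|n]; simpl PS_incr_1. unfold zero; simpl. field.
      (* Symmetrize [sum_i s_i (j s_j)] over [i + j = n + 1]. *)
      set (F := fun i => s i * s (S n - i)%nat).
      assert (Ea : PS_mult s (PS_derive s) n = sum_f_R0 (fun i => INR (S n - i) * F i) (S n)).
      { rewrite tech5. rewrite Nat.sub_diag. simpl (INR 0). rewrite Rmult_0_l, Rplus_0_r.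
        apply sum_eq. intros i Hi. unfold PS_derive, F.
        replace (S (n - i)) with (S n - i)%nat by lia. ring. }
      assert (Eb : sum_f_R0 (fun i => INR (S n - i) * F i) (S n) = sum_f_R0 (fun i => INR i * F i) (S n)).
      { rewrite <- (sum_f_R0_rev (fun i => INR i * F i)). apply sum_eq. intros i Hi.
        unfold F. replace (S n - (S n - i))%nat with i by lia. ring. }
      assert (Ec : INR (S n) * PS_mult s s (S n) =
        sum_f_R0 (fun i => INR (S n - i) * F i) (S n) + sum_f_R0 (fun i => INR i * F i) (S n)).
      { rewrite <- sum_plus. unfold PS_mult. rewrite scal_sum. apply sum_eq. intros i Hi.
        unfold F. rewrite minus_INR by auto. ring. }
      rewrite Ec, Ea, <- Eb. match goal with |- ?a = ?b => change (@eq R a b) end. field. }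
    rewrite E1, E2. field. rewrite S_INR. pose proof (pos_INR n). split; lra. }
  rewrite E. field.
Qed.

(** The equation in the conclusion says that the spiral starting at distance r0 with r0^P = x meets
    the negative axis at distance r0 exp(T(x)). *)
Lemma half_return_exponent (P la be : R) : 1 <= P ->
  exists T rho, 0 < rho /\ analytic_at T 0 /\ T 0 = 0 /\
    forall x, Rabs x < rho -> exp (- (P * T x)) = 1 + la * x - be * x * T x.
Proof.
  intros HP. set (s := quad_coef P la be).
  destruct (quad_coef_radius P la be HP) as [rho [Hrho Hrad]]. fold s in Hrad.
  assert (Hin : forall x, Rabs x < rho -> Rbar_lt (Rabs x) (CV_radius s)).
  { intros x Hx. apply Rbar_lt_le_trans with (2 := Hrad). exact Hx. }
  exists (PSeries s), rho. split; auto.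
  assert (T0 : PSeries s 0 = 0) by (rewrite PSeries_0; reflexivity).
  split; [|split]; auto.
  - apply analytic_at_0. exists s, (rho / 2). split. lra. split; auto.
    apply Rbar_lt_le_trans with (2 := Hrad). simpl; lra.
  - intros x Hx.
    set (T := PSeries s) in *. set (T' := PSeries (PS_derive s)).
    assert (HT : forall y, Rabs y < rho -> is_derive T y (T' y)).
    { intros y Hy. apply is_derive_PSeries; auto. }
    (* A first integral: the differential equation says exactly that u' = 0, and u(0) = 1 gives back
       the equation before differentiation. *)
    set (u := fun y => (1 + la * y - be * y * T y) * exp (P * T y)).
    assert (Hu : forall y, Rabs y < rho -> is_derive u y 0).
    { intros y Hy. pose proof (quad_ode P la be y HP (Hin y Hy)) as O. cbv zeta in O.
      fold s in O. fold T in O. fold T' in O.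
      eapply is_derive_cast. apply is_derive_multR.
      apply is_derive_plusR. apply is_derive_plusR. apply @is_derive_const.
      apply is_derive_multR. apply @is_derive_const. apply @is_derive_id.
      apply (is_derive_ext (fun y => (- be * y) * T y)). intros t; simpl; ring.
      apply is_derive_multR. apply is_derive_multR. apply @is_derive_const. apply @is_derive_id.
      apply HT; auto.
      apply (is_derive_compR exp). apply is_derive_exp.
      apply is_derive_multR. apply @is_derive_const. apply HT; auto.
      unfold zero, one; simpl. 
      transitivity (exp (P * T y) * (la - be * T y - be * y * T' y + (1 + la * y - be * y * T y) * (P * T' y))).
      ring. replace (la - be * T y - be * y * T' y + (1 + la * y - be * y * T y) * (P * T' y)) with 0.
      ring. lra. }
    destruct (MVT_abs u (fun _ => 0) rho 0 x) as [z [_ [_ E]]]; auto.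
    rewrite Rabs_R0; auto.
    assert (Eu : u x = 1).
    { replace (u x) with (u 0) by lra. unfold u. rewrite T0, !Rmult_0_r, exp_0. ring. }
    unfold u in Eu. rewrite exp_Ropp. pose proof (exp_pos (P * T x)).
    apply Rmult_eq_reg_r with (exp (P * T x)). 2: lra. rewrite Eu. field. lra.
Qed.

(** * Polynomials in two variables *)

(* Sums over [sum_n] leave equations at a carrier that [ring] does not recognize as [R]. *)
Ltac ring_R := match goal with |- ?a = ?b => change (@eq R a b) end; ring.

Lemma sum_n_delta (a : nat -> R) (i N : nat) : (i <= N)%nat ->
  sum_n (fun k => if Nat.eq_dec k i then a k else 0) N = a i.
Proof.
  assert (Z : forall M, (M < i)%nat -> sum_n (fun k => if Nat.eq_dec k i then a k else 0) M = 0).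
  { induction M as [|M IH]; intros HM.
    rewrite sum_O. destruct (Nat.eq_dec 0 i); auto; lia.
    rewrite sum_SnR, IH by lia. destruct (Nat.eq_dec (S M) i). lia. ring_R. }
  induction N as [|N IH]; intros HN.
  - replace i with 0%nat by lia. rewrite sum_O. auto.
  - rewrite sum_SnR. destruct (Nat.eq_dec (S N) i) as [E|E].
    rewrite Z by lia. rewrite E. ring_R. rewrite IH by lia. ring_R.
Qed.

Lemma sum_n_trunc (a : nat -> R) (N k : nat) :
  sum_n (fun i => if le_dec i N then a i else 0) (N + k) = sum_n a N.
Proof.
  induction k as [|k IH].
  - rewrite Nat.add_0_r. apply sum_n_ext_loc. intros n Hn. destruct (le_dec n N); auto; lia.
  - rewrite Nat.add_succ_r, sum_SnR, IH. destruct (le_dec (S (N + k)) N). lia. ring_R.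
Qed.

Lemma poly2_monomial (k i j : nat) (c : R) : (k <= i + j)%nat ->
  is_poly2_order_ge k (fun x y => c * x ^ i * y ^ j).
Proof.
  intros Hk. exists (i + j)%nat, (fun i' j' => if Nat.eq_dec i' i then if Nat.eq_dec j' j then c else 0 else 0).
  split.
  - intros i' j' H. destruct (Nat.eq_dec i' i), (Nat.eq_dec j' j); auto. lia.
  - intros x y. symmetry.
    rewrite (sum_n_ext _ (fun i' => if Nat.eq_dec i' i then c * x ^ i' * y ^ j else 0)).
    apply (sum_n_delta (fun i' => c * x ^ i' * y ^ j)). lia.
    intros i'. destruct (Nat.eq_dec i' i).
    rewrite (sum_n_ext _ (fun j' => if Nat.eq_dec j' j then c * x ^ i' * y ^ j' else 0)).
    apply (sum_n_delta (fun j' => c * x ^ i' * y ^ j')). lia.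
    intros j'. destruct (Nat.eq_dec j' j); auto. ring_R.
    rewrite (sum_n_ext _ (fun _ => 0)). rewrite sum_n_const. ring_R.
    intros j'. ring_R.
Qed.

Lemma poly2_plus (k : nat) (P Q : R -> R -> R) :
  is_poly2_order_ge k P -> is_poly2_order_ge k Q -> is_poly2_order_ge k (fun x y => P x y + Q x y).
Proof.
  intros [N [c [Hc HP]]] [M [d [Hd HQ]]].
  assert (Tr : forall N M c (x y : R),
    sum_n (fun i => sum_n (fun j => (if le_dec i N then if le_dec j N then c i j else 0 else 0)
      * x ^ i * y ^ j) (N + M)) (N + M) = sum_n (fun i => sum_n (fun j => c i j * x ^ i * y ^ j) N) N).
  { clear. intros N M c x y. rewrite <- (sum_n_trunc _ N M). apply sum_n_ext. intros i.
    destruct (le_dec i N).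
    - rewrite <- (sum_n_trunc _ N M). apply sum_n_ext. intros j. destruct (le_dec j N); auto.
      ring_R.
    - rewrite (sum_n_ext _ (fun _ => 0)). rewrite sum_n_const. ring_R.
      intros j. ring_R. }
  exists (N + M)%nat, (fun i j => (if le_dec i N then if le_dec j N then c i j else 0 else 0) +
     (if le_dec i M then if le_dec j M then d i j else 0 else 0)).
  split.
  - intros i j H. rewrite Hc, Hd by auto.
    destruct (le_dec i N), (le_dec j N), (le_dec i M), (le_dec j M); ring_R.
  - intros x y. rewrite HP, HQ, <- (Tr N M c x y), <- (Tr M N d x y), (Nat.add_comm M N).
    rewrite <- (sum_n_plus (G := R_AbelianMonoid)).
    apply sum_n_ext. intros i. rewrite <- (sum_n_plus (G := R_AbelianMonoid)).
    apply sum_n_ext. intros j. unfold plus; simpl.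
    ring_R.
Qed.

Lemma poly2_ext (k : nat) (P Q : R -> R -> R) : (forall x y, P x y = Q x y) ->
  is_poly2_order_ge k P -> is_poly2_order_ge k Q.
Proof.
  intros E [N [c [Hc HP]]]. exists N, c. split; auto. intros x y. now rewrite <- E.
Qed.

Lemma poly2_sum (k n : nat) (F : nat -> R -> R -> R) :
  (forall i, (i <= n)%nat -> is_poly2_order_ge k (F i)) ->
  is_poly2_order_ge k (fun x y => sum_f_R0 (fun i => F i x y) n).
Proof.
  intros H; induction n as [|n IH]; simpl. apply H; auto.
  apply poly2_plus; auto.
Qed.

Lemma poly2_radial (m : nat) (a b : R) : (1 <= m)%nat ->
  is_poly2_order_ge 2 (fun x y => (a * x + b * y) * (x ^ 2 + y ^ 2) ^ m).
Proof.
  intros Hm.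
  apply (poly2_ext 2 (fun x y => sum_f_R0 (fun i => (a * Binomial.C m i) * x ^ S (2 * i) * y ^ (2 * (m - i))
     + (b * Binomial.C m i) * x ^ (2 * i) * y ^ S (2 * (m - i))) m)).
  - intros x y. rewrite binomial, scal_sum. apply sum_eq. intros i Hi.
    rewrite <- (tech_pow_Rmult x (2 * i)), <- (tech_pow_Rmult y (2 * (m - i))), !pow_mult. ring.
  - apply poly2_sum. intros i Hi. apply poly2_plus; apply poly2_monomial; lia.
Qed.

(** * Explicit orbits of the spiral and of the linear centre *)

(* The system is [theta' = 1 - (be / p) r^(2m)], [r' = c r^(2m + 1)] with [c = - la / (p PI)],
   so [r(t)^(- 2m)] is affine in [t], and the half turn is completed at the time [Th] below. *)
Lemma half_return_spiral (m : nat) (la be x tau : R) :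
  (1 <= m)%nat -> 0 < x -> la <> 0 ->
  let p := INR (2 * m) in let eps := x ^ (2 * m) in
  exp (- (p * tau)) = 1 + la * eps - be * eps * tau ->
  / 2 <= exp (- (p * tau)) -> Rabs (be * tau / la) < 1 -> Rabs (be * eps / p) < / 4 ->
  half_return
    (fun u v => (- la / (p * PI) * u + be / p * v) * (u ^ 2 + v ^ 2) ^ m)
    (fun u v => (- be / p * u + - la / (p * PI) * v) * (u ^ 2 + v ^ 2) ^ m)
    x (- (x * exp tau)).
Proof.
  intros Hm Hx Hla p eps Heq Hhalf Hsm1 Hsm2.
  pose proof PI_RGT_0 as HPI.
  assert (Hp : 0 < p) by (apply lt_0_INR; lia).
  (* Obtained by solving th(Th) = PI, with th(t) = t - d ln(w(t)) as below and ln(w(Th)) = -p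
     tau. *)
  set (Th := PI * (1 - be * tau / la)).
  assert (HTh : 0 < Th) by (apply Rabs_def2 in Hsm1; unfold Th; apply Rmult_lt_0_compat; lra).
  (* [w] is (r(t) / x)^(-2m). At time [Th] it equals 1 + la eps - be eps tau, so the hypothesis on
     [tau] says that the final radius is x exp(tau). *)
  set (a := la * eps / PI). set (w := fun t => 1 + a * t).
  assert (HwT : w Th = exp (- (p * tau))).
  { rewrite Heq. unfold w, a, Th. field. split; lra. }
  (* An affine function is bounded below by its end values, here 1 and exp(-p tau). *)
  assert (Hw : forall t, 0 <= t <= Th -> / 2 <= w t).
  { intros t Ht. rewrite <- HwT in Hhalf. unfold w in *.
    destruct (Rle_or_lt 0 a). nra. nra. }
  assert (Hdw : forall t, is_derive w t a).
  { intros t. unfold w. auto_derive; auto. ring. }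
  set (r := fun t => x * exp (- (ln (w t) / p))).
  (* The angular speed is 1 - (be / p) eps / w, and eps / w integrates to (eps / a) ln(w) = (PI /
     la) ln(w). *)
  set (d := be * PI / (p * la)).
  set (th := fun t => t - d * ln (w t)).
  assert (Hdln : forall t, 0 <= t <= Th -> is_derive (fun t => ln (w t)) t (/ w t * a)).
  { intros t Ht. apply is_derive_compR; auto. apply is_derive_ln. specialize (Hw t Ht). lra. }
  assert (Hdr : forall t, 0 <= t <= Th -> is_derive r t (- la / (p * PI) * (eps / w t) * r t)).
  { intros t Ht. specialize (Hw t Ht). eapply is_derive_cast.
    apply is_derive_multR. apply @is_derive_const.
    apply (is_derive_compR exp). apply is_derive_exp.
    apply (is_derive_ext (fun t => - / p * ln (w t))). intros s; simpl; field; lra.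
    apply is_derive_multR. apply @is_derive_const. apply Hdln; auto.
    unfold zero, r, a; simpl. field. repeat split; lra. }
  assert (Hdth : forall t, 0 <= t <= Th -> is_derive th t (1 - be / p * (eps / w t))).
  { intros t Ht. specialize (Hw t Ht). eapply is_derive_cast.
    apply (is_derive_ext (fun t => t + - d * ln (w t))). intros s; unfold th; ring_R.
    apply is_derive_plusR. apply @is_derive_id. apply is_derive_multR. apply @is_derive_const.
    apply Hdln; auto.
    unfold zero, one, d, a; simpl. field. repeat split; lra. }
  assert (Hrp : forall t, 0 <= t <= Th -> forall c s, c ^ 2 + s ^ 2 = 1 ->
    ((r t * c) ^ 2 + (r t * s) ^ 2) ^ m = eps / w t).
  { intros t Ht c s Hcs. specialize (Hw t Ht).
    replace ((r t * c) ^ 2 + (r t * s) ^ 2) with (r t ^ 2 * (c ^ 2 + s ^ 2)) by ring.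
    rewrite Hcs, Rmult_1_r, <- pow_mult. unfold r. rewrite Rpow_mult_distr. fold eps.
    unfold Rdiv at 2. f_equal. rewrite <- Rpower_pow by apply exp_pos. unfold Rpower. rewrite ln_exp.
    fold p. replace (p * - (ln (w t) / p)) with (- ln (w t)) by (field; lra).
    rewrite exp_Ropp, exp_ln; lra. }
  assert (Hcs : forall y, cos y ^ 2 + sin y ^ 2 = 1).
  { intros y. pose proof (sin2_cos2 y) as E. unfold Rsqr in E. lra. }
  assert (Hthpos : forall t, 0 <= t <= Th -> 0 < 1 - be / p * (eps / w t)).
  { intros t Ht. specialize (Hw t Ht).
    assert (Hiw : 0 < / w t <= 2).
    { split. apply Rinv_0_lt_compat; lra. replace 2 with (/ / 2) by field. apply Rinv_le_contravar; lra. }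
    replace (be / p * (eps / w t)) with (be * eps / p * / w t) by (field; lra).
    apply Rabs_def2 in Hsm2. nra. }
  (* The angle stays strictly between 0 and PI before [Th], so the ordinate is positive there and no
     earlier crossing of the axis can occur. *)
  assert (Hmono : forall s t, 0 <= s -> s < t -> t <= Th -> th s < th t).
  { intros s t Hs Hst Ht.
    destruct (MVT_gen th s t (fun t => 1 - be / p * (eps / w t))) as [z [Hz Ez]].
    intros y Hy. rewrite Rmin_left, Rmax_right in Hy by lra. apply Hdth; lra.
    intros y Hy. rewrite Rmin_left, Rmax_right in Hy by lra. eapply is_derive_continuity_pt, Hdth; lra.
    rewrite Rmin_left, Rmax_right in Hz by lra.
    assert (0 < (1 - be / p * (eps / w z)) * (t - s)); [|lra].
    apply Rmult_lt_0_compat. apply Hthpos; lra. lra. }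
  assert (Hth0 : th 0 = 0).
  { unfold th, w. rewrite Rmult_0_r, Rplus_0_r, ln_1. ring. }
  assert (HthT : th Th = PI).
  { unfold th. rewrite HwT, ln_exp. unfold Th, d. field. split; lra. }
  assert (Hrpos : forall t, 0 < r t) by (intros t; apply Rmult_lt_0_compat; [lra | apply exp_pos]).
  exists Th, (fun t => r t * cos (th t)), (fun t => r t * sin (th t)).
  split; auto. split; [|split; [|split; [|split; [|split; [|split]]]]].
  - intros t Ht. rewrite !(Hrp t Ht _ _ (Hcs (th t))). split; eapply is_derive_cast.
    + apply is_derive_multR. apply Hdr; auto. apply (is_derive_compR cos th). apply is_derive_cos.
      apply Hdth; auto.
    + simpl. ring.
    + apply is_derive_multR. apply Hdr; auto. apply (is_derive_compR sin th). apply is_derive_sin.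
      apply Hdth; auto.
    + simpl. unfold Rdiv. ring.
  - rewrite Hth0, cos_0. unfold r, w. rewrite Rmult_0_r, Rplus_0_r, ln_1.
    unfold Rdiv. rewrite Rmult_0_l, Ropp_0, exp_0. ring.
  - rewrite Hth0, sin_0. ring.
  - intros t Ht [_ Hv].
    assert (0 < sin (th t)).
    { apply sin_gt_0. rewrite <- Hth0. apply Hmono; lra. rewrite <- HthT. apply Hmono; lra. }
    pose proof (Rmult_lt_0_compat _ _ (Hrpos t) H). lra.
  - pose proof (exp_pos tau). pose proof (Rmult_lt_0_compat _ _ Hx H). lra.
  - rewrite HthT, cos_PI. unfold r. rewrite HwT, ln_exp.
    replace (- (- (p * tau) / p)) with tau by (field; lra). ring.
  - rewrite HthT, sin_PI. ring.
Qed.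

Lemma half_return_center (x : R) : 0 < x -> half_return (fun _ _ => 0) (fun _ _ => 0) x (- x).
Proof.
  intros Hx. exists PI, (fun t => x * cos t), (fun t => x * sin t).
  split. apply PI_RGT_0. split; [|split; [|split; [|split; [|split; [|split]]]]].
  - intros t _. split; auto_derive; auto; ring.
  - rewrite cos_0. ring.
  - rewrite sin_0. ring.
  - intros t Ht [_ H]. pose proof (Rmult_lt_0_compat _ _ Hx (sin_gt_0 t (proj1 Ht) (proj2 Ht))). lra.
  - lra.
  - rewrite cos_PI. ring.
  - rewrite sin_PI. ring.
Qed.

(** * The involutive case, the realization of the model and the theorem *)

Lemma analytic_plus (f g : R -> R) : analytic_at f 0 -> analytic_at g 0 ->
  analytic_at (fun x => f x + g x) 0.
Proof.
  intros [a Ha] [b Hb]. exists (PS_plus a b).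
  generalize (filter_and _ _ Ha Hb). apply filter_imp. intros x [H1 H2].
  exact (is_pseries_plus _ _ _ _ _ H1 H2).
Qed.

Lemma analytic_opp (f : R -> R) : analytic_at f 0 -> analytic_at (fun x => - f x) 0.
Proof.
  intros [a Ha]. exists (PS_opp a). revert Ha. apply filter_imp. intros x H.
  exact (is_pseries_opp _ _ _ H).
Qed.

Lemma involution_conjugate (r : R) (f : R -> R) : 0 < r -> smooth_on r f -> f 0 = 0 -> Derive f 0 = -1 ->
  (forall x, Rabs x < r -> f (f x) = x) -> smooth_conjugate_at0 f (fun x => - x).
Proof.
  intros Hr Hf Hf0 Hf1 Hff.
  set (h := fun x => / 2 * (x - f x)).
  assert (Hh : smooth_on r h) by (intros n; apply Ck_scal, Ck_minus; [apply Ck_id | apply Hf]).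
  assert (Hh0 : h 0 = 0) by (unfold h; rewrite Hf0; ring).
  assert (Hh1 : Derive h 0 = 1).
  { apply is_derive_unique. eapply is_derive_cast. apply is_derive_multR. apply @is_derive_const.
    apply (is_derive_minus (fun x => x) f). apply @is_derive_id.
    apply (smooth_on_Derive r f Hf). now rewrite Rabs_R0.
    rewrite Hf1. unfold minus, plus, opp, one, zero; simpl. field. }
  destruct (smooth_local_inverse r h) as [e [r1 [g [He [Hr1 [Hg [Hg0 [Hi1 Hi2]]]]]]]]; auto.
  rewrite Hh1; lra.
  exists h, g. split; auto. split; auto.
  split. now apply (smooth_on_near r). split. now apply (smooth_on_near r1).
  split; [|split].
  - destruct (smooth_small r r1 h) as [s [Hs Hs']]; auto.
    apply locally_0_abs. exists (Rmin s e). pose proof (Rmin_l s e). pose proof (Rmin_r s e).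
    split. apply Rmin_pos; lra. intros x Hx. apply Hi2. lra.
    specialize (Hs' x ltac:(lra)). now rewrite Hh0, Rminus_0_r in Hs'.
  - apply locally_0_abs. exists r1. split; auto. intros y Hy. now apply Hi1.
  - apply locally_0_abs. exists r. split; auto. intros x Hx. unfold h. rewrite Hff by auto. ring.
Qed.

(** As the exponent is a function of x^(2m), its equation holds on both sides of 0, although the
    orbits are followed from positive x. The conjugacy needs both sides, since it compares [Pi] with
    [f] also at negative points. *)
Lemma half_return_realization (m : nat) (k b : R) : (1 <= m)%nat -> k <> 0 ->
  exists P Q Pi tau rt, is_poly2_order_ge 2 P /\ is_poly2_order_ge 2 Q /\
    is_half_return_map P Q Pi /\ 0 < rt /\
    (forall x, Rabs x < rt -> Rabs (tau x) <= 1 /\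
       k * (exp (- (INR (2 * m) * tau x)) - 1) + b * x ^ (2 * m) * tau x = x ^ (2 * m) / 2) /\
    (forall x, Pi x = - (x * exp (tau x))).
Proof.
  (* These values turn exp(-p tau) = 1 + la x^(2m) - be x^(2m) tau, multiplied by k, into the
     translation by 1/2 in the coordinate k / y^(2m) + b ln|y|. *)
  intros Hm Hk. set (p := INR (2 * m)). set (be := b / k). set (la := / (2 * k)).
  assert (Hp : 1 <= p) by (apply (le_INR 1); lia).
  assert (Hla : la <> 0) by (apply Rinv_neq_0_compat; lra).
  destruct (half_return_exponent p la be Hp) as [T [rho [Hrho [HTa [HT0 HT]]]]].
  set (tau := fun x => T (x ^ (2 * m))).
  assert (Z : 0 ^ (2 * m) = 0) by (apply pow_ne_zero; lia).
  assert (Htau : analytic_at tau 0).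
  { apply (analytic_comp T (fun x => x ^ (2 * m))); auto. apply analytic_pow. }
  assert (Htau0 : tau 0 = 0) by (unfold tau; now rewrite Z).
  destruct (analytic_smooth tau Htau) as [r [Hr Hts]].
  destruct (smooth_small r 1 tau) as [r1 [Hr1 H1]]; auto. lra.
  destruct (smooth_small r rho (fun x => x ^ (2 * m))) as [r2 [Hr2 H2]]; auto. apply smooth_on_pow.
  destruct (smooth_small r (/ 2) (fun x => exp (- (p * tau x)))) as [r3 [Hr3 H3]]; auto. lra.
  { intros n. apply Ck_exp, Ck_opp, Ck_scal, Hts. }
  destruct (smooth_small r 1 (fun x => (be / la) * tau x)) as [r4 [Hr4 H4]]; auto. lra.
  { intros n. apply Ck_scal, Hts. }
  destruct (smooth_small r (/ 4) (fun x => (be / p) * x ^ (2 * m))) as [r5 [Hr5 H5]]; auto. lra.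
  { intros n. apply Ck_scal, smooth_on_pow. }
  rewrite Htau0 in H1. rewrite Z in H2. rewrite Htau0, Rmult_0_r, Ropp_0, exp_0 in H3.
  rewrite Htau0, Rmult_0_r in H4. rewrite Z, Rmult_0_r in H5.
  set (rt := Rmin (Rmin r1 r2) (Rmin r3 (Rmin r4 r5))).
  assert (HL : rt <= r1 /\ rt <= r2 /\ rt <= r3 /\ rt <= r4 /\ rt <= r5).
  { unfold rt. pose proof (Rmin_l (Rmin r1 r2) (Rmin r3 (Rmin r4 r5))).
    pose proof (Rmin_r (Rmin r1 r2) (Rmin r3 (Rmin r4 r5))).
    pose proof (Rmin_l r1 r2). pose proof (Rmin_r r1 r2).
    pose proof (Rmin_l r3 (Rmin r4 r5)). pose proof (Rmin_r r3 (Rmin r4 r5)).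
    pose proof (Rmin_l r4 r5). pose proof (Rmin_r r4 r5). repeat split; lra. }
  assert (Hrt : 0 < rt) by (unfold rt; repeat apply Rmin_pos; lra).
  assert (HE : forall x, Rabs x < rt ->
    exp (- (p * tau x)) = 1 + la * x ^ (2 * m) - be * x ^ (2 * m) * tau x).
  { intros x Hx. apply HT. specialize (H2 x ltac:(lra)). now rewrite Rminus_0_r in H2. }
  exists (fun u v => (- la / (p * PI) * u + be / p * v) * (u ^ 2 + v ^ 2) ^ m),
    (fun u v => (- be / p * u + - la / (p * PI) * v) * (u ^ 2 + v ^ 2) ^ m),
    (fun x => - (x * exp (tau x))), tau, rt.
  split. now apply poly2_radial. split. now apply poly2_radial.
  split; [split|split; [|split]]; auto.
  - apply analytic_opp, analytic_mult. apply analytic_id.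
    apply (analytic_comp exp tau); auto. apply analytic_exp.
  - exists rt. split; auto. intros x [Hx0 Hx].
    assert (Hxa : Rabs x < rt) by (rewrite Rabs_pos_eq; lra).
    apply half_return_spiral; auto.
    + specialize (H3 x ltac:(lra)). apply Rabs_def2 in H3. unfold p in *. lra.
    + specialize (H4 x ltac:(lra)). rewrite Rminus_0_r in H4.
      replace (be * tau x / la) with (be / la * tau x) by (field; auto). auto.
    + specialize (H5 x ltac:(lra)). rewrite Rminus_0_r in H5.
      replace (be * x ^ (2 * m) / INR (2 * m)) with (be / p * x ^ (2 * m)); auto.
      unfold p. field. unfold p in Hp. lra.
  - intros x Hx. split. specialize (H1 x ltac:(lra)). rewrite Rminus_0_r in H1. lra.
    fold p. rewrite HE by auto. unfold la, be. field. auto.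
Qed.

Theorem proposition10 (f : R -> R)
    (hf : analytic_at f 0) (hf0 : f 0 = 0) (hf1 : is_derive f 0 (-1)) :
  exists P Q : R -> R -> R,
    is_poly2_order_ge 2 P /\ is_poly2_order_ge 2 Q /\
    exists Pi : R -> R,
      is_half_return_map P Q Pi /\ smooth_conjugate_at0 f Pi.
Proof.
  assert (Hf1 : Derive f 0 = -1) by now apply is_derive_unique.
  destruct (analytic_smooth f hf) as [r0 [Hr0 Hf]].
  set (D := fun x => f (f x) + - x).
  assert (HD : analytic_at D 0).
  { apply analytic_plus. now apply analytic_comp. apply analytic_opp, analytic_id. }
  destruct (analytic_order D HD) as [[r1 [Hr1 HZ]]|[r1 [n [B [Hr1 [HB [HB0 HDB]]]]]]].
  - exists (fun _ _ => 0), (fun _ _ => 0).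
    assert (Hz : is_poly2_order_ge 2 (fun _ _ => 0)).
    { apply (poly2_ext 2 (fun x y => 0 * x ^ 2 * y ^ 0)). intros; ring.
      apply poly2_monomial. lia. }
    split; auto. split; auto. exists (fun x => - x). split.
    + split. apply analytic_opp, analytic_id. exists 1. split. lra.
      intros x Hx. apply half_return_center, Hx.
    + pose proof (Rmin_l r0 r1). pose proof (Rmin_r r0 r1).
      apply (involution_conjugate (Rmin r0 r1)); auto. now apply Rmin_pos.
      now apply (smooth_on_shrink r0).
      intros x Hx. specialize (HZ x ltac:(lra)). unfold D in HZ. lra.
  - set (r := Rmin r0 r1). pose proof (Rmin_l r0 r1). pose proof (Rmin_r r0 r1). fold r in H, H0.
    assert (Hr : 0 < r) by now apply Rmin_pos.
    apply (smooth_on_shrink r0 r) in Hf; auto. apply (smooth_on_shrink r1 r) in HB; auto.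
    assert (R00 : Rabs 0 < r) by now rewrite Rabs_R0.
    assert (Hff : forall x, Rabs x < r -> f (f x) = x + x ^ n * B x).
    { intros x Hx. rewrite <- HDB by lra. unfold D. ring. }
    (* Order 0 contradicts f(f(0)) = 0, and order 1 contradicts the derivative (-1)(-1) = 1 of the
       square at 0, since B(0) <> 0. *)
    assert (Hn : (2 <= n)%nat).
    { destruct n as [|[|n]]; [exfalso|exfalso|lia].
      - specialize (Hff 0 R00). rewrite !hf0 in Hff. simpl in Hff. lra.
      - assert (E : is_derive (fun x => f (f x)) 0 1).
        { eapply is_derive_cast. apply (is_derive_compR f f). rewrite hf0. exact hf1. exact hf1. ring. }
        assert (E2 : is_derive (fun x => f (f x)) 0 (1 + B 0)).
        { apply (is_derive_ext_loc (fun x => x + x * B x)).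
          generalize (locally_abs_lt r 0 R00). apply filter_imp. intros x Hx. rewrite Hff by auto.
          rewrite pow_1. auto.
          eapply is_derive_cast. apply is_derive_plusR. apply @is_derive_id.
          apply is_derive_multR. apply @is_derive_id. now apply (smooth_on_Derive r B).
          unfold one; simpl. ring. }
        apply is_derive_unique in E. apply is_derive_unique in E2. lra. }
    destruct (square_order_odd r n B f Hr Hf hf0 Hf1 HB HB0 Hn Hff) as [m [Hm En]].
    destruct (fatou_reversing r (2 * m) B f) as [r' [K [b [Hr' [HK [HK0 HF]]]]]]; auto.
    + lia.
    + intros x. rewrite pow_mult. apply pow_le, pow2_ge_0.
    + intros x Hx. rewrite Hff, En by auto. rewrite <- tech_pow_Rmult. ring.
    + destruct (half_return_realization m (K 0) b Hm HK0)
        as [P [Q [Pi [tau [rt [HP [HQ [HPi [Hrt [Htau HPe]]]]]]]]]].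
      exists P, Q. split; auto. split; auto. exists Pi. split; auto.
      pose proof (Rmin_l r r'). pose proof (Rmin_r r r').
      apply (conjugate_of_fatou (Rmin r r') rt m K f tau Pi b); auto.
      * now apply Rmin_pos.
      * now apply (smooth_on_shrink r).
      * now apply (smooth_on_shrink r').
      * intros x Hx0 Hx. apply HF; auto. lra.
Qed.
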